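(* Let $p\in(1,\infty)$ and let $\psi_m^D$ and $\psi_m^S$ be the Daubechies orthonormal wavelet and the semiorthogonal spline wavelet of order $m$, respectively. Then $$\lim_{k\to\infty}\lim_{m\to\infty}\left(\frac{C_{k,p}(\psi_m^S)}{C_{k,p}(\psi_m^D)}\right)^{1/k}=\frac{\pi}{2\pi-4\xi_2}=0.61098\ldots,$$ where $\xi_2=0.2853\ldots$ is the unique solution of $(2\pi\xi_2-4\xi_2^2)\cos(2\xi_2)+(3\xi_2-\pi)\sin(2\xi_2)=0$ in $(0,\pi/2)$.
   Context: The Fourier transform is $\widehat f(\omega)=\frac{1}{\sqrt{2\pi}}\int_{\mathbb{R}}f(x)e^{-i x\omega}\,dx$; $\|\cdot\|_p$ is the $L_p(\mathbb{R})$ norm. For an integer $k$, ${}_kf$ denotes the function with $\widehat{{}_kf}(\omega)=(i\omega)^{-k}\widehat f(\omega)$, and $C_{k,p}(f)=\|\widehat{{}_kf}\|_p/\|\widehat f\|_p$. Daubechies wavelets: $H_m$ is the Daubechies orthonormal low-pass mask of order $m$, a $2\pi$-periodic trigonometric polynomial $H_m(t)=\sum_{\nu=0}^L h_\nu e^{-i\nu t}$ with $|H_m(t)|^2=1-c_m\int_0^t\sin^{2m-1}\omega\,d\omega$, $c_m=\left(\int_0^\pi\sin^{2m-1}\omega\,d\omega\right)^{-1}$ (equivalently $|H_m(t)|^2=\cos^{2m}(t/2)\sum_{\nu=0}^{m-1}\binom{m-1+\nu}{\nu}\sin^{2\nu}(t/2)$), normalized by $H_m(0)=1$; and $\widehat{\psi_m^D}(\omega)=\frac{1}{\sqrt{2\pi}}H_m(\omega/2+\pi)\prod_{\ell=1}^\infty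 H_m(2^{-\ell-1}\omega)$. Spline wavelets: $N_m(x)=\frac{1}{(m-1)!}\sum_{\nu=0}^m(-1)^\nu\binom{m}{\nu}(x-\nu)_+^{m-1}$ is the B-spline of order $m$, and $\psi_m^S(x)=\sum_{\nu=0}^{2m-2}\frac{(-1)^\nu}{2^{m-1}}N_{2m}(\nu+1)N_{2m}^{(m)}(2x-\nu)$, where $N_{2m}^{(m)}$ is the $m$-th derivative of $N_{2m}$. *)

(* Defs.v *)
From HB Require Import structures.
From mathcomp Require Import all_boot all_order all_algebra.
From mathcomp Require Import complex.
From mathcomp Require Import all_classical all_reals all_analysis.

Set Implicit Arguments.
Unset Strict Implicit.
Unset Printing Implicit Defensive.

Import Order.TTheory GRing.Theory Num.Theory.
Import numFieldNormedType.Exports.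

Local Open Scope classical_set_scope.
Local Open Scope complex_scope.
Local Open Scope ring_scope.

Section fourier.
Context {R : realType}.
Local Notation mu := (@lebesgue_measure R).

(* the complex modulus, as a real number *)
Definition cmod (z : R[i]) : R := ComplexField.Normc.normc z.

(* exp(i t) *)
Definition cis (t : R) : R[i] := cos t +i* sin t.

Definition cintegrable (f : R -> R[i]) : Prop :=
  mu.-integrable setT (fun x => (complex.Re (f x))%:E) /\
  mu.-integrable setT (fun x => (complex.Im (f x))%:E).

Definition cintegral (f : R -> R[i]) : R[i] :=
  (\int[mu]_x complex.Re (f x)) +i* (\int[mu]_x complex.Im (f x)).

Definition fourier (f : R -> R[i]) (w : R) : R[i] :=
  ((Num.sqrt (2 * pi))^-1)%:C * cintegral (fun x => f x * cis (- (x * w))).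

(* [fourier_prim k f] is the Fourier transform of the function written _k f:
   for k >= 1 a k-fold primitive of f, for k <= -1 a derivative. *)
Definition fourier_prim (k : int) (f : R -> R[i]) (w : R) : R[i] :=
  ('i * w%:C) ^ (- k) * fourier f w.

Definition cLnorm (p : R) (g : R -> R[i]) : \bar R :=
  'N[mu]_(p%:E)[EFin \o (cmod \o g)]%E.

(* C_{k,p}(f), in [0, +oo]: [fourier_prim k f] need not be in L_p when f has
   fewer than k vanishing moments. *)
Definition Ckp (k : int) (p : R) (f : R -> R[i]) : \bar R :=
  (cLnorm p (fourier_prim k f) / cLnorm p (fourier f))%E.

End fourier.

Section daubechies.
Context {R : realType}.
Local Notation mu := (@lebesgue_measure R).

(* oriented integral of f from a to b, also for b < a *)
Definition integral_from_to (a b : R) (f : R -> R) : R :=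
  if a <= b then \int[mu]_(x in `[a, b]) f x
  else - \int[mu]_(x in `[b, a]) f x.

Definition daubechies_c (m : nat) : R :=
  (integral_from_to 0 pi (fun w => sin w ^+ m.*2.-1))^-1.

(* The modulus and the value at 0 leave the phase of the mask free: every
   spectral factor qualifies, whatever its length and whether its coefficients
   are real or complex. Meaningful for m >= 1. *)
Definition is_daubechies_mask (m : nat) (H : R -> R[i]) : Prop :=
  [/\ exists (L : nat) (h : nat -> R[i]), forall t,
        H t = \sum_(nu < L.+1) h nu * cis (- (nu%:R * t)),
      forall t, cmod (H t) ^+ 2 =
        1 - daubechies_c m * integral_from_to 0 t (fun w => sin w ^+ m.*2.-1)
    & H 0 = 1].

(* [psi] is the wavelet generated by the mask [H]: its Fourier transform at w is
   (2 pi)^(-1/2) H(w/2 + pi) prod_(l >= 1) H(2^(-l-1) w), the infinite product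
   being the limit of its partial products. [^o] gives R[i] the topology of its
   modulus. *)
Definition is_wavelet_of_mask (H : R -> R[i]) (psi : R -> R[i]) : Prop :=
  cintegrable psi /\
  forall w : R,
    ((fun n : nat => ((Num.sqrt (2 * pi))^-1)%:C * H (w / 2 + pi) *
        \prod_(1 <= l < n.+1) H (w / 2 ^+ l.+1)) : nat -> (R[i])^o) @ \oo
      --> (fourier psi w : (R[i])^o).

Definition is_daubechies_wavelet (m : nat) (psi : R -> R[i]) : Prop :=
  exists2 H : R -> R[i], is_daubechies_mask m H & is_wavelet_of_mask H psi.

End daubechies.

Section spline.
Context {R : realType}.

(* x_+^n, with x_+^0 the indicator function of [0, +oo[ *)
Definition tpow (x : R) (n : nat) : R := if 0 <= x then x ^+ n else 0.

Definition bspline (m : nat) (x : R) : R :=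
  (m.-1`!)%:R^-1 *
  \sum_(nu < m.+1) (-1) ^+ nu * 'C(m, nu)%:R * tpow (x - nu%:R) m.-1.

(* The sum runs over nu = 0, ..., 2m-2; meaningful for m >= 1. *)
Definition spline_wavelet (m : nat) (x : R) : R :=
  \sum_(nu < m.*2.-1) (-1) ^+ nu / 2 ^+ m.-1 *
    bspline m.*2 (nu.+1)%:R * derive1n m (bspline m.*2) (2 * x - nu%:R).

Definition spline_waveletC (m : nat) (x : R) : R[i] := (spline_wavelet m x)%:C.

End spline.

Definition xi2_eqn {R : realType} (x : R) : Prop :=
  (2 * pi * x - 4 * x ^+ 2) * cos (2 * x) + (3 * x - pi) * sin (2 * x) = 0.

(* Main.v *)
(** The phases of the two wavelets play no role: both ratios only depend on the
    moduli of the Fourier transforms.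

    For the Daubechies wavelets, [|H_m|^2] tends to the indicator function of
    the frequencies with positive cosine, so that [sqrt (2 pi) |psi^|] tends
    almost everywhere to the indicator function of the band
    [pi < |w| < 2 pi], with the domination [C / (1 + w^2)] uniformly in the
    order. Hence [C_{k,p}] tends to [(L_k / L_0)^(1/p)], where [L_k] is the
    integral of [|w|^(-k p)] over the band; its [k]-th root tends to [1 / pi].

    For the spline wavelets, [sqrt (2 pi) |psi^(w)|] is the modulus of an Euler
    spline at [-e^(-i w/2)] times [(4 sin(w/4)^2 / |w|)^m]. The Euler spline is
    a quasi-periodic function obtained by repeated integration: with
    [d = pi - w/2], one integration multiplies its distance to a multiple of an
    exponential by at most [|d| / 2], and the multiple itself by
    [sin(d/2) / (d/2)]. The modulus thus grows like the [m]-th power of an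
    explicit rate in [w], which is maximal exactly at [|w| = 2 pi - 4 xi_2],
    and the mass of [|psi^|^p] concentrates there: [C_{k,p}] tends to
    [(2 pi - 4 xi_2)^(-k)]. *)
Require Import Defs.
From HB Require Import structures.
From mathcomp Require Import all_boot all_order all_algebra.
From mathcomp Require Import complex.
From mathcomp Require Import all_classical all_reals all_analysis.
From mathcomp Require Import measurable_realfun ring lra zify.

Set Implicit Arguments.
Unset Strict Implicit.
Unset Printing Implicit Defensive.

Import Order.TTheory GRing.Theory Num.Theory.
Import numFieldNormedType.Exports.

Local Open Scope classical_set_scope.
Local Open Scope complex_scope.
Local Open Scope ring_scope.

(** * Trigonometric estimates *)

Section derivative_tests.
Context {R : realType}.
Implicit Types (f df : R -> R) (a b x : R).

(** The asymptotics of the Euler spline are usable only where the multiplier [2 sin(x/2) / x] beats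
    the error rate [x / 2]; here [x = pi - |w|/2] ranges up to [31/20]. At the other frequencies
    only the trivial bound 1 on the Euler spline is at hand, which leaves the rate
    [4 sin(w/4)^2 / |w|]: at most [0.68] for [|w| <= 16/5] and at most [2/3] for [|w| >= 6]. The
    maximum of the true rate is about [0.697]. The constant [69/100], which fits between these
    numbers, is what makes the crude bounds sufficient.

    The factor [|w|^(-k)] is singular at 0, so that [k] of the powers supplied by the order must be
    spent against it near 0; hence the assumptions [k <= n] and the exponents [n - k].

    For the Daubechies wavelets the order only enters through a power: the squared mask is at most
    the [n]-th power of a function free of [n]. A fixed number of these powers already makes the
    dyadic product decay like [w^(-2)], and the others are discarded.

    All dominations have the form [M / (1 + w^2)]; the assumption [p > 1] keeps this form after
    raising to the power [p]. *)

Lemma is_derive_continuous_within f df a b :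
  (forall x, a <= x <= b -> is_derive x 1 f (df x)) ->
  {within `[a, b], continuous f}.
Proof.
move=> fd; apply: derivable_within_continuous => x xab.
by have /fd [] : a <= x <= b by rewrite in_itv/= in xab.
Qed.

Lemma derive_ge0_le f df a b : a <= b ->
  (forall x, a <= x <= b -> is_derive x 1 f (df x)) ->
  (forall x, a < x < b -> 0 <= df x) -> f a <= f b.
Proof.
move=> ab fd df0.
move: ab; rewrite le_eqVlt => /predU1P[-> //|ab].
have [|c' cab] := @MVT _ f df a b ab _ (is_derive_continuous_within fd).
  by move=> x; rewrite in_itv/= => /andP[/ltW ax /ltW xb]; apply: fd; rewrite ax xb.
move=> e; rewrite -subr_ge0 e mulr_ge0 ?subr_ge0 ?(ltW ab)//.
by apply: df0; rewrite in_itv/= in cab.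
Qed.

Lemma derive_gt0_lt f df a b : a < b ->
  (forall x, a <= x <= b -> is_derive x 1 f (df x)) ->
  (forall x, a < x < b -> 0 < df x) -> f a < f b.
Proof.
move=> ab fd df0.
have [|c' cab] := @MVT _ f df a b ab _ (is_derive_continuous_within fd).
  by move=> x; rewrite in_itv/= => /andP[/ltW ax /ltW xb]; apply: fd; rewrite ax xb.
move=> e; rewrite -subr_gt0 e mulr_gt0 ?subr_gt0//.
by apply: df0; rewrite in_itv/= in cab.
Qed.

Lemma derive_le0_ge f df a b : a <= b ->
  (forall x, a <= x <= b -> is_derive x 1 f (df x)) ->
  (forall x, a < x < b -> df x <= 0) -> f b <= f a.
Proof.
move=> ab fd df0; rewrite -lerN2.
apply: (@derive_ge0_le (fun x => - f x) (fun x => - df x)) => // x xab.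
  by apply: is_deriveN; exact: fd.
by rewrite oppr_ge0 df0.
Qed.

Lemma derive_lt0_gt f df a b : a < b ->
  (forall x, a <= x <= b -> is_derive x 1 f (df x)) ->
  (forall x, a < x < b -> df x < 0) -> f b < f a.
Proof.
move=> ab fd df0; rewrite -ltrN2.
apply: (@derive_gt0_lt (fun x => - f x) (fun x => - df x)) => // x xab.
  by apply: is_deriveN; exact: fd.
by rewrite oppr_gt0 df0.
Qed.

Lemma is_derive_inv f (d : R) x : f x != 0 -> is_derive x 1 f d ->
  is_derive x 1 (fun y => (f y)^-1) (- f x ^- 2 * d).
Proof. by move=> fx0 fd; apply: is_deriveV. Qed.

End derivative_tests.

Section trigonometric_bounds.
Context {R : realType}.
Implicit Types x : R.

Definition sin_taylor (n : nat) x : R :=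
  \sum_(i < n) (-1) ^+ i * (i.*2.+1`!%:R^-1 * x ^+ i.*2.+1).

Definition cos_taylor (n : nat) x : R :=
  \sum_(i < n) (-1) ^+ i * (i.*2`!%:R^-1 * x ^+ i.*2).

Lemma is_derive_pow (n : nat) x :
  is_derive x (1 : R) (fun y : R => y ^+ n) (n%:R * x ^+ n.-1).
Proof.
have := @is_deriveX _ _ id n x 1 1 (is_derive_id x 1).
by rewrite exprfctE /GRing.scale /= mulr1.
Qed.

Lemma is_derive_monom (n : nat) x :
  is_derive x (1 : R) (fun y : R => n.+1`!%:R^-1 * y ^+ n.+1) (n`!%:R^-1 * x ^+ n).
Proof.
have -> : n`!%:R^-1 * x ^+ n = n.+1`!%:R^-1 *: (n.+1%:R * x ^+ n) :> R.
  rewrite factS natrM invfM /GRing.scale /= mulrA; congr (_ * _).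
  by rewrite mulrAC mulVf ?mul1r// pnatr_eq0.
exact: (is_deriveZ _ (is_derive_pow n.+1 x)).
Qed.

Lemma is_derive_sin_taylor (n : nat) x :
  is_derive x (1 : R) (sin_taylor n) (cos_taylor n x).
Proof.
have -> : sin_taylor n = \sum_(i < n) fun y : R => (-1) ^+ i * (i.*2.+1`!%:R^-1 * y ^+ i.*2.+1).
  by apply/funext => y; rewrite fct_sumE.
apply: is_derive_sum => i; apply: is_deriveZ; exact: is_derive_monom.
Qed.

Lemma is_derive_cos_taylor (n : nat) x :
  is_derive x (1 : R) (cos_taylor n.+1) (- sin_taylor n x).
Proof.
have -> : cos_taylor n.+1 = (cst 1) +
    \sum_(i < n) fun y : R => (-1) ^+ i.+1 * (i.+1.*2`!%:R^-1 * y ^+ i.+1.*2).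
  apply/funext => y; rewrite /cos_taylor big_ord_recl !fctE fct_sumE /=.
  by rewrite fact0 invr1 !mul1r expr0.
rewrite /sin_taylor -sumrN -[X in is_derive _ _ _ X]add0r.
apply: is_deriveD; apply: is_derive_sum => i.
rewrite exprS mulN1r -mulNr; apply: is_deriveZ; exact: is_derive_monom.
Qed.

(** Each Taylor remainder vanishes at 0 and is, up to sign, a primitive of the preceding one. The
    signs therefore propagate by an induction alternating between cosine and sine, which starts from
    [cos x <= 1]. *)
Lemma sin_cos_taylor_sign (n : nat) x : 0 <= x ->
  0 <= (-1) ^+ n.+1 * (cos x - cos_taylor n.+1 x) /\
  0 <= (-1) ^+ n.+1 * (sin x - sin_taylor n.+1 x).
Proof.
suff cs (m : nat) :
    (forall y : R, 0 <= y -> 0 <= (-1) ^+ m * (cos y - cos_taylor m y)) ->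
    (forall y : R, 0 <= y -> 0 <= (-1) ^+ m * (sin y - sin_taylor m y)).
  move=> x0.
  have H k : forall y : R, 0 <= y -> 0 <= (-1) ^+ k.+1 * (cos y - cos_taylor k.+1 y).
    elim: k => [y y0|k IH y y0].
      rewrite /cos_taylor big_ord_recl big_ord0 fact0 !expr0 invr1 !mulr1 addr0.
      by rewrite expr1 mulN1r opprB subr_ge0 cos_le1.
    have := @derive_ge0_le _ (fun z : R => (-1) ^+ k.+2 * (cos z - cos_taylor k.+2 z))
      (fun z => (-1) ^+ k.+1 * (sin z - sin_taylor k.+1 z)) 0 y y0 _ _.
    have -> : cos_taylor k.+2 0 = 1.
      rewrite /cos_taylor big_ord_recl fact0 !expr0 invr1 !mulr1 big1 ?addr0//.
      by move=> i _; rewrite /= expr0n /= !mulr0.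
    rewrite cos0 subrr mulr0; apply=> z.
      move=> _.
      have -> : (-1) ^+ k.+1 * (sin z - sin_taylor k.+1 z) =
          (-1) ^+ k.+2 *: (- sin z - - sin_taylor k.+1 z) :> R.
        by rewrite /GRing.scale /= (exprS _ k.+1); ring.
      apply: is_deriveZ; apply: is_deriveB; exact: is_derive_cos_taylor.
    by move=> /andP[z0 _]; apply: (cs k.+1 IH); exact: ltW.
  by split; [exact: H|exact: (cs _ (H n))].
move=> IH y y0.
have := @derive_ge0_le _ (fun z : R => (-1) ^+ m * (sin z - sin_taylor m z))
  (fun z => (-1) ^+ m * (cos z - cos_taylor m z)) 0 y y0 _ _.
have -> : sin_taylor m 0 = 0.
  by rewrite /sin_taylor big1// => i _; rewrite expr0n !mulr0.
rewrite sin0 subrr mulr0; apply=> z.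
  by move=> _; apply: is_deriveZ; apply: is_deriveB; exact: is_derive_sin_taylor.
by move=> /andP[z0 _]; apply: IH; exact: ltW.
Qed.

(** Horner form in [u = x^2] of the Taylor polynomials, for [k = 0] (cosine) and [k = 1] (sine
    divided by [x]). At a rational point it unfolds to an arithmetic expression that [lra] can
    evaluate. *)
Fixpoint taylor_horner (k n : nat) (u : R) : R :=
  if n is n'.+1 then 1 - u / (k.+1%:R * k.+2%:R) * taylor_horner k.+2 n' u else 1.

Lemma taylor_hornerE (k n : nat) x :
  \sum_(i < n.+1) (-1) ^+ i * ((k + i.*2)`!%:R^-1 * x ^+ i.*2) =
  k`!%:R^-1 * taylor_horner k n (x ^+ 2).
Proof.
elim: n k => [|n IH] k; rewrite big_ord_recl addn0 !expr0.
  by rewrite big_ord0 addr0 !mulr1 mul1r.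
rewrite mul1r /= mulrBr; congr (_ + _).
rewrite (eq_bigr (fun i : 'I_n.+1 => - x ^+ 2 *
    ((-1) ^+ i * ((k.+2 + i.*2)`!%:R^-1 * x ^+ i.*2)))); last first.
  move=> i _; rewrite /= /bump add1n doubleS !addnS !addSn exprS mulN1r.
  by rewrite -(addn2 i.*2) exprD; ring.
rewrite -mulr_sumr IH !factS !natrM !invfM; ring.
Qed.

Lemma cos_taylorE (n : nat) x : cos_taylor n.+1 x = taylor_horner 0 n (x ^+ 2).
Proof. by rewrite /cos_taylor (taylor_hornerE 0) fact0 invr1 mul1r. Qed.

Lemma sin_taylorE (n : nat) x : sin_taylor n.+1 x = x * taylor_horner 1 n (x ^+ 2).
Proof.
have := taylor_hornerE 1 n x; rewrite factS fact0 invr1 mul1r => <-.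
rewrite mulr_sumr; apply: eq_bigr => i _; rewrite add1n.
by rewrite exprS; ring.
Qed.

Lemma cos_ge_taylor (n : nat) x : 0 <= x -> taylor_horner 0 n.*2.+1 (x ^+ 2) <= cos x.
Proof.
move=> x0; have [+ _] := sin_cos_taylor_sign n.*2.+1 x0.
by rewrite -signr_odd /= odd_double mul1r subr_ge0 cos_taylorE.
Qed.

Lemma cos_le_taylor (n : nat) x : 0 <= x -> cos x <= taylor_horner 0 n.*2 (x ^+ 2).
Proof.
move=> x0; have [+ _] := sin_cos_taylor_sign n.*2 x0.
by rewrite -signr_odd /= odd_double mulN1r oppr_ge0 subr_le0 cos_taylorE.
Qed.

Lemma sin_ge_taylor (n : nat) x : 0 <= x -> x * taylor_horner 1 n.*2.+1 (x ^+ 2) <= sin x.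
Proof.
move=> x0; have [_] := sin_cos_taylor_sign n.*2.+1 x0.
by rewrite -signr_odd /= odd_double mul1r subr_ge0 sin_taylorE.
Qed.

Lemma sin_le_taylor (n : nat) x : 0 <= x -> sin x <= x * taylor_horner 1 n.*2 (x ^+ 2).
Proof.
move=> x0; have [_] := sin_cos_taylor_sign n.*2 x0.
by rewrite -signr_odd /= odd_double mulN1r oppr_ge0 subr_le0 sin_taylorE.
Qed.

(** The cosine decreases through 0 at [pi / 2], so its sign at half of a rational number decides on
    which side of [pi] this number lies. *)
Lemma pi_bounds :
  3 + 1415 / 10 ^+ 4 + 926 / 10 ^+ 7 < pi :> R /\ pi < 3 + 1415 / 10 ^+ 4 + 927 / 10 ^+ 7 :> R.
Proof.
have p2 := @pi_ge2 R.
split.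
  have : 0 < cos ((3 + 1415 / 10 ^+ 4 + 926 / 10 ^+ 7) / 2 : R).
    apply: (lt_le_trans _ (cos_ge_taylor 3 _)); last by lra.
    rewrite /=; lra.
  rewrite -(@cos_pihalf R) ltr_cos ?in_itv /=; lra.
have : cos ((3 + 1415 / 10 ^+ 4 + 927 / 10 ^+ 7) / 2 : R) < 0.
  apply: (le_lt_trans (cos_le_taylor 3 _)); first by lra.
  rewrite /=; lra.
rewrite -(@cos_pihalf R) ltr_cos ?in_itv /=; lra.
Qed.

End trigonometric_bounds.

(** * The equation of the peak and the location of its root *)

Section peak.
Context {R : realType}.
Implicit Types x y : R.

Lemma pi_num : 3 + 1415 / 10 ^+ 4 + 926 / 10 ^+ 7 < pi :> R.
Proof. by case: (@pi_bounds R). Qed.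

Lemma pi_num_lt : pi < 3 + 1415 / 10 ^+ 4 + 927 / 10 ^+ 7 :> R.
Proof. by case: (@pi_bounds R). Qed.

Lemma sin_le_cubic x : 0 <= x <= 2 -> sin x <= x * (1 - x ^+ 2 / 8).
Proof.
move=> /andP[x0 x2]; apply: (le_trans (sin_le_taylor 1 x0)).
rewrite /=; apply: ler_wpM2l => //.
have u0 : 0 <= x ^+ 2 by exact: sqr_ge0.
have u4 : x ^+ 2 <= 4 by rewrite expr2; nra.
by move: (x ^+ 2) u0 u4 => u u0 u4; nra.
Qed.

(** A surplus of [1/4] over [1/x^2] is what the monotonicity of [peak_slope] requires; it follows
    from the cubic bound on the sine. *)
Lemma inv_sqr_sin_ge x : 0 < x <= pi / 2 -> x ^- 2 + 4^-1 <= sin x ^- 2.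
Proof.
move=> /andP[x0 xpi].
have xlt : x < 8 / 5 by apply: (le_lt_trans xpi); have := pi_num_lt; lra.
have s0 : 0 < sin x by apply: sin_gt0_pi; have := @pi_gt0 R; lra.
have sle : sin x <= x * (1 - x ^+ 2 / 8) by apply: sin_le_cubic; lra.
have u0 : 0 < x ^+ 2 by rewrite exprn_gt0.
have -> : x ^- 2 + 4^-1 = (x ^+ 2 / (1 + x ^+ 2 / 4))^-1.
  by field; rewrite !gt_eqF//; lra.
rewrite lef_pV2 ?posrE ?exprn_gt0 ?divr_gt0 ?exprn_gt0//; last by lra.
rewrite ler_pdivlMr; last by lra.
have : sin x ^+ 2 <= (x * (1 - x ^+ 2 / 8)) ^+ 2 by rewrite ler_sqr ?nnegrE; nra.
rewrite exprMn; move: (sin x ^+ 2) => s.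
have u4 : x ^+ 2 <= 4 by rewrite expr2; nra.
move: (x ^+ 2) u0 u4 => u u0 u4 H.
apply: (@le_trans _ _ (u * (1 - u / 8) ^+ 2 * (1 + u / 4))).
  by rewrite ler_pM2r//; nra.
rewrite -mulrA -[leRHS]mulr1 ler_pM2l//.
have : 0 <= u ^+ 2 * (12 - u) by rewrite mulr_ge0 ?sqr_ge0 //; lra.
nra.
Qed.

(* Half the logarithmic derivative of sin(x)^2 / ((pi - x) x^2). *)
Definition peak_slope x : R := cos x / sin x + ((pi - x)^-1 / 2 - x^-1).

(** The derivative is [-1/sin(z)^2 + 1/(2 (pi - z)^2) + 1/z^2]. To the left of [pi / 2] the bound on
    [1/sin^2] is applied at [z] and absorbs the singularity at 0; to the right it is applied at
    [pi - z] and absorbs the one at [pi]. The surplus [1/4] covers the remaining bounded term. *)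
Lemma peak_slope_decr x y : 0 < x -> x < y -> y < pi -> peak_slope y < peak_slope x.
Proof.
move=> x0 xy ypi.
apply: (@derive_lt0_gt _ peak_slope (fun z => - sin z ^- 2 + ((pi - z) ^- 2 / 2 + z ^- 2))) => // z.
  move=> /andP[xz zy].
  have z0 : z != 0 by rewrite gt_eqF//; lra.
  have pz0 : pi - z != 0 by rewrite gt_eqF//; lra.
  have s0 : sin z != 0 by rewrite gt_eqF// sin_gt0_pi//; lra.
  have h1 := is_derive_inv s0 (is_derive_sin z).
  have h2 := is_derive_inv z0 (is_derive_id z 1).
  have h3 : is_derive z (1 : R) (fun y : R => (pi - y)^-1) (- (pi - z) ^- 2 * - 1).
    apply: (@is_derive_inv _ (fun y => pi - y)) => //.
    by apply: is_derive_eq; rewrite /GRing.scale /= add0r mul1r.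
  apply: is_derive_eq.
  rewrite /GRing.scale /= !mulr1.
  have := cos2Dsin2 z; move: (sin z) (cos z) s0 => s c s0 cs.
  rewrite [RHS](_ : _ = - (c ^+ 2 + s ^+ 2) / s ^+ 2 + ((pi - z) ^- 2 / 2 + z ^- 2)).
    by move: (@pi R) pz0 => P pz0; field; rewrite s0 z0 pz0.
  by rewrite cs mulN1r.
move=> /andP[xz zy].
have p1 := pi_num; have p2 := pi_num_lt.
have [zp|zp] := leP z (pi / 2).
  have : 0 < z <= pi / 2 by lra.
  move/inv_sqr_sin_ge.
  suff : (pi - z) ^- 2 < 2^-1 by lra.
  rewrite ltf_pV2 ?posrE ?exprn_gt0//; last by lra.
  have : 0 < (pi - z - 157 / 100) * (pi - z + 157 / 100) by apply: mulr_gt0; lra.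
  by lra.
have : 0 < pi - z <= pi / 2 by lra.
move/inv_sqr_sin_ge; rewrite sinB sinpi cospi mul0r sub0r mulN1r opprK.
have : (25 / 10) ^-1 < (pi - z) ^- 2.
  rewrite ltf_pV2 ?posrE ?exprn_gt0//; [|lra].
  have : 0 < (158 / 100 - (pi - z)) * (pi - z + 158 / 100) by apply: mulr_gt0; lra.
  by lra.
suff : z ^- 2 < (24 / 10)^-1 by lra.
rewrite ltf_pV2 ?posrE ?exprn_gt0//; [|lra].
have : 0 < (z - 157 / 100) * (z + 157 / 100) by apply: mulr_gt0; lra.
lra.
Qed.

(** The equation of [xi_2] in the variable [x = 2 xi_2]; it is [peak_slope] with its denominators
    cleared. *)
Definition peak_eqn x : R := (pi * x - x ^+ 2) * cos x + (3 / 2 * x - pi) * sin x.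

Lemma peak_eqnE x : 0 < x < pi ->
  peak_eqn x = x * (pi - x) * sin x * peak_slope x.
Proof.
move=> /andP[x0 xpi]; rewrite /peak_eqn /peak_slope.
have s0 : sin x != 0 by rewrite gt_eqF// sin_gt0_pi//; lra.
have x0' : x != 0 by rewrite gt_eqF.
have pz0 : pi - x != 0 by rewrite gt_eqF//; lra.
by move: (@pi R) pz0 => P pz0; field; rewrite s0 x0' pz0.
Qed.

Lemma peak_eqn_left : 0 < peak_eqn (57 / 10 ^+ 2 + 6 / 10 ^+ 4 + 5 / 10 ^+ 5).
Proof.
set a := _ + _ + _ / _; have a0 : 0 <= a by rewrite /a; lra.
have := cos_ge_taylor 2 a0; have := cos_le_taylor 2 a0.
have := sin_ge_taylor 2 a0; have := sin_le_taylor 2 a0.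
rewrite /peak_eqn; move: (cos a) (sin a) => c s; rewrite /= /a => s1 s2 c1 c2.
have p1 := pi_num; have p2 := pi_num_lt.
(* [pi] occurs only in the term [pi * (a * c - s)]. Replacing it there by a rational bound leaves a
   goal that is linear in [c] and [s]. *)
have : pi * (s - a * c) <= (3 + 1415 / 10 ^+ 4 + 927 / 10 ^+ 7) * (s - a * c).
  by apply: ler_wpM2r; rewrite /a; lra.
rewrite /a; lra.
Qed.

Lemma peak_eqn_right : peak_eqn (57 / 10 ^+ 2 + 6 / 10 ^+ 4 + 8 / 10 ^+ 5) < 0.
Proof.
set a := _ + _ + _ / _; have a0 : 0 <= a by rewrite /a; lra.
have := cos_ge_taylor 2 a0; have := cos_le_taylor 2 a0.
have := sin_ge_taylor 2 a0; have := sin_le_taylor 2 a0.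
rewrite /peak_eqn; move: (cos a) (sin a) => c s; rewrite /= /a => s1 s2 c1 c2.
have p1 := pi_num; have p2 := pi_num_lt.
have : (3 + 1415 / 10 ^+ 4 + 926 / 10 ^+ 7) * (s - a * c) <= pi * (s - a * c).
  by apply: ler_wpM2r; rewrite /a; lra.
rewrite /a; lra.
Qed.

(** The five decimals are dictated by the final numerical claim: at the left end of this interval,
    [pi / (2 (pi - x))] exceeds [0.61098] by less than [10^(-6)]. *)
Lemma peak_exists : exists2 x : R,
  57 / 10 ^+ 2 + 6 / 10 ^+ 4 + 5 / 10 ^+ 5 <= x <= 57 / 10 ^+ 2 + 6 / 10 ^+ 4 + 8 / 10 ^+ 5 & peak_eqn x = 0.
Proof.
have [|||x xI fx] := @IVT _ peak_eqn (57 / 10 ^+ 2 + 6 / 10 ^+ 4 + 5 / 10 ^+ 5) (57 / 10 ^+ 2 + 6 / 10 ^+ 4 + 8 / 10 ^+ 5) 0.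
- lra.
- apply: continuous_subspaceT => y; rewrite /peak_eqn.
  apply: differentiable_continuous; apply/derivable1_diffP.
  by apply: ex_derive.
- by rewrite ge_min le_max (ltW peak_eqn_left) (ltW peak_eqn_right) orbT.
by exists x => //; rewrite in_itv in xI.
Qed.

End peak.

(** * The exponential rate of the spline wavelets *)

Section rate.
Context {R : realType}.
Implicit Types x y : R.

Lemma peak_slope_peak x : 0 < x < pi -> peak_eqn x = 0 -> peak_slope x = 0.
Proof.
move=> x0pi; rewrite peak_eqnE// => /eqP; case/andP: (x0pi) => x0 xpi.
by rewrite mulf_eq0 gt_eqF ?mulr_gt0 ?subr_gt0 ?sin_gt0_pi// => /eqP.
Qed.

Lemma peak_uniq x y : 0 < x < pi -> 0 < y < pi ->
  peak_eqn x = 0 -> peak_eqn y = 0 -> x = y.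
Proof.
move=> hx hy /(peak_slope_peak hx) ex /(peak_slope_peak hy) ey.
case/andP: hx => x0 xpi; case/andP: hy => y0 ypi.
have [xy|xy|//] := ltgtP x y.
  by have := peak_slope_decr x0 xy ypi; rewrite ex ey ltxx.
by have := peak_slope_decr y0 xy xpi; rewrite ex ey ltxx.
Qed.

(* [2 sin(w/2)^2 / ((w/2) (w/2 - pi)^2)], the exponential rate of the spline
   wavelet at frequency [w], in the variable [x = pi - w/2]. *)
Definition peak_rate x : R := 2 * sin x ^+ 2 / ((pi - x) * x ^+ 2).

Lemma is_derive_peak_rate x : 0 < x < pi ->
  is_derive x 1 peak_rate (2 * peak_rate x * peak_slope x).
Proof.
move=> /andP[x0 xpi].
have s0 : sin x != 0 by rewrite gt_eqF// sin_gt0_pi//; lra.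
have x0' : x != 0 by rewrite gt_eqF.
have pz0 : pi - x != 0 by rewrite gt_eqF//; lra.
rewrite /peak_rate /peak_slope.
have h1 : is_derive x 1 (fun y : R => (pi - y) * y ^+ 2) (pi * 2 * x - 3 * x ^+ 2).
  apply: is_derive_eq; rewrite /GRing.scale /= !mulr1.
  by move: (@pi R) => P; ring.
have h2 := @is_derive_inv _ (fun y => (pi - y) * y ^+ 2) _ x _ h1.
have {}h2 := h2 (mulf_neq0 pz0 (expf_neq0 2 x0')).
have h3 : is_derive x 1 (fun y : R => 2 * sin y ^+ 2) (4 * sin x * cos x).
  apply: is_derive_eq; rewrite /GRing.scale /=; ring.
apply: (is_derive_eq (is_deriveM h3 h2)); rewrite /GRing.scale /=.
move: (sin x) (cos x) s0 => s c s0; move: (@pi R) pz0 => P pz0.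
by field; rewrite s0 x0' pz0.
Qed.

Section at_the_peak.
Context (x0 : R) (x0pi : 0 < x0 < pi) (x0_peak : peak_eqn x0 = 0).

Lemma peak_rate_gt0 x : 0 < x < pi -> 0 < peak_rate x.
Proof.
move=> /[dup] /andP[xgt0 xpi] /sin_gt0_pi s0.
by rewrite divr_gt0 ?mulr_gt0 ?exprn_gt0 ?subr_gt0.
Qed.

Lemma peak_rate_incr x y : 0 < x -> x < y -> y <= x0 -> peak_rate x < peak_rate y.
Proof.
move=> xgt0 xy yx0; case/andP: x0pi => x00 xpi.
apply: (@derive_gt0_lt _ peak_rate (fun z => 2 * peak_rate z * peak_slope z) _ _ xy) => z zxy.
  by apply: is_derive_peak_rate; move: zxy; lra.
have zpi : 0 < z < pi by lra.
have := @peak_slope_decr _ z x0 ltac:(lra) ltac:(lra) xpi.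
by rewrite (peak_slope_peak x0pi x0_peak) => ?; rewrite pmulr_lgt0// pmulr_rgt0// peak_rate_gt0.
Qed.

Lemma peak_rate_decr x y : x0 <= x -> x < y -> y < pi -> peak_rate y < peak_rate x.
Proof.
move=> x0x xy ypi; case/andP: x0pi => x00 _.
apply: (@derive_lt0_gt _ peak_rate (fun z => 2 * peak_rate z * peak_slope z) _ _ xy) => z zxy.
  by apply: is_derive_peak_rate; move: zxy; lra.
have zpi : 0 < z < pi by lra.
have := @peak_slope_decr _ x0 z x00 ltac:(lra) ltac:(lra).
by rewrite (peak_slope_peak x0pi x0_peak) => ?; rewrite pmulr_rlt0// pmulr_rgt0// peak_rate_gt0.
Qed.

Lemma peak_rate_le x : 0 < x < pi -> peak_rate x <= peak_rate x0.
Proof.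
move=> /andP[xgt0 xpi]; have [xx0|xx0|->//] := ltgtP x x0.
  by rewrite ltW// peak_rate_incr.
by rewrite ltW// peak_rate_decr.
Qed.

Lemma sin_pi6 : sin (pi / 6) = 2^-1 :> R.
Proof.
have pi0 := @pi_gt0 R.
have e : cos (2 * (pi / 6)) = sin (pi / 6) :> R.
  have -> : 2 * (pi / 6) = pi / 2 - pi / 6 :> R by move: (@pi R) => P; field.
  by rewrite cosB cos_pihalf sin_pihalf mul0r add0r mul1r.
have s0 : 0 < sin (pi / 6) :> R by apply: sin_gt0_pi; lra.
move: e; rewrite mulr_natl cos_mulr2n cos2sin2; move: (sin (pi/6)) s0 => s s0.
rewrite mulr2n => e.
have /eqP : (s + 1) * (2 * s - 1) = s - (1 - s ^+ 2 + (1 - s ^+ 2) - 1) by ring.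
by rewrite e subrr mulf_eq0 => /orP[|] /eqP; lra.
Qed.

(** The point [pi / 6] is close to the maximum and has a rational sine; the rate there is
    [108 / (5 pi^3)], about [0.6966]. *)
Lemma peak_rate_num : 69 / 100 < peak_rate x0.
Proof.
have p0 := @pi_gt0 R; have p2 := @pi_num_lt R.
apply: (@lt_le_trans _ _ (peak_rate (pi / 6))); last by apply: peak_rate_le; lra.
rewrite /peak_rate sin_pi6.
have -> : 2 * 2^-1 ^+ 2 / ((pi - pi / 6) * (pi / 6) ^+ 2) = (5 / 108 * pi ^+ 3)^-1 :> R.
  have : pi != 0 :> R by rewrite gt_eqF.
  have -> : pi - pi / 6 = 5 / 6 * pi :> R by move: (@pi R) => P; field.
  by move: (@pi R) => P P0; field.
have P3 : 0 < 5 / 108 * pi ^+ 3 :> R by rewrite mulr_gt0 ?exprn_gt0//; lra.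
have : pi ^+ 3 < (3 + 142 / 10 ^+ 3) ^+ 3 :> R by rewrite ltr_pXn2r ?nnegrE//; lra.
rewrite -[X in _ -> _ < X]mul1r ltr_pdivlMr//.
by move: (pi ^+ 3) => P; lra.
Qed.

End at_the_peak.
End rate.

(** * Complex exponentials *)

Section complex_modulus.
Context {R : realType}.
Implicit Types (z w : R[i]) (x t : R).

Lemma cmodM z w : cmod (z * w) = cmod z * cmod w.
Proof. exact: ComplexField.Normc.normcM. Qed.

Lemma cmodV z : cmod z^-1 = (cmod z)^-1.
Proof. exact: ComplexField.Normc.normcV. Qed.

Lemma cmodX z n : cmod (z ^+ n) = cmod z ^+ n.
Proof.
elim: n => [|n IH]; first by rewrite !expr0 /cmod ComplexField.Normc.normc1.
by rewrite !exprS cmodM IH.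
Qed.

Lemma cmodN z : cmod (- z) = cmod z.
Proof. exact: normcN. Qed.

Lemma cmodD z w : cmod (z + w) <= cmod z + cmod w.
Proof. exact: le_normcD. Qed.

Lemma cmodB z w : cmod (z - w) <= cmod z + cmod w.
Proof. by rewrite -(cmodN w) cmodD. Qed.

Lemma cmod0 : cmod (0 : R[i]) = 0.
Proof. exact: ComplexField.Normc.normc0. Qed.

Lemma cmod1 : cmod (1 : R[i]) = 1.
Proof. exact: ComplexField.Normc.normc1. Qed.

Lemma cmodE z : cmod z = Num.sqrt (complex.Re z ^+ 2 + complex.Im z ^+ 2).
Proof. by case: z. Qed.

Lemma cmod_ge0 z : 0 <= cmod z.
Proof. by rewrite cmodE sqrtr_ge0. Qed.

Lemma sqr_cmod z : cmod z ^+ 2 = complex.Re z ^+ 2 + complex.Im z ^+ 2.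
Proof. by rewrite cmodE sqr_sqrtr// addr_ge0 ?sqr_ge0. Qed.

Lemma cmod_eq0 z : cmod z = 0 -> z = 0.
Proof. exact: ComplexField.Normc.eq0_normc. Qed.

Lemma cmod_real x : cmod x%:C = `|x|.
Proof. by rewrite cmodE /= expr0n addr0 sqrtr_sqr. Qed.

Lemma cmod_i : cmod ('i : R[i]) = 1.
Proof. by rewrite cmodE /= expr0n expr1n add0r sqrtr1. Qed.

Lemma cmod_cis t : cmod (cis t) = 1.
Proof. by rewrite cmodE /= cos2Dsin2 sqrtr1. Qed.

Lemma ler_cmod_dist z w : `|cmod z - cmod w| <= cmod (z - w).
Proof.
rewrite ler_norml lerBlDr lerBrDl.
have h1 := cmodD (z - w) w; have h2 := cmodB z (z - w).
rewrite subrK in h1; rewrite (_ : z - (z - w) = w) in h2; last by ring.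
by rewrite h1 andbT; lra.
Qed.

Lemma cmod_sum n (f : 'I_n -> R[i]) : cmod (\sum_(i < n) f i) <= \sum_(i < n) cmod (f i).
Proof.
elim/big_ind2 : _ => //; first by rewrite cmod0.
by move=> a b c e ab ce; apply: (le_trans (cmodD _ _)); exact: lerD.
Qed.

Lemma cisD x t : cis (x + t) = cis x * cis t :> R[i].
Proof. by rewrite /cis cosD sinD; simpc; congr (_ +i* _); ring. Qed.

Lemma cis0 : cis 0 = 1 :> R[i].
Proof. by rewrite /cis cos0 sin0. Qed.

Lemma cis_neq0 x : cis x != 0 :> R[i].
Proof. by apply/eqP => /(congr1 cmod); rewrite cmod_cis cmod0 => /eqP; rewrite oner_eq0. Qed.

Lemma cisN x : cis (- x) = (cis x)^-1 :> R[i].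
Proof. by apply: (mulfI (cis_neq0 x)); rewrite -cisD subrr cis0 divff// cis_neq0. Qed.

Lemma cisMn x n : cis (n%:R * x) = cis x ^+ n :> R[i].
Proof.
elim: n => [|n IH]; first by rewrite mul0r cis0 expr0.
by rewrite -natr1 mulrDl mul1r cisD IH exprSr.
Qed.

Lemma cispi : cis pi = -1 :> R[i].
Proof. by rewrite /cis cospi sinpi; simpc. Qed.

End complex_modulus.

Section complex_derivative.
Context {R : realType}.
Implicit Types (f g : R -> R[i]) (z : R[i]) (x t : R).

Definition is_cderive f x (d : R[i]) : Prop :=
  is_derive x 1 (fun y => complex.Re (f y)) (complex.Re d) /\
  is_derive x 1 (fun y => complex.Im (f y)) (complex.Im d).

Lemma is_cderive_eq f x d d' : is_cderive f x d -> d = d' -> is_cderive f x d'.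
Proof. by move=> ? <-. Qed.

Lemma is_cderive_cst z x : is_cderive (fun=> z) x 0.
Proof. by split; exact: is_derive_cst. Qed.

Lemma is_cderive_real (h : R -> R) x d : is_derive x 1 h d ->
  is_cderive (fun y => (h y)%:C) x d%:C.
Proof. by move=> hd; split => //=; exact: is_derive_cst. Qed.

Lemma ReD z w : complex.Re (z + w) = complex.Re z + complex.Re w.
Proof. by case: z w => [? ?] [? ?]. Qed.
Lemma ImD z w : complex.Im (z + w) = complex.Im z + complex.Im w.
Proof. by case: z w => [? ?] [? ?]. Qed.
Lemma ReM z w : complex.Re (z * w) = complex.Re z * complex.Re w - complex.Im z * complex.Im w.
Proof. by case: z w => [? ?] [? ?]. Qed.
Lemma ImM z w : complex.Im (z * w) = complex.Re z * complex.Im w + complex.Im z * complex.Re w.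
Proof. by case: z w => [? ?] [? ?]. Qed.

Lemma is_cderiveD f g x d e : is_cderive f x d -> is_cderive g x e ->
  is_cderive (fun y => f y + g y) x (d + e).
Proof.
move=> [fr fi] [gr gi]; split.
  rewrite ReD (_ : (fun y => _) = (fun y => complex.Re (f y)) + (fun y => complex.Re (g y))).
    exact: is_deriveD.
  by apply/funext => y; rewrite ReD.
rewrite ImD (_ : (fun y => _) = (fun y => complex.Im (f y)) + (fun y => complex.Im (g y))).
  exact: is_deriveD.
by apply/funext => y; rewrite ImD.
Qed.

Lemma is_cderiveM f g x d e : is_cderive f x d -> is_cderive g x e ->
  is_cderive (fun y => f y * g y) x (d * g x + f x * e).
Proof.
move=> [fr fi] [gr gi]; split.
  rewrite (_ : (fun y => _) = (fun y => complex.Re (f y)) * (fun y => complex.Re (g y))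
    - (fun y => complex.Im (f y)) * (fun y => complex.Im (g y))); last first.
    by apply/funext => y; rewrite ReM.
  apply: is_derive_eq (is_deriveB (is_deriveM fr gr) (is_deriveM fi gi)) _.
  by rewrite ReD !ReM /GRing.scale /=; ring.
rewrite (_ : (fun y => _) = (fun y => complex.Re (f y)) * (fun y => complex.Im (g y))
    + (fun y => complex.Im (f y)) * (fun y => complex.Re (g y))); last first.
  by apply/funext => y; rewrite ImM.
apply: is_derive_eq (is_deriveD (is_deriveM fr gi) (is_deriveM fi gr)) _.
by rewrite ImD !ImM /GRing.scale /=; ring.
Qed.

Lemma is_cderiveZ z f x d : is_cderive f x d -> is_cderive (fun y => z * f y) x (z * d).
Proof.
move=> fd; apply: is_cderive_eq (is_cderiveM (is_cderive_cst z x) fd) _.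
by rewrite mul0r add0r.
Qed.

Lemma is_cderiveB f g x d e : is_cderive f x d -> is_cderive g x e ->
  is_cderive (fun y => f y - g y) x (d - e).
Proof.
move=> fd gd.
have := is_cderiveD fd (is_cderiveZ (-1) gd); rewrite mulN1r.
by congr is_cderive; apply/funext => y; rewrite mulN1r.
Qed.

Lemma is_cderive_sum n (f : 'I_n -> R -> R[i]) x (d : 'I_n -> R[i]) :
  (forall i, is_cderive (f i) x (d i)) ->
  is_cderive (fun y => \sum_(i < n) f i y) x (\sum_(i < n) d i).
Proof.
elim: n f d => [|n IH] f d fd.
  rewrite big_ord0 (_ : (fun y => _) = fun=> 0); first exact: is_cderive_cst.
  by apply/funext => y; rewrite big_ord0.
rewrite big_ord_recl (_ : (fun y => _) =
    (fun y => f ord0 y + \sum_(i < n) f (lift ord0 i) y)).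
  by apply: is_cderiveD => //; exact: IH.
by apply/funext => y; rewrite big_ord_recl.
Qed.

Lemma is_cderive_cis t x :
  is_cderive (fun y => cis (t * y)) x ('i * t%:C * cis (t * x)).
Proof.
have h : is_derive x 1 ( *%R t) t.
  by apply: (is_derive_eq (is_deriveZ t (is_derive_id x 1))); rewrite /GRing.scale /= mulr1.
split => /=.
  apply: (is_derive_eq (is_derive1_comp (is_derive_cos (t * x)) h)); ring.
apply: (is_derive_eq (is_derive1_comp (is_derive_sin (t * x)) h)); ring.
Qed.

Lemma is_cderive_id x : is_cderive (fun y => y%:C) x 1.
Proof. by apply: is_cderive_eq (is_cderive_real (is_derive_id x 1)) _. Qed.

(* Project on the direction of the increment and apply the real mean value
   theorem. *)
Lemma cmod_increment_le f (df : R -> R[i]) (K a b : R) : a <= b ->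
  (forall x, a <= x <= b -> is_cderive f x (df x)) ->
  (forall x, a <= x <= b -> cmod (df x) <= K) ->
  cmod (f b - f a) <= K * (b - a).
Proof.
move=> ab fd dfK; have [D DE] : exists D : R[i], D = f b - f a by exists (f b - f a).
rewrite -DE.
pose h x := complex.Re D * complex.Re (f x) + complex.Im D * complex.Im (f x).
pose dh x := complex.Re D * complex.Re (df x) + complex.Im D * complex.Im (df x).
have hd x : a <= x <= b -> is_derive x 1 h (dh x).
  move=> /fd [rd id]; rewrite /h /dh; move: (complex.Re D) (complex.Im D) => u v.
  by apply: is_derive_eq; rewrite /GRing.scale /=; ring.
have dhK x : a <= x <= b -> dh x <= cmod D * K.
  move=> xab; apply: (@le_trans _ _ (cmod D * cmod (df x))); last first.
    by rewrite ler_wpM2l ?cmod_ge0 ?dfK.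
  have [le0|gt0] := leP (dh x) 0.
    by apply: (le_trans le0); rewrite mulr_ge0 ?cmod_ge0.
  rewrite -ler_sqr ?nnegrE ?(ltW gt0) ?mulr_ge0 ?cmod_ge0//.
  rewrite exprMn !sqr_cmod /dh -subr_ge0.
  move: (complex.Re D) (complex.Im D) (complex.Re (df x)) (complex.Im (df x)) => u v s t.
  have := sqr_ge0 (u * t - v * s); congr (0 <= _); ring.
have [|D0] := eqVneq (cmod D) 0.
  move=> ->; rewrite mulr_ge0 ?subr_ge0//.
  by apply: le_trans (dfK a _); rewrite ?cmod_ge0// lexx ab.
have : h b - h a <= cmod D * K * (b - a).
  have := @derive_ge0_le _ (fun x => cmod D * K * x - h x) (fun x => cmod D * K - dh x) a b ab.
  move=> H; have : cmod D * K * a - h a <= cmod D * K * b - h b.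
    apply: H => x xab; last by rewrite subr_ge0 dhK//; lra.
    have := hd x xab => hdx.
    by apply: is_derive_eq; rewrite /GRing.scale /= mulr1.
  by lra.
have -> : h b - h a = cmod D ^+ 2.
  by rewrite sqr_cmod /h DE /=; case: (f a) (f b) => [p q] [s t] /=; ring.
by rewrite expr2 -mulrA ler_pM2l// lt0r D0 cmod_ge0.
Qed.

Lemma cis_lipschitz x t : cmod (cis x - cis t) <= `|x - t|.
Proof.
wlog tx : x t / t <= x.
  move=> H; have [|/ltW] := leP t x; first exact: H.
  by rewrite distrC -cmodN opprB; exact: H.
have := @cmod_increment_le cis (fun y => 'i * cis y) 1 t x tx.
rewrite mul1r ger0_norm ?subr_ge0//; apply=> y _; last by rewrite cmodM cmod_cis cmod_i mul1r.
have := is_cderive_cis 1 y; rewrite !mul1r mulr1; congr is_cderive.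
by apply/funext => u; rewrite mul1r.
Qed.

End complex_derivative.

(** * Repeated integration of quasi-periodic functions *)

Section quasi_periodic.
Context {R : realType}.
Context (d : R) (d0 : d != 0).
Implicit Types (f g : R -> R[i]) (x y : R).

Let z : R[i] := cis (- d).
Let q : R[i] := 1 - z.
Let J : R[i] := 'i * d%:C.
Let J0 : J != 0.
Proof.
apply/eqP => /(congr1 cmod); rewrite cmodM cmod_i cmod0 mul1r cmod_real => /eqP.
by rewrite normr_eq0 (negbTE d0).
Qed.

(* [phi] is the convolution of [psi] with [cis (- d x)] on the circle. The
   kernel may be recentered by a constant as [cis (- d x) psi x] has mean 0:
   this is the role of its periodic primitive [W]. *)
Lemma quasi_periodic_contraction (phi psi W : R -> R[i]) (M : R) : q != 0 ->
  (forall x, 0 <= x <= 1 -> is_cderive phi x (q * psi x)) ->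
  phi 0 = z * phi 1 ->
  (forall x, 0 <= x <= 1 -> is_cderive W x (cis (- d * x) * psi x)) ->
  W 0 = W 1 ->
  (forall x, 0 <= x <= 1 -> cmod (psi x) <= M) ->
  forall x, 0 <= x <= 1 -> cmod (phi x) <= `|d| / 2 * M.
Proof.
move=> q0 dphi phi01 dW W01 psiM x x01.
have M0 : 0 <= M by apply: le_trans (psiM x x01); exact: cmod_ge0.
(* Used on [[0, x]] with [s = x] and on [[x, 1]] with [s = x + 1]. As [s - y] stays in [[0, 1]], the
   kernel [cis (- d * (s - y))] is within [|d| / 2] of its value at the midpoint. By
   quasi-periodicity the two increments add up to [q * cis (- d * x) * phi x], and the terms in [W]
   cancel. *)
have H s a b : 0 <= a -> a <= b -> b <= 1 ->
    (forall y, a <= y <= b -> 0 <= s - y <= 1) ->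
    cmod ((cis (- d * s) * phi b - cis (- d / 2) * q * W b)
        - (cis (- d * s) * phi a - cis (- d / 2) * q * W a))
      <= cmod q * (`|d| / 2 * M) * (b - a).
  move=> a0 ab b1 sy.
  apply: (@cmod_increment_le _ (fun y => cis (- d * s) * phi y - cis (- d / 2) * q * W y)
    (fun y => cis (- d * s) * (q * psi y) - cis (- d / 2) * q * (cis (- d * y) * psi y))) => // y aby.
    by apply: is_cderiveB; apply: is_cderiveZ; [apply: dphi|apply: dW]; lra.
  have -> : cis (- d * s) * (q * psi y) - cis (- d / 2) * q * (cis (- d * y) * psi y) =
      q * (cis (- d * y) * ((cis (- d * (s - y)) - cis (- d / 2)) * psi y)).
    have -> : - d * s = - d * y + - d * (s - y) by ring.
    by rewrite cisD; ring.
  rewrite !cmodM cmod_cis mul1r ler_wpM2l ?cmod_ge0//.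
  apply: ler_pM; rewrite ?cmod_ge0 ?psiM//; last by lra.
  apply: (le_trans (cis_lipschitz _ _)).
  have -> : - d * (s - y) - - d / 2 = d * (2^-1 - (s - y)) by field.
  rewrite normrM ler_wpM2l ?normr_ge0//.
  by have := sy y aby; rewrite ler_norml; lra.
case/andP: (x01) => x0 x1.
have h1 : _ := H x 0 x (lexx 0) x0 x1 (fun y yx => ltac:(lra)).
have h2 : _ := H (x + 1) x 1 x0 x1 (lexx 1) (fun y yx => ltac:(lra)).
set A := (_ - _) in h1; set B := (_ - _) in h2.
have AB : A + B = q * (cis (- d * x) * phi x).
  have e : cis (- d * (x + 1)) = cis (- d * x) * z by rewrite mulrDr mulr1 cisD.
  by rewrite /A /B phi01 W01 e /q; ring.
have := cmodD A B; rewrite AB !cmodM cmod_cis mul1r => h3.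
have : cmod q * cmod (phi x) <= cmod q * (`|d| / 2 * M).
  apply: (le_trans h3); apply: (le_trans (lerD h1 h2)).
  by rewrite -mulrDr (_ : x - 0 + (1 - x) = 1) ?mulr1//; ring.
rewrite ler_pM2l// lt0r cmod_ge0 andbT.
by apply: contra_neq q0; exact: cmod_eq0.
Qed.

Context (Y : nat -> R -> R[i])
  (Y0 : forall x, Y 0 x = 1)
  (dY : forall n x, 0 <= x <= 1 -> is_cderive (Y n.+1) x (q * Y n x))
  (Y01 : forall n, Y n.+1 0 = z * Y n.+1 1).

Let lam : R[i] := q / (J).

(** [cis (d * x)] is an eigenfunction of the integration step, with eigenvalue [lam], so the
    difference obeys the recursion of [Y] and [quasi_periodic_contraction] applies at each step. The
    factor 2 bounds the initial difference [1 - lam * cis (d * x)], as [lam] has modulus at most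
    1. *)
Lemma euler_spline_dist n x : q != 0 -> 0 <= x <= 1 ->
  cmod (Y n x - lam ^+ n.+1 * cis (d * x)) <= (`|d| / 2) ^+ n * 2.
Proof.
move=> q0.
have dcis y : is_cderive (fun t => cis (- d * t)) y (- J * cis (- d * y)).
  by apply: is_cderive_eq (is_cderive_cis (- d) y) _; rewrite rmorphN /= mulrN.
have cJ : cmod J = `|d| by rewrite cmodM cmod_i mul1r cmod_real.
move: (J0) cJ; rewrite /lam.
move: (J) dcis (is_cderive_cis d : forall y, is_cderive _ y (J * _)) => I dcis dcisd I0 cI.
pose l : R[i] := q / I; rewrite -/l.
pose rho n x := Y n x - l ^+ n.+1 * cis (d * x).
have lE : l * I = q by rewrite /l divfK.
have drho k y : 0 <= y <= 1 -> is_cderive (rho k.+1) y (q * rho k y).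
  move=> y01; rewrite /rho mulrBr.
  apply: is_cderiveB; first exact: dY.
  apply: is_cderive_eq (is_cderiveZ _ (dcisd y)) _.
  by rewrite exprSr -lE; ring.
have rho01 k : rho k.+1 0 = z * rho k.+1 1.
  have zd : z * cis (d * 1) = 1 by rewrite mulr1 -cisD addNr cis0.
  by rewrite /rho Y01 mulr0 cis0 mulrBr mulrCA zd.
have [W [dW W01]] : exists W : nat -> R -> R[i],
    (forall k y, 0 <= y <= 1 -> is_cderive (W k) y (cis (- d * y) * rho k y)) /\
    (forall k, W k 0 = W k 1).
  (* The primitives are obtained by integration by parts, each from the preceding one. The initial
     one takes equal values at 0 and 1 exactly because [l] is the mean of [cis (- d * y)] over
     [[0, 1]]: this is what singles out the coefficient of the exponential. *)
  pose W := fix W k y := if k is k'.+1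
    then I^-1 * (q * W k' y - cis (- d * y) * rho k y)
    else - I^-1 * cis (- d * y) - l * y%:C.
  exists W; split; last first.
    elim=> [|k IH]; last by rewrite /= IH rho01 mulr0 cis0 mul1r mulr1 /z.
    rewrite /= mulr0 cis0 !mulr1 mulr0 -/z /l /q; field; exact: I0.
  elim=> [|k IH] y y01 /=.
    rewrite /rho Y0 expr1 mulrBr mulr1 mulrCA -cisD mulNr addNr cis0 mulr1.
    apply: is_cderiveB; last first.
      by apply: is_cderive_eq (is_cderiveZ _ (is_cderive_id y)) _; rewrite mulr1.
    rewrite -mulNr; apply: is_cderive_eq (is_cderiveZ _ (dcis y)) _.
    by field; exact: I0.
  apply: is_cderive_eq (is_cderiveZ _ (is_cderiveB (is_cderiveZ q (IH y y01))
    (is_cderiveM (dcis y) (drho k y y01)))) _.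
  by field; exact: I0.
elim: n x => [|n IH] x x01.
  rewrite expr0 mul1r Y0 expr1; apply: (le_trans (cmodB _ _)).
  rewrite cmodM cmod_cis mulr1 cmod1 /l cmodM cmodV cI.
  suff : cmod q / `|d| <= 1 by lra.
  rewrite ler_pdivrMr ?normr_gt0// mul1r.
  by have := @cis_lipschitz R 0 (- d); rewrite cis0 sub0r opprK.
have -> : (`|d| / 2) ^+ n.+1 * 2 = `|d| / 2 * ((`|d| / 2) ^+ n * 2) by rewrite exprS mulrA.
exact: (@quasi_periodic_contraction (rho n.+1) (rho n) (W n)
  _ q0 (drho n) (rho01 n) (dW n) (W01 n) IH x x01).
Qed.

End quasi_periodic.

(** * B-splines and the Euler spline *)

Section truncated_powers.
Context {R : realType}.
Implicit Types x y : R.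

Lemma tpow_ge0 x n : 0 <= x -> tpow x n = x ^+ n.
Proof. by rewrite /tpow => ->. Qed.

Lemma tpow_lt0 x n : x < 0 -> tpow x n = 0.
Proof. by rewrite /tpow ltNge => /negbTE ->. Qed.

Lemma tpowS x n : tpow x n.+1 = tpow x n * x.
Proof. by rewrite /tpow; case: ifP; rewrite ?mul0r// exprSr. Qed.

Lemma tpowSE x n : tpow x n.+1 = ((x + `|x|) / 2) ^+ n.+1.
Proof.
have [x0|x0] := leP 0 x; first by rewrite tpow_ge0// ger0_norm//; congr (_ ^+ _); field.
by rewrite tpow_lt0// ltr0_norm// subrr mul0r expr0n.
Qed.

Lemma continuous_tpow n : continuous (fun x : R => tpow x n.+1).
Proof.
move=> x; rewrite (_ : (fun y => _) = (fun y : R => y ^+ n.+1) \o (fun y => (y + `|y|) / 2)).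
  apply: continuous_comp; last exact: exprn_continuous.
  apply: cvgMl; apply: cvgD; first exact: cvg_id.
  exact: norm_continuous.
by apply/funext => y; rewrite tpowSE.
Qed.

Lemma is_derive_tpow n x :
  is_derive x (1 : R) (fun y : R => tpow y n.+2) (n.+2%:R * tpow x n.+1).
Proof.
have [x0|x0|->] := ltgtP x 0.
- rewrite tpow_lt0// mulr0.
  have e : \forall y \near x, cst 0 y = tpow y n.+2.
    by near=> y; rewrite tpow_lt0//; near: y; exact: lt_nbhsl.
  exact: (near_eq_is_derive e (is_derive_cst 0 x 1)).
- rewrite tpow_ge0 ?(ltW x0)//.
  have e : \forall y \near x, y ^+ n.+2 = tpow y n.+2.
    by near=> y; rewrite tpow_ge0// ltW//; near: y; exact: lt_nbhsr.
  exact: (near_eq_is_derive e (is_derive_pow n.+2 x)).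
(* At 0 the difference quotient is itself a truncated power, continuous and vanishing at 0. *)
apply/is_derive1_caratheodory; exists (fun y => tpow y n.+1); split.
- by move=> y; rewrite (tpow_ge0 _ (lexx 0)) expr0n !subr0 tpowS.
- exact: continuous_tpow.
- by rewrite (tpow_ge0 _ (lexx 0)) expr0n mulr0.
Unshelve. all: by end_near. Qed.

(* The [N]-th difference of the truncated power of degree [j], so that
   [bspline N] is the case [j = N - 1]. *)
Definition tpow_diff (N j : nat) x : R :=
  j`!%:R^-1 * \sum_(nu < N.+1) (-1) ^+ nu * 'C(N, nu)%:R * tpow (x - nu%:R) j.

Lemma sum_signed_bin_rec (N : nat) (f : nat -> R) :
  \sum_(nu < N.+2) (-1) ^+ nu * 'C(N.+1, nu)%:R * f nu =
  \sum_(nu < N.+1) (-1) ^+ nu * 'C(N, nu)%:R * f nu -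
  \sum_(nu < N.+1) (-1) ^+ nu * 'C(N, nu)%:R * f nu.+1.
Proof.
rewrite big_ord_recl /= bin0.
under eq_bigr do rewrite /bump add1n binS natrD mulrDr mulrDl.
rewrite big_split /= addrA; congr (_ + _); last first.
  by rewrite -sumrN; apply: eq_bigr => i _; rewrite exprS mulN1r !mulNr.
rewrite big_ord_recr /= bin_small// mulr0 mul0r addr0 [RHS]big_ord_recl bin0.
by congr (_ + _).
Qed.

(** An [N]-th finite difference annihilates polynomials of degree below [N]: one difference lowers
    the degree, and the induction handles the [N - 1] others. *)
Lemma sum_signed_bin_pow (N j : nat) y : (j < N)%N ->
  \sum_(nu < N.+1) (-1) ^+ nu * 'C(N, nu)%:R * (y - nu%:R) ^+ j = 0.
Proof.
elim: N j y => // N IH j y jN.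
rewrite (sum_signed_bin_rec N (fun nu => (y - nu%:R) ^+ j)) -sumrB.
rewrite (eq_bigr (fun nu : 'I_N.+1 => \sum_(i < j) (- (-1) ^+ (j - i) *+ 'C(j, i)) *
    ((-1) ^+ nu * 'C(N, nu)%:R * (y - nu%:R) ^+ i))); last first.
  move=> nu _; have e (w : R) : (w - 1) ^+ j =
      \sum_(i < j) ((-1) ^+ (j - i) *+ 'C(j, i)) * w ^+ i + w ^+ j.
    rewrite addrC exprDn big_ord_recr /= subnn expr0 mul1r binn mulr1n.
    by congr (_ + _); apply: eq_bigr => i _; rewrite mulrnAl.
  rewrite -(natr1 nu) opprD addrA e -mulrBr opprD addrCA subrr addr0 -sumrN mulr_sumr.
  by apply: eq_bigr => i _; rewrite mulNrn mulNr mulrN mulrCA.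
rewrite exchange_big /= big1// => i _; rewrite -mulr_sumr IH ?mulr0//.
by apply: leq_trans (ltn_ord i) _.
Qed.

Lemma tpow_diff_lt0 N j x : x < 0 -> tpow_diff N j x = 0.
Proof.
move=> x0; rewrite /tpow_diff big1 ?mulr0// => i _.
by rewrite tpow_lt0 ?mulr0//; have := ler0n R i; lra.
Qed.

Lemma tpow_diff_le0 N j x : x <= 0 -> tpow_diff N j.+1 x = 0.
Proof.
rewrite le_eqVlt => /predU1P[->|]; last exact: tpow_diff_lt0.
rewrite /tpow_diff big1 ?mulr0// => -[[|i] iN] _ /=.
  by rewrite tpow_ge0 ?subrr// expr0n mulr0.
by rewrite tpow_lt0 ?mulr0// sub0r oppr_lt0.
Qed.

(** Beyond the last knot all truncated powers are genuine powers, whose [N]-th difference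
    vanishes. *)
Lemma tpow_diff_ge N j x : (j < N)%N -> N%:R <= x -> tpow_diff N j x = 0.
Proof.
move=> jN Nx; rewrite /tpow_diff (eq_bigr (fun nu : 'I_N.+1 =>
    (-1) ^+ nu * 'C(N, nu)%:R * (x - nu%:R) ^+ j)).
  by rewrite sum_signed_bin_pow// mulr0.
move=> nu _; rewrite tpow_ge0// subr_ge0; apply: le_trans Nx.
by rewrite ler_nat -ltnS.
Qed.

Lemma is_derive_tpow_diff N j x :
  is_derive x (1 : R) (tpow_diff N j.+2) (tpow_diff N j.+1 x).
Proof.
have -> : tpow_diff N j.+2 = j.+2`!%:R^-1 *: \sum_(nu < N.+1)
    (fun y => ((-1) ^+ nu * 'C(N, nu)%:R) * tpow (y - nu%:R) j.+2).
  by apply/funext => y; rewrite !fctE fct_sumE.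
have -> : tpow_diff N j.+1 x = j.+2`!%:R^-1 *: \sum_(nu < N.+1)
    (((-1) ^+ nu * 'C(N, nu)%:R) * (j.+2%:R * tpow (x - nu%:R) j.+1)).
  rewrite /tpow_diff /GRing.scale /= (factS j.+1) natrM invfM.
  rewrite [in RHS](eq_bigr (fun nu : 'I_N.+1 =>
    j.+2%:R * ((-1) ^+ nu * 'C(N, nu)%:R * tpow (x - nu%:R) j.+1))).
    rewrite -mulr_sumr; field.
    by rewrite !pnatr_eq0 -lt0n fact_gt0 /=.
  by move=> i _; ring.
apply: is_deriveZ; apply: is_derive_sum => nu; apply: is_deriveZ.
have h : is_derive x (1 : R) (fun y : R => y - nu%:R) 1.
  by apply: is_derive_eq; rewrite subr0.
have := @is_derive1_comp _ (fun y => tpow y j.+2) (fun y => y - nu%:R) x _ _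
  (is_derive_tpow j (x - nu%:R)) h.
by rewrite mulr1.
Qed.

Lemma tpow_diff_rec N j x : tpow_diff N.+1 j x = tpow_diff N j x - tpow_diff N j (x - 1).
Proof.
rewrite /tpow_diff (sum_signed_bin_rec N (fun nu => tpow (x - nu%:R) j)) mulrBr.
congr (_ - _ * _); apply: eq_bigr => i _; congr (_ * tpow _ _).
by rewrite -natr1; ring.
Qed.

End truncated_powers.

Section bsplines.
Context {R : realType}.
Implicit Types x y : R.

Lemma bsplineE N x : bspline N x = tpow_diff N N.-1 x.
Proof. by []. Qed.

Lemma bspline_lt0 N x : x < 0 -> bspline N x = 0.
Proof. exact: tpow_diff_lt0. Qed.

Lemma bspline_ge N x : (0 < N)%N -> N%:R <= x -> bspline N x = 0.
Proof. by case: N => // N _; exact: tpow_diff_ge. Qed.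

Lemma bspline1 x : bspline 1 x = if 0 <= x < 1 then 1 else 0.
Proof.
rewrite /bspline /= !big_ord_recl big_ord0 /= /bump /= expr0 expr1 !bin0 binn fact0.
rewrite invr1 subr0 !mul1r addr0 mulr1 mulN1r /tpow !expr0 subr_ge0.
by have [x0|x0] := leP 0 x; have [x1|x1] := leP 1 x; rewrite ?subrr ?subr0 ?oppr0 ?addr0//; lra.
Qed.

(** The absorption identity [nu C(M, nu) = (M - nu + 1) C(M, nu - 1)] and a shift of the index. *)
Lemma sum_signed_bin_shift M (g : nat -> R) :
  \sum_(nu < M.+1) (-1) ^+ nu * 'C(M, nu)%:R * (nu%:R * g nu) =
  - \sum_(nu < M.+1) (-1) ^+ nu * 'C(M, nu)%:R * ((M%:R - nu%:R) * g nu.+1).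
Proof.
rewrite big_ord_recl mul0r mulr0 add0r [in RHS]big_ord_recr /= subrr mul0r mulr0 addr0.
rewrite -sumrN; apply: eq_bigr => nu _; rewrite /bump add1n exprS mulN1r !mulNr.
congr (- _); rewrite -!mulrA; congr (_ * _); rewrite !mulrA; congr (_ * _).
rewrite -natrB 1?ltnW// -!natrM mulnC; congr (_%:R).
by rewrite mul_bin_left mulnC.
Qed.

(** The Cox-de Boor recurrence for integer knots. One factor [x - nu] is split off each truncated
    power; the sums weighted by [nu] that remain cancel by [sum_signed_bin_shift]. The recurrence is
    what gives positivity and the partition of unity. *)
Lemma bspline_rec N x : (0 < N)%N ->
  N%:R * bspline N.+1 x = x * bspline N x + (N.+1%:R - x) * bspline N (x - 1).
Proof.
case: N => // N _; rewrite /bspline /= factS natrM invfM.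
have n0 : N.+1%:R != 0 :> R by rewrite pnatr_eq0.
have f0 : N`!%:R != 0 :> R by rewrite pnatr_eq0 -lt0n fact_gt0.
pose T (nu : nat) := tpow (x - nu%:R) N.
rewrite (eq_bigr (fun nu : 'I_N.+3 => (-1) ^+ nu * 'C(N.+2, nu)%:R * ((x - nu%:R) * T nu))); last first.
  by move=> nu _; rewrite tpowS /T [_ * (x - _)]mulrC.
rewrite (sum_signed_bin_rec N.+1 (fun nu => (x - nu%:R) * T nu)).
set A := \sum_(nu < N.+2) (-1) ^+ nu * 'C(N.+1, nu)%:R * tpow (x - nu%:R) N.
set B := \sum_(nu < N.+2) (-1) ^+ nu * 'C(N.+1, nu)%:R * tpow (x - 1 - nu%:R) N.
have -> : \sum_(nu < N.+2) (-1) ^+ nu * 'C(N.+1, nu)%:R * ((x - nu%:R) * T nu) =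
    x * A - \sum_(nu < N.+2) (-1) ^+ nu * 'C(N.+1, nu)%:R * (nu%:R * T nu).
  rewrite /A mulr_sumr -sumrB; apply: eq_bigr => nu _; rewrite -/(T nu); ring.
have -> : \sum_(nu < N.+2) (-1) ^+ nu * 'C(N.+1, nu)%:R * ((x - nu.+1%:R) * T nu.+1) =
    (x - N.+2%:R) * B + \sum_(nu < N.+2) (-1) ^+ nu * 'C(N.+1, nu)%:R * ((N.+1%:R - nu%:R) * T nu.+1).
  rewrite /B mulr_sumr -big_split; apply: eq_bigr => nu _ /=.
  have -> : tpow (x - 1 - nu%:R) N = T nu.+1 by rewrite /T -natr1; congr tpow; ring.
  by rewrite -natr1 -(natr1 N.+1); ring.
rewrite sum_signed_bin_shift; set S := \sum_(nu < N.+2) _ * ((_ - _) * _).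
have {}n0 : 1 + N%:R != 0 :> R by rewrite addrC natr1.
by field; rewrite f0 n0.
Qed.

Lemma bspline_ge0 N x : (0 < N)%N -> 0 <= bspline N x.
Proof.
elim: N x => // -[_ x _|N IH x _]; first by rewrite bspline1; case: ifP.
have [x0|x0] := ltP x 0; first by rewrite bspline_lt0.
have [xN|xN] := leP N.+2%:R x; first by rewrite bspline_ge.
suff : 0 <= N.+1%:R * bspline N.+2 x by rewrite pmulr_rge0// ltr0n.
by rewrite bspline_rec// addr_ge0// mulr_ge0 ?IH// subr_ge0 ltW.
Qed.

(** Summing the recurrence over the integers, each value of lower order is collected twice, and its
    two weights add up to the factor on the left of the recurrence. *)
Lemma sum_bspline N : (0 < N)%N -> \sum_(j < N.+1) bspline N j%:R = 1 :> R.
Proof.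
elim: N => // -[_ _|N IH _].
  rewrite !big_ord_recl big_ord0 !bspline1 /= lexx ltr01 /bump /= ltxx andbF.
  by rewrite !addr0.
have N0 : N.+1%:R != 0 :> R by rewrite pnatr_eq0.
apply: (mulfI N0); rewrite mulr1 mulr_sumr.
under eq_bigr do rewrite bspline_rec//.
rewrite big_split /= big_ord_recr /= bspline_ge ?ler_nat// mulr0 addr0.
rewrite [X in _ + X]big_ord_recl /= bspline_lt0 ?mulr0 ?add0r; last by lra.
transitivity (N.+1%:R * \sum_(j < N.+2) bspline N.+1 j%:R : R); last by rewrite IH ?mulr1.
rewrite -big_split /= mulr_sumr; apply: eq_bigr => i _.
rewrite /bump add1n -!natr1.
have -> : i%:R + 1 - 1 = i%:R :> R by ring.
by ring.
Qed.

(* For [0 <= x <= 1] this is the sum over all integers [j] of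
   [bspline N (x + j) z^j], an exponential Euler spline. *)
Definition euler_spline (N : nat) (z : R[i]) x : R[i] :=
  \sum_(j < N) (bspline N (x + j%:R))%:C * z ^+ j.

Lemma bspline2E x : bspline 2 x = x * bspline 1 x + (2 - x) * bspline 1 (x - 1).
Proof. by have := @bspline_rec 1 x isT; rewrite mul1r. Qed.

Lemma bspline2_left x : 0 <= x <= 1 -> bspline 2 x = x.
Proof.
move=> /andP[x0]; rewrite bspline2E !bspline1 le_eqVlt.
move=> /predU1P[->|x1].
  by rewrite subrr ltxx lexx ltr01 andbF /=; ring.
have -> : (0 <= x - 1) = false by apply/negbTE; rewrite -ltNge subr_lt0.
by rewrite x0 x1 /= mulr1 mulr0 addr0.
Qed.

Lemma bspline2_right x : 1 <= x <= 2 -> bspline 2 x = 2 - x.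
Proof.
move=> /andP[x1]; rewrite bspline2E !bspline1 le_eqVlt.
have -> : (x < 1) = false by apply/negbTE; rewrite -leNgt.
rewrite andbF mulr0 add0r => /predU1P[->|x2]; first by rewrite subrr mul0r.
by rewrite subr_ge0 x1 ltrBlDl x2 mulr1.
Qed.

Lemma euler_spline2 z x : 0 <= x <= 1 -> euler_spline 2 z x = x%:C + (1 - x)%:C * z.
Proof.
move=> x01; rewrite /euler_spline !big_ord_recl big_ord0 /= /bump /= addr0 addn0.
rewrite expr0 mulr1 addr0 bspline2_left// bspline2_right; last by lra.
by rewrite expr1; congr (_ + _%:C * _); ring.
Qed.

Lemma is_cderive_euler_spline N z x : 0 <= x <= 1 ->
  is_cderive (euler_spline N.+3 z) x ((1 - z) * euler_spline N.+2 z x).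
Proof.
move=> x01.
have -> : (1 - z) * euler_spline N.+2 z x = \sum_(j < N.+3)
    (tpow_diff N.+3 N.+1 (x + j%:R))%:C * z ^+ j.
  rewrite (eq_bigr (fun j : 'I_N.+3 => (bspline N.+2 (x + j%:R))%:C * z ^+ j
      - (bspline N.+2 (x + j%:R - 1))%:C * z ^+ j)); last first.
    by move=> j _; rewrite tpow_diff_rec rmorphB mulrBl.
  rewrite sumrB mulrBl mul1r; congr (_ - _).
    rewrite big_ord_recr /= [bspline _ _]bspline_ge ?mul0r ?addr0//.
    by case/andP: x01 => x0 _; rewrite lerDr.
  rewrite big_ord_recl /= [bspline _ _]tpow_diff_le0 ?mul0r ?add0r; last by lra.
  rewrite /euler_spline mulr_sumr; apply: eq_bigr => j _.
  rewrite /bump add1n exprS -natr1 mulrCA; congr (_ %:C * _).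
  by congr bspline; ring.
apply: is_cderive_sum => j.
have h : is_derive x (1 : R) (fun y : R => y + j%:R) 1.
  by apply: is_derive_eq; rewrite addr0.
have := @is_derive1_comp _ (bspline N.+3) (fun y => y + j%:R) x _ _
  (is_derive_tpow_diff N.+3 N (x + j%:R)) h.
rewrite mulr1 => /is_cderive_real bd.
apply: is_cderive_eq (is_cderiveM bd (is_cderive_cst (z ^+ j) x)) _.
by rewrite mulr0 addr0.
Qed.

Lemma euler_spline01 N z : euler_spline N.+2 z 0 = z * euler_spline N.+2 z 1.
Proof.
rewrite /euler_spline big_ord_recl [in RHS]big_ord_recr /=.
rewrite [bspline _ (0 + 0)]tpow_diff_le0 ?addr0// mul0r add0r.
rewrite [bspline _ (1 + _)]bspline_ge// ?mul0r ?addr0.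
rewrite mulr_sumr; apply: eq_bigr => j _; rewrite /bump add1n exprS add0r mulrCA.
by rewrite -natr1 addrC.
Qed.

(** At [x = 1] the exponential has modulus 1, so only the power of the eigenvalue survives in the
    modulus of the main term. *)
Lemma euler_spline_asymp (N : nat) (d : R) : d != 0 -> cis (- d) != 1 :> R[i] ->
  `| cmod (euler_spline N.+2 (cis (- d)) 1) - (cmod (1 - cis (- d)) / `|d|) ^+ N.+2 | <=
  2 * (`|d| / 2) ^+ N.+1.
Proof.
move=> d0 zd; pose z : R[i] := cis (- d); have q0 : 1 - z != 0 by rewrite subr_eq0 eq_sym.
(* The spline of order 2 has kinks at 0 and 1, whereas the recursion asks for two-sided derivatives
   on the closed interval; it is therefore replaced by its affine expression on [[0, 1]], and order
   1 by the constant 1. *)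
pose Y n x : R[i] := match n with 0%N => 1 | 1%N => x%:C + (1 - x)%:C * z
  | n.+2 => euler_spline n.+3 z x end.
have YE n x : 0 <= x <= 1 -> Y n.+1 x = euler_spline n.+2 z x.
  by case: n => // x01; rewrite euler_spline2.
have := @euler_spline_dist _ d d0 Y _ _ _ N.+1 1 q0.
rewrite YE ?lexx ?ler01// mulr1 [_ ^+ _ * 2]mulrC -/z => H.
have -> : (cmod (1 - z) / `|d|) ^+ N.+2 = cmod (((1 - z) / ('i * d%:C)) ^+ N.+2 * cis d).
  by rewrite cmodM cmod_cis mulr1 cmodX cmodM cmodV cmodM cmod_i mul1r cmod_real.
apply: (le_trans (ler_cmod_dist _ _)); apply: H => //.
- move=> [|n] y y01.
    have h : is_derive y (1 : R) (fun t : R => 1 - t) (- 1).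
      by apply: is_derive_eq; rewrite /GRing.scale /=; ring.
    rewrite mulr1; apply: is_cderive_eq
      (is_cderiveD (is_cderive_id y) (is_cderiveM (is_cderive_real h) (is_cderive_cst z y))) _.
    by rewrite mulr0 addr0 rmorphN mulN1r.
  by rewrite YE//; exact: is_cderive_euler_spline.
- by move=> n; rewrite !YE ?lexx ?ler01// euler_spline01.
Qed.

End bsplines.

(** * Fourier transforms of piecewise polynomials and of the spline wavelets *)

Section spline_fourier.
Context {R : realType}.
Local Notation mu := (@lebesgue_measure R).
Implicit Types (f F : R -> R[i]) (a b x w : R).

Lemma continuous_integrable_itv (g : R -> R) a b : continuous g ->
  mu.-integrable `[a, b] (EFin \o g).
Proof.
move=> cg; apply: continuous_compact_integrable; first exact: segment_compact.
exact: continuous_subspaceT.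
Qed.

Lemma Rintegral_sum_itv n (g : 'I_n -> R -> R) a b : (forall i, continuous (g i)) ->
  \int[mu]_(x in `[a, b]) (\sum_(i < n) g i x) = \sum_(i < n) \int[mu]_(x in `[a, b]) g i x.
Proof.
elim: n g => [|n IH] g cg.
  rewrite big_ord0 /Rintegral; under eq_integral do rewrite big_ord0.
  by rewrite integral0.
rewrite big_ord_recl -IH//.
under eq_Rintegral do rewrite big_ord_recl.
rewrite RintegralD//; first exact: continuous_integrable_itv.
apply: continuous_integrable_itv => x.
by apply: continuous_big => //=; exact: add_continuous.
Qed.

Lemma Rintegral_FTC (g G : R -> R) a b : a <= b -> continuous g ->
  (forall x, is_derive x 1 G (g x)) -> \int[mu]_(x in `[a, b]) g x = G b - G a.
Proof.
rewrite le_eqVlt => /predU1P[->|ab] cg dG; first by rewrite set_itv1 Rintegral_set1 subrr.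
have cG : continuous G.
  move=> x; apply: differentiable_continuous; apply/derivable1_diffP.
  by have [] := dG x.
rewrite /Rintegral (@continuous_FTC2 _ g G a b)//.
- exact: continuous_subspaceT.
- split; first by move=> x _; have [] := dG x.
  + by apply: cvg_at_right_filter; exact: cG.
  + by apply: cvg_at_left_filter; exact: cG.
- by move=> x _; rewrite derive1E; have [_ ->] := dG x.
Qed.

(** Repeated integration by parts of [(x - t)^n / n!] against [cis (- w * x)]. *)
Fixpoint pow_cis_primitive (n : nat) (t w : R) x : R[i] :=
  if n is n'.+1 then
    ('i * w%:C)^-1 * (pow_cis_primitive n' t w x - ((n`!%:R^-1 * (x - t) ^+ n)%:C * cis (- w * x)))
  else - ('i * w%:C)^-1 * cis (- w * x).

Lemma iM_neq0 w : w != 0 -> 'i * w%:C != 0 :> R[i].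
Proof.
move=> w0; apply/eqP => /(congr1 cmod); rewrite cmodM cmod_i cmod0 mul1r cmod_real => /eqP.
by rewrite normr_eq0 (negbTE w0).
Qed.

Lemma is_cderive_pow_cis_primitive n t w x : w != 0 ->
  is_cderive (pow_cis_primitive n t w) x ((n`!%:R^-1 * (x - t) ^+ n)%:C * cis (- w * x)).
Proof.
move=> /iM_neq0 J0.
have dc y : is_cderive (fun t => cis (- w * t)) y (- ('i * w%:C) * cis (- w * y)).
  by apply: is_cderive_eq (is_cderive_cis (- w) y) _; rewrite rmorphN /= mulrN.
elim: n => [|n IH] /=.
  rewrite fact0 invr1 expr0 mulr1 mul1r; apply: is_cderive_eq (is_cderiveZ _ (dc x)) _.
  by rewrite 2!mulNr mulrN opprK mulrA mulVf// mul1r.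
have h : is_derive x (1 : R) (fun y : R => n.+1`!%:R^-1 * (y - t) ^+ n.+1) (n`!%:R^-1 * (x - t) ^+ n).
  have h : is_derive x (1 : R) (fun y : R => y - t) 1.
    by apply: is_derive_eq; rewrite subr0.
  have := @is_derive1_comp _ (fun y => n.+1`!%:R^-1 * y ^+ n.+1) (fun y => y - t) x _ _
    (is_derive_monom n (x - t)) h.
  by rewrite mulr1.
have := is_cderiveB IH (is_cderiveM (is_cderive_real h) (dc x)).
move/(is_cderiveZ ('i * w%:C)^-1) => H; apply: is_cderive_eq H _.
move: (n`!%:R^-1 * (x - t) ^+ n)%:C (n.+1`!%:R^-1 * (x - t) ^+ n.+1)%:C => B C.
move: (cis (- w * x)) ('i * w%:C) J0 => A J J0.
by field; exact: J0.
Qed.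

(** Each primitive is [cis (- w * x)] times a polynomial of degree [n] in [x - t i], with
    coefficients independent of [i]; the vanishing moments thus remove the whole combination. *)
Lemma sum_pow_cis_primitive k n (b t : 'I_k -> R) w x :
  (forall j, (j <= n)%N -> \sum_(i < k) b i * (x - t i) ^+ j = 0) ->
  \sum_(i < k) (b i)%:C * pow_cis_primitive n (t i) w x = 0.
Proof.
elim: n => [|n IH] bt.
  rewrite /= -mulr_suml -rmorph_sum /=.
  rewrite (_ : \sum_(i < k) b i = 0) ?mul0r// -[RHS](bt 0%N isT).
  by apply: eq_bigr => i _; rewrite expr0 mulr1.
pose c : R := n.+1`!%:R^-1; pose I := ('i * w%:C)^-1.
rewrite (eq_bigr (fun i => I * ((b i)%:C * pow_cis_primitive n (t i) w x
   - (c * (b i * (x - t i) ^+ n.+1))%:C * cis (- w * x)))); last first.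
  by move=> i _ /=; rewrite -/c -/I mulrCA mulrBr !rmorphM /=; ring.
rewrite -mulr_sumr sumrB IH ?sub0r; last by move=> j jn; apply: bt; exact: leqW.
by rewrite -mulr_suml -rmorph_sum -mulr_sumr bt// mulr0 mul0r oppr0 mulr0.
Qed.

Lemma pow_cis_primitive_start n t w :
  pow_cis_primitive n t w t = - ('i * w%:C) ^- n.+1 * cis (- w * t).
Proof.
elim: n => [|n IH] /=; first by rewrite expr1.
by rewrite IH subrr expr0n mulr0 mul0r subr0 mulrA mulrN -invfM -exprS.
Qed.

Lemma continuous_comp_subr (g : R -> R) t : continuous g -> continuous (fun x => g (x - t)).
Proof.
move=> cg x; apply: (@continuous_comp _ _ _ (fun x => x - t) g); last exact: cg.
by apply: cvgB; [exact: cvg_id|exact: cvg_cst].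
Qed.

Lemma continuous_mul (f g : R -> R) : continuous f -> continuous g ->
  continuous (fun x => f x * g x).
Proof. by move=> cf cg x; apply: cvgM; [exact: cf|exact: cg]. Qed.

Lemma continuous_scale_arg (g : R -> R) c : continuous g -> continuous (fun x => g (c * x)).
Proof.
move=> cg x; apply: (@continuous_comp _ _ _ (fun x => c * x) g); last exact: cg.
by apply: cvgM; [exact: cvg_cst|exact: cvg_id].
Qed.

Lemma Rintegral_tpow (g G : R -> R) n t T : 0 <= t <= T -> continuous g ->
  (forall x, is_derive x 1 G ((x - t) ^+ n.+1 * g x)) ->
  \int[mu]_(x in `[0, T]) (tpow (x - t) n.+1 * g x) = G T - G t.
Proof.
move=> /andP[t0 tT] cg dG.
rewrite -(Rintegral_FTC tT _ dG); last first.
  by apply: continuous_mul => //; apply: (@continuous_comp_subr (fun y => y ^+ n.+1)); exact: exprn_continuous.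
rewrite Rintegral_mkcond [RHS]Rintegral_mkcond; congr Rintegral; apply/funext => x.
rewrite !patchE !mem_setE !in_itv /=.
have [tx|xt] := leP t x; first by rewrite (le_trans t0 tx) /= tpow_ge0 ?subr_ge0.
by rewrite tpow_lt0 ?subr_lt0// mul0r if_same.
Qed.

(* Laplace's formula for a linear combination of truncated powers with compact
   support: the contributions at the right end of the support cancel. *)
Lemma cintegral_tpow k n (b t : 'I_k -> R) (T w : R) : w != 0 ->
  (forall i, 0 <= t i <= T) ->
  (forall x j, (j <= n.+1)%N -> \sum_(i < k) b i * (x - t i) ^+ j = 0) ->
  cintegral (fun x => (\sum_(i < k) b i * tpow (x - t i) n.+1)%:C * cis (- (x * w))) =
  n.+1`!%:R%:C * ('i * w%:C) ^- n.+2 * \sum_(i < k) (b i)%:C * cis (- (t i * w)).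
Proof.
move=> w0 tT bt.
pose f x := \sum_(i < k) b i * tpow (x - t i) n.+1.
have f0 x : x \notin `[0, T]%R -> f x = 0.
  rewrite in_itv /= negb_and -!ltNge => /orP[x0|xT].
    by rewrite /f big1// => i _; rewrite tpow_lt0 ?mulr0//; have := tT i; lra.
  rewrite -[RHS](bt x n.+1 (leqnn _)); apply: eq_bigr => i _.
  by rewrite tpow_ge0//; have := tT i; lra.
have F0 : n.+1`!%:R != 0 :> R by rewrite pnatr_eq0 -lt0n fact_gt0.
pose P i x := (n.+1`!%:R)%:C * pow_cis_primitive n.+1 (t i) w x.
have dP i x : is_cderive (P i) x (((x - t i) ^+ n.+1)%:C * cis (- w * x)).
  apply: is_cderive_eq (is_cderiveZ _ (is_cderive_pow_cis_primitive n.+1 (t i) x w0)) _.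
  by rewrite mulrA -rmorphM /= mulrA (divff F0) mul1r.
have ReM (r : R) z : complex.Re (r%:C * z) = r * complex.Re z.
  by case: z => p q /=; rewrite mul0r subr0.
have ImM (r : R) z : complex.Im (r%:C * z) = r * complex.Im z.
  by case: z => p q /=; rewrite mul0r addr0.
have ReB (z v : R[i]) : complex.Re (z - v) = complex.Re z - complex.Re v by case: z v => ? ? [].
have ImB (z v : R[i]) : complex.Im (z - v) = complex.Im z - complex.Im v by case: z v => ? ? [].
have main (g : R -> R) (G : 'I_k -> R -> R) : continuous g ->
    (forall i x, is_derive x 1 (G i) ((x - t i) ^+ n.+1 * g x)) ->
    \int[mu]_x (f x * g x) = \sum_(i < k) b i * (G i T - G i (t i)).
  move=> cg dG; transitivity (\int[mu]_(x in `[0, T]) (f x * g x)).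
    rewrite [RHS]Rintegral_mkcond; congr Rintegral; apply/funext => x.
    rewrite patchE mem_setE; case: ifPn => // /f0 ->.
    by rewrite mul0r.
  under eq_Rintegral do rewrite /f mulr_suml.
  have ct i : continuous (fun x => tpow (x - t i) n.+1 * g x).
    by apply: continuous_mul => //; exact: (@continuous_comp_subr (fun x => tpow x n.+1) (t i) (@continuous_tpow _ n)).
  have cb i : continuous (fun x => b i * tpow (x - t i) n.+1 * g x).
    move=> x; rewrite (_ : (fun x => _) = (fun x => b i * (tpow (x - t i) n.+1 * g x))).
      by apply: cvgM; [exact: cvg_cst|exact: ct].
    by apply/funext => y; rewrite mulrA.
  rewrite Rintegral_sum_itv//; apply: eq_bigr => i _.
  under eq_Rintegral do rewrite -mulrA.
  rewrite RintegralZl//; last exact: continuous_integrable_itv.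
  by rewrite (@Rintegral_tpow g (G i) n (t i) T).
have mainRe := main (fun x => complex.Re (cis (- w * x))) (fun i x => complex.Re (P i x)).
have mainIm := main (fun x => complex.Im (cis (- w * x))) (fun i x => complex.Im (P i x)).
have cRe : continuous (fun x => complex.Re (cis (- w * x))).
  by apply: (@continuous_scale_arg cos); exact: continuous_cos.
have cIm : continuous (fun x => complex.Im (cis (- w * x))).
  by apply: (@continuous_scale_arg sin); exact: continuous_sin.
have Re_sum (z : 'I_k -> R[i]) : complex.Re (\sum_(i < k) z i) = \sum_(i < k) complex.Re (z i).
  by apply: (big_morph _ _ _) => // -[? ?] [].
have Im_sum (z : 'I_k -> R[i]) : complex.Im (\sum_(i < k) z i) = \sum_(i < k) complex.Im (z i).
  by apply: (big_morph _ _ _) => // -[? ?] [].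
have xw x : - (x * w) = - w * x by rewrite mulrC mulNr.
transitivity (\sum_(i < k) (b i)%:C * (P i T - P i (t i))).
  rewrite /cintegral [RHS](_ : _ = complex.Re (\sum_(i < k) (b i)%:C * (P i T - P i (t i)))
    +i* complex.Im (\sum_(i < k) (b i)%:C * (P i T - P i (t i)))); last by case: (\sum_(i < k) _).
  congr (_ +i* _).
    under eq_Rintegral do rewrite ReM xw.
    apply: etrans (mainRe cRe _) _; first by move=> i x; have [+ _] := dP i x; rewrite ReM.
    by rewrite Re_sum; apply: eq_bigr => i _; rewrite [in RHS]ReM ReB.
  under eq_Rintegral do rewrite ImM xw.
  apply: etrans (mainIm cIm _) _; first by move=> i x; have [_ +] := dP i x; rewrite ImM.
  by rewrite Im_sum; apply: eq_bigr => i _; rewrite [in RHS]ImM ImB.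
rewrite (eq_bigr (fun i => n.+1`!%:R%:C * ((b i)%:C * pow_cis_primitive n.+1 (t i) w T) +
    n.+1`!%:R%:C * ('i * w%:C) ^- n.+2 * ((b i)%:C * cis (- (t i * w))))); last first.
  move=> i _; rewrite /P pow_cis_primitive_start xw.
  by move: ('i * w%:C) => J; ring.
rewrite big_split -mulr_sumr -[X in _ + X = _]mulr_sumr.
rewrite sum_pow_cis_primitive ?mulr0 ?add0r//.
by move=> j jn; exact: bt.
Qed.

End spline_fourier.

Section spline_wavelet_fourier.
Context {R : realType}.
Implicit Types (x w : R).

Lemma derive1n_tpow_diff N j i : derive1n j (tpow_diff N (j + i.+1)) = tpow_diff N i.+1 :> (R -> R).
Proof.
elim: j i => [|j IH] i; first by rewrite add0n derive1n0.
rewrite derive1nS addSnnS IH; apply/funext => x; rewrite derive1E.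
by have [_ ->] := is_derive_tpow_diff N i x.
Qed.

Lemma derive1n_bspline n : derive1n n.+2 (bspline n.+2.*2) = tpow_diff n.+2.*2 n.+1 :> (R -> R).
Proof.
rewrite -(derive1n_tpow_diff n.+2.*2 n.+2 n); congr derive1n; apply/funext => x.
by rewrite bsplineE; congr tpow_diff; rewrite -addnn addnS.
Qed.

Lemma tpow_scale (c x : R) n : 0 < c -> tpow (c * x) n = c ^+ n * tpow x n.
Proof. by move=> c0; rewrite /tpow pmulr_rge0//; case: ifP; rewrite ?mulr0// exprMn. Qed.

(** With [knot], this presents the wavelet of order [n + 2] as one combination of truncated powers:
    the first index is the translate of the B-spline, the second its knot. The factor [2^(n+1)]
    produced by the dilation cancels the normalization of the wavelet. *)
Let coef n (nl : 'I_n.+2.*2.-1 * 'I_n.+2.*2.+1) : R :=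
  ((-1) ^+ nl.1 * bspline n.+2.*2 nl.1.+1%:R) *
  (n.+1`!%:R^-1 * ((-1) ^+ nl.2 * 'C(n.+2.*2, nl.2)%:R)).

Let knot n (nl : 'I_n.+2.*2.-1 * 'I_n.+2.*2.+1) : R := (nl.1%:R + nl.2%:R) / 2.

Lemma spline_waveletE n x : spline_wavelet n.+2 x =
  \sum_(nl : 'I_n.+2.*2.-1 * 'I_n.+2.*2.+1) coef nl * tpow (x - knot nl) n.+1.
Proof.
rewrite /spline_wavelet derive1n_bspline.
rewrite -(pair_bigA _ (fun nu l => coef (nu, l) * tpow (x - knot (nu, l)) n.+1)) /=.
apply: eq_bigr => nu _; rewrite /tpow_diff !mulr_sumr; apply: eq_bigr => l _.
rewrite /coef /knot /=.
have -> : 2 * x - nu%:R - l%:R = 2 * (x - (nu%:R + l%:R) / 2) by field.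
rewrite tpow_scale//; have : 2 ^+ n.+1 != 0 :> R by rewrite expf_neq0// pnatr_eq0.
move: (2 ^+ n.+1) (n.+1`!%:R^-1) => c d c0; field.
exact: c0.
Qed.

Lemma coef_moment n x j : (j <= n.+1)%N ->
  \sum_(nl : 'I_n.+2.*2.-1 * 'I_n.+2.*2.+1) coef nl * (x - knot nl) ^+ j = 0.
Proof.
move=> jn; rewrite -(pair_bigA _ (fun nu l => coef (nu, l) * (x - knot (nu, l)) ^+ j)) /=.
rewrite big1// => nu _; rewrite /coef /knot /=.
pose c : R := (-1) ^+ nu * bspline n.+2.*2 nu.+1%:R * n.+1`!%:R^-1 / 2 ^+ j.
rewrite (eq_bigr (fun l : 'I_n.+2.*2.+1 =>
    c * ((-1) ^+ l * 'C(n.+2.*2, l)%:R * (2 * x - nu%:R - l%:R) ^+ j))).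
  rewrite -mulr_sumr sum_signed_bin_pow ?mulr0//.
  by lia.
move=> l _; have -> : 2 * x - nu%:R - l%:R = 2 * (x - (nu%:R + l%:R) / 2) by field.
rewrite exprMn /c; have : 2 ^+ j != 0 :> R by rewrite expf_neq0// pnatr_eq0.
move: (2 ^+ j) (n.+1`!%:R^-1) => e d e0; field.
exact: e0.
Qed.

(** With [u = cis (- w / 2)], each knot contributes a product of a power of [u] for the translate
    and one for the knot of the B-spline, so the double sum factors: the first gives the Euler
    spline at [- u], the second the binomial expansion of [(1 - u)^(2m)]. *)
Lemma cintegral_spline n w : w != 0 ->
  cintegral (fun x => spline_waveletC n.+2 x * cis (- (x * w))) =
  ('i * w%:C) ^- n.+2 * euler_spline n.+2.*2 (- cis (- w / 2)) 1 * (1 - cis (- w / 2)) ^+ n.+2.*2.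
Proof.
move=> w0; pose T : finType := ('I_n.+2.*2.-1 * 'I_n.+2.*2.+1)%type.
pose k := #|T|.
pose b (i : 'I_k) : R := coef (enum_val i : T); pose t (i : 'I_k) := knot (enum_val i : T).
have sumE (V : nmodType) (F : T -> V) : \sum_(i < k) F (enum_val i) = \sum_(nl : T) F nl.
  by rewrite [RHS]big_enum_val.
have kE i : 0 <= t i <= n.+2.*2%:R.
  rewrite /t /knot; case: (enum_val _) => -[a la] [c lc] /=.
  rewrite divr_ge0 ?addr_ge0//= ler_pdivrMr// -natrD -natrM ler_nat; lia.
have := @cintegral_tpow _ k n b t n.+2.*2%:R w w0 kE.
have -> : (fun x => (\sum_(i < k) b i * tpow (x - t i) n.+1)%:C * cis (- (x * w))) =
    (fun x => spline_waveletC n.+2 x * cis (- (x * w))).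
  apply/funext => x; rewrite /spline_waveletC spline_waveletE.
  by rewrite (sumE _ (fun nl => coef nl * tpow (x - knot nl) n.+1)).
move=> ->; last first.
  by move=> x j jn; rewrite (sumE _ (fun nl => coef nl * (x - knot nl) ^+ j)) coef_moment.
rewrite (sumE _ (fun nl => (coef nl)%:C * cis (- (knot nl * w)))) {k b t sumE kE}.
rewrite -(pair_bigA _ (fun nu l => (coef (nu, l))%:C * cis (- (knot (nu, l) * w)))) /=.
set u := cis (- w / 2).
have uE (a c : nat) : cis (- ((a%:R + c%:R) / 2 * w)) = u ^+ a * u ^+ c.
  by rewrite -!cisMn -cisD; congr cis; field.
have F0 : n.+1`!%:R%:C != 0 :> R[i].
  by rewrite fmorph_eq0 pnatr_eq0 -lt0n fact_gt0.
have -> : euler_spline n.+2.*2 (- u) 1 =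
    \sum_(nu < n.+2.*2.-1) ((-1) ^+ nu * bspline n.+2.*2 nu.+1%:R)%:C * u ^+ nu.
  rewrite /euler_spline; have -> : n.+2.*2 = n.+2.*2.-1.+1 by lia.
  rewrite big_ord_recr /= [bspline _ _]bspline_ge// ?mul0r ?addr0.
  apply: eq_bigr => nu _; rewrite -natr1 addrC; move: (bspline _ _) => B.
  by rewrite [(- u) ^+ _]exprNn rmorphM rmorphXn rmorphN rmorph1 mulrCA mulrA.
have -> : (1 - u) ^+ n.+2.*2 =
    \sum_(l < n.+2.*2.+1) ((-1) ^+ l * 'C(n.+2.*2, l)%:R)%:C * u ^+ l.
  rewrite exprBn; apply: eq_bigr => l _; rewrite expr1n mulr1 -mulr_natr.
  by rewrite !rmorphM rmorphXn rmorphN rmorph1 rmorph_nat /= mulrAC.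
rewrite -!mulrA mulrCA; congr (_ * _).
rewrite !mulr_suml mulr_sumr; apply: eq_bigr => nu _.
rewrite !mulr_sumr; apply: eq_bigr => l _.
rewrite /coef /knot /= uE; move: (bspline _ _) => b; rewrite !rmorphM fmorphV /=.
move: (n.+1`!%:R%:C) F0 (u ^+ nu) (u ^+ l) => F F0 A B.
field.
exact: F0.
Qed.

Lemma cmod_sub_cis (x : R) : cmod (1 - cis x) ^+ 2 = 4 * sin (x / 2) ^+ 2.
Proof.
rewrite sqr_cmod /=.
have -> : x = x / 2 + x / 2 by field.
rewrite cosD sinD; have -> : (x / 2 + x / 2) / 2 = x / 2 by field.
have := cos2Dsin2 (x / 2); move: (cos _) (sin _) => c s cs.
have -> : (1 - (c * c - s * s)) ^+ 2 + (0 - (s * c + c * s)) ^+ 2 =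
  1 - 2 * (c ^+ 2 - s ^+ 2) + (c ^+ 2 + s ^+ 2) ^+ 2 by ring.
rewrite cs; have -> : c ^+ 2 = 1 - s ^+ 2 by rewrite -cs; ring.
by ring.
Qed.

Lemma cmod_fourier_spline n w : w != 0 ->
  cmod (fourier (spline_waveletC n.+2) w) = (Num.sqrt (2 * pi))^-1 *
  (cmod (euler_spline n.+2.*2 (- cis (- w / 2)) 1) * (4 * sin (w / 4) ^+ 2 / `|w|) ^+ n.+2).
Proof.
move=> w0; rewrite /fourier cmodM cmod_real ger0_norm ?invr_ge0 ?sqrtr_ge0//.
congr (_ * _); rewrite cintegral_spline// 2!cmodM cmodV !cmodX (cmodM 'i) cmod_i mul1r cmod_real.
have -> : cmod (1 - cis (- w / 2)) ^+ n.+2.*2 = (4 * sin (w / 4) ^+ 2) ^+ n.+2.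
  rewrite -mul2n exprM cmod_sub_cis.
  have -> : - w / 2 / 2 = - (w / 4) by field.
  by rewrite sinN sqrrN.
by rewrite expr_div_n -mulrA mulrCA [X in _ * X]mulrC.
Qed.

End spline_wavelet_fourier.

(** * The spectrum of the spline wavelets *)

Section spline_pointwise.
Context {R : realType}.
Implicit Types (x w : R).

(** Positivity and partition of unity: the only bound used at frequencies away from the peak. *)
Lemma cmod_euler_spline_le1 N (z : R[i]) : (0 < N)%N -> cmod z = 1 ->
  cmod (euler_spline N z 1) <= 1.
Proof.
move=> N0 z1; apply: (le_trans (cmod_sum _)).
apply: (@le_trans _ _ (\sum_(j < N.+1) bspline N j%:R)); last by rewrite sum_bspline.
rewrite big_ord_recl -[leLHS]add0r lerD ?bspline_ge0//; apply: ler_sum => j _.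
rewrite cmodM cmodX z1 expr1n mulr1 cmod_real ger0_norm ?bspline_ge0//.
by rewrite lift0 -natr1 addrC.
Qed.

Definition spline_base w : R := 4 * sin (w / 4) ^+ 2 / `|w|.

Lemma spline_base_ge0 w : 0 <= spline_base w.
Proof. by rewrite /spline_base divr_ge0// mulr_ge0// sqr_ge0. Qed.

Lemma spline_base_le_inv w : spline_base w <= 4 / `|w|.
Proof.
by rewrite /spline_base ler_wpM2r ?invr_ge0// ler_piMr//.
Qed.

Lemma spline_base_norm w : spline_base `|w| = spline_base w.
Proof.
rewrite /spline_base normr_id; have [w0|w0] := leP 0 w; first by rewrite ger0_norm.
by rewrite ltr0_norm// mulNr sinN sqrrN.
Qed.

(** The first bound stays below the threshold [69/100]; the second absorbs the singular factor
    [|w|^(-k)]. *)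
Lemma spline_base_le w : 0 < `|w| <= 16 / 5 ->
  spline_base w <= 68 / 100 /\ spline_base w <= `|w| / 4.
Proof.
rewrite -spline_base_norm; move: `|w| => {}w /andP[w0 w1]; rewrite /spline_base gtr0_norm//.
have [h wE] : exists h, w = 4 * h by exists (w / 4); field.
have h4 : 4 * h / 4 = h by field.
rewrite {}wE {w} h4 in w0 w1 *.
have h0 : 0 < h by lra.
have h8 : h <= 8 / 10 by lra.
have sh : sin h <= h * (1 - h ^+ 2 / 8) by apply: sin_le_cubic; lra.
have s0 : 0 <= sin h by apply: sin_ge0_pi; have := @pi_ge2 R; lra.
move: (sin h) s0 sh => s s0 sh.
have h2 : h ^+ 2 <= 64 / 100 by have := ler_pM (ltW h0) (ltW h0) h8 h8; rewrite -expr2; lra.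
have ss : s ^+ 2 <= h ^+ 2 * (1 - h ^+ 2 / 8) ^+ 2.
  rewrite -exprMn ler_sqr ?nnegrE// mulr_ge0 ?(ltW h0)//.
  by have := sqr_ge0 h; lra.
have -> : 4 * s ^+ 2 / (4 * h) = s ^+ 2 / h by field; rewrite gt_eqF.
have u1 : (1 - h ^+ 2 / 8) ^+ 2 <= 1.
  by have := sqr_ge0 h; rewrite expr2 => u0; rewrite mulr_ile1//; lra.
rewrite !ler_pdivrMr//; split; last first.
  apply: (le_trans ss); rewrite -[leRHS]mulr1 -expr2; apply: ler_wpM2l => //.
  exact: sqr_ge0.
apply: (le_trans ss); rewrite expr2 -mulrA [leRHS]mulrC ler_pM2l//.
have hh : 0 < h ^+ 2 by rewrite exprn_gt0.
have H : 0 <= (8 / 10 - h) * (8 / 10 + h) by apply: mulr_ge0; lra.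
nra.
Qed.

(** Two lower bounds on the modulus of the eigenvalue of the integration step: the second says that
    it dominates the contraction rate, and the first allows trading one of its powers for a factor
    2. *)
Lemma sinc_half_ge x : 0 < x <= 31 / 20 ->
  [/\ 1 / 2 <= 2 * sin (x / 2) / x & x / 2 <= 2 * sin (x / 2) / x].
Proof.
move=> /andP[x0 x1]; have [h xE] : exists h, x = 2 * h by exists (x / 2); field.
have h2 : 2 * h / 2 = h by field.
rewrite {}xE {x} h2 in x0 x1 *.
have h0 : 0 < h by lra.
have h1 : h <= 31 / 40 by lra.
have := sin_ge_taylor 0 (ltW h0); rewrite /=; move: (sin h) => s sh.
have -> : 2 * s / (2 * h) = s / h by field; rewrite gt_eqF.
have u : h ^+ 2 <= (31 / 40) ^+ 2 by rewrite ler_sqr ?nnegrE; lra.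
have h21 : 1 / 2 * h <= s by nra.
split; first by rewrite ler_pdivlMr.
by rewrite ler_pdivlMr//; nra.
Qed.

End spline_pointwise.

Section spline_pointwise2.
Context {R : realType}.
Implicit Types (x w : R).

(** Away from [w = 0] this is [sqrt (2 pi)] times the modulus of the Fourier transform of the
    wavelet of order [n + 2]. *)
Definition spline_profile n w : R :=
  cmod (euler_spline n.+2.*2 (- cis (- w / 2)) 1) * spline_base w ^+ n.+2.

Lemma spline_profile_ge0 n w : 0 <= spline_profile n w.
Proof. by rewrite mulr_ge0 ?cmod_ge0 ?exprn_ge0 ?spline_base_ge0. Qed.

Lemma spline_profile_le_base n w : spline_profile n w <= spline_base w ^+ n.+2.
Proof.
rewrite ler_piMl ?exprn_ge0 ?spline_base_ge0//.
by apply: cmod_euler_spline_le1 => //; rewrite cmodN cmod_cis.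
Qed.

Lemma cmod_sub_cis_norm (d : R) : `|d| < 2 * pi -> cmod (1 - cis (- d)) = 2 * sin (`|d| / 2).
Proof.
move=> dpi; have s0 : 0 <= sin (`|d| / 2).
  by apply: sin_ge0_pi; have := normr_ge0 d; lra.
apply: (@pexpIrn _ 2) => //; rewrite ?nnegrE ?cmod_ge0 ?mulr_ge0//.
rewrite cmod_sub_cis exprMn; have -> : (2 : R) ^+ 2 = 4 by ring.
congr (4 * _); have [d0|d0] := leP 0 d; first by rewrite ger0_norm// mulNr sinN sqrrN.
by rewrite ltr0_norm.
Qed.

(** Let [l] be the modulus of the eigenvalue and [m = n + 2]; the error is at most [2 (x/2)^(2m-1)].
    From [x/2 <= l] and [l >= 1/2] it is at most [4 l^(2m)], hence the factor 5. For [x <= 4/5] even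
    [x/2 <= l/2], and as [2m - 1 >= 3] the error is at most [l^(2m-1) / 4], which is at most half of
    the main term. *)
Lemma euler_spline_bounds n w x : 0 < x <= 31 / 20 -> `|w| = 2 * (pi - x) ->
  cmod (euler_spline n.+2.*2 (- cis (- w / 2)) 1) <= 5 * (2 * sin (x / 2) / x) ^+ n.+2.*2 /\
  (x <= 4 / 5 -> 2^-1 * (2 * sin (x / 2) / x) ^+ n.+2.*2 <=
     cmod (euler_spline n.+2.*2 (- cis (- w / 2)) 1)).
Proof.
move=> x01 wx; have /andP[x0 x1] := x01.
have p2 := @pi_ge2 R.
have [d dx wd] : exists2 d : R, `|d| = x & - cis (- w / 2) = cis (- d).
  have [w0|w0] := leP 0 w.
    exists (w / 2 - pi); first by rewrite ltr0_norm; move: wx; rewrite ger0_norm//; lra.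
    by rewrite opprB addrC cisD cispi mulrN1 mulNr.
  exists (w / 2 + pi); first by rewrite gtr0_norm; move: wx; rewrite ltr0_norm//; lra.
  by rewrite opprD cisD [cis (- pi)]cisN cispi invrN1 mulrN1 mulNr.
have dpi : `|d| < 2 * pi by rewrite dx; lra.
have l1 := cmod_sub_cis_norm dpi; rewrite dx in l1.
have [h1 h2] := sinc_half_ge x01; rewrite -l1 in h1 h2 *; rewrite wd.
have d0 : d != 0 by rewrite -normr_gt0 dx.
set l := cmod (1 - cis (- d)) / x in h1 h2 *.
have c1 : cis (- d) != 1.
  by apply: contraTneq h1 => c1; rewrite /l c1 subrr cmod0 mul0r -ltNge; lra.
have := euler_spline_asymp n.+1.*2 d0 c1; rewrite dx -/l.
have -> : n.+1.*2.+2 = n.+2.*2 by [].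
have -> : n.+2.*2 = (n.*2.+3).+1 by lia.
have l0 : 0 <= l by lra.
have lN : 0 <= l ^+ n.*2.+3 by rewrite exprn_ge0.
have lS : l ^+ n.*2.+3 <= 2 * l ^+ n.*2.+4.
  by rewrite [l ^+ n.*2.+4]exprS mulrA ler_peMl//; lra.
move: (cmod _) => E; rewrite ler_norml => /andP[lo up]; split.
  have : (x / 2) ^+ n.*2.+3 <= l ^+ n.*2.+3 by rewrite lerXn2r ?nnegrE//; lra.
  move: lS up; move: (l ^+ n.*2.+3) (l ^+ n.*2.+4) ((x / 2) ^+ n.*2.+3) => u v t; lra.
move=> x45; have xl : x / 2 <= 2^-1 * l.
  have h0 : 0 <= x / 2 by lra.
  have : x / 2 * (1 - (x / 2) ^+ 2 / 6) <= sin (x / 2).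
    by have := sin_ge_taylor 0 h0; rewrite /= mulr1 ; lra.
  have -> : l = sin (x / 2) / (x / 2) by rewrite /l l1; field; rewrite gt_eqF.
  move=> sx; rewrite mulrA ler_pdivlMr; last by lra.
  have : (x / 2) ^+ 2 <= (2 / 5) ^+ 2 by rewrite ler_sqr ?nnegrE; lra.
  have h25 : x / 2 <= 2 / 5 by lra.
  move: (x / 2) h0 sx h25 => h h0 sx h25 hh; rewrite [2^-1 * _]mulrC.
  have : h * (9 / 10) <= h * (1 - h ^+ 2 / 6) by apply: ler_wpM2l => //; lra.
  have : h * h <= h * (2 / 5) by apply: ler_wpM2l => //.
  by lra.
have : (x / 2) ^+ n.*2.+3 <= 8^-1 * l ^+ n.*2.+3.
  apply: (@le_trans _ _ ((2^-1 * l) ^+ n.*2.+3)).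
    by rewrite lerXn2r ?nnegrE//; lra.
  rewrite exprMn ler_wpM2r// exprVn lef_pV2 ?posrE ?exprn_gt0//.
  rewrite -[X in X <= _](_ : 2 ^+ 3 = 8); last by ring.
  by rewrite ler_weXn2l//; lra.
move: lS lo; move: (l ^+ n.*2.+3) (l ^+ n.*2.+4) ((x / 2) ^+ n.*2.+3) => u v t; lra.
Qed.

(** Since [|w|/4 = pi/2 - x/2], the sine in [spline_base] becomes [cos (x/2)], and the duplication
    formula merges it with [sin (x/2)]. *)
Lemma peak_rateE w x : 0 < x < pi -> `|w| = 2 * (pi - x) ->
  spline_base w * (2 * sin (x / 2) / x) ^+ 2 = peak_rate x.
Proof.
move=> /andP[x0 xpi] wx; rewrite -spline_base_norm /spline_base normr_id wx.
have -> : 2 * (pi - x) / 4 = pi / 2 - x / 2 by move: (@pi R) => P; field.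
rewrite sinB sin_pihalf cos_pihalf mul1r mul0r subr0 /peak_rate.
have -> : sin x = 2 * sin (x / 2) * cos (x / 2).
  have {1}-> : x = x / 2 + x / 2 by field.
  by rewrite sinD; ring.
have : pi - x != 0 by rewrite gt_eqF// subr_gt0.
have : x != 0 by rewrite gt_eqF.
move: (sin _) (cos _) (@pi R) => s c P x0' Px; field.
by rewrite x0'.
Qed.

Lemma spline_profile_bounds n w x : 0 < x <= 31 / 20 -> `|w| = 2 * (pi - x) ->
  spline_profile n w <= 5 * peak_rate x ^+ n.+2 /\
  (x <= 4 / 5 -> 2^-1 * peak_rate x ^+ n.+2 <= spline_profile n w).
Proof.
move=> x01 wx; have [h1 h2] := euler_spline_bounds n x01 wx.
have xpi : 0 < x < pi by have := @pi_ge2 R; lra.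
have b0 : 0 <= spline_base w ^+ n.+2 by rewrite exprn_ge0 ?spline_base_ge0.
have -> : peak_rate x ^+ n.+2 = spline_base w ^+ n.+2 * (2 * sin (x / 2) / x) ^+ n.+2.*2.
  by rewrite -(peak_rateE xpi wx) [LHS]exprMn -exprM mul2n.
rewrite /spline_profile; move: (cmod _) ((2 * sin (x / 2) / x) ^+ n.+2.*2) h1 h2 => E L h1 h2.
split; first by rewrite [leLHS]mulrC [leRHS]mulrCA; exact: ler_wpM2l.
by move=> /h2 {}h2; rewrite [leLHS]mulrCA [leRHS]mulrC; exact: ler_wpM2l.
Qed.

End spline_pointwise2.

(** * Weighted integrals and their relation to [Ckp] *)

Section weights.
Context {R : realType}.
Local Notation mu := (@lebesgue_measure R).
Implicit Types (p w : R) (k : nat) (Phi : R -> R).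

Lemma one_plus_sqr_gt0 w : 0 < 1 + w ^+ 2.
Proof. by rewrite ltr_pwDl// sqr_ge0. Qed.

Lemma continuous_cauchy : continuous (fun w : R => (1 + w ^+ 2)^-1).
Proof. exact: continuous_oneDsqrV. Qed.

Lemma integrable_cauchy : mu.-integrable setT (fun w => ((1 + w ^+ 2)^-1)%:E).
Proof.
apply/integrableP; split.
  by apply/measurable_EFinP; apply: continuous_measurable_fun; exact: continuous_cauchy.
under eq_integral do rewrite gee0_abs ?lee_fin ?invr_ge0 ?ltW ?one_plus_sqr_gt0//.
rewrite ge0_symfun_integralT.
- by rewrite -set_itvcy integral0y_oneDsqr -EFinM ltry.
- by move=> w; rewrite invr_ge0 ltW// one_plus_sqr_gt0.
- exact: continuous_cauchy.
- by move=> w /=; rewrite sqrrN.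
Qed.

(** The integrand of the [p]-th power of the norm of [fourier_prim k f], when [Phi] is the modulus
    of the Fourier transform of [f]. *)
Definition weight k p Phi w : R := (Phi w * `|w| ^- k) `^ p.

Lemma weight_ge0 k p Phi w : 0 <= weight k p Phi w.
Proof. exact: powR_ge0. Qed.

Lemma measurable_weight k p Phi : measurable_fun setT Phi ->
  measurable_fun setT (weight k p Phi).
Proof.
move=> mPhi; apply: (measurableT_comp (measurable_powR p)).
apply: measurable_funM => //.
have -> : (fun w => `|w| ^- k) = (fun w : R => `|w| `^ (- k%:R)).
  by apply/funext => w; rewrite powR_invn.
apply: (measurableT_comp (measurable_powR _)).
by apply: continuous_measurable_fun; exact: norm_continuous.
Qed.

Lemma cmod_fourier_prim k (f : R -> R[i]) w :
  cmod (fourier_prim k%:Z f w) = cmod (fourier f w) * `|w| ^- k.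
Proof.
rewrite /fourier_prim cmodM -exprnN cmodV cmodX cmodM cmod_i mul1r cmod_real.
by rewrite mulrC.
Qed.

Lemma cLnorm_weight k p (f : R -> R[i]) a : 0 < p ->
  (\int[mu]_w (weight k p (fun t => cmod (fourier f t)) w)%:E = a%:E)%E ->
  cLnorm p (fourier_prim k%:Z f) = (a `^ p^-1)%:E.
Proof.
move=> p0 ia; rewrite /cLnorm unlock -poweR_EFin -ia; apply: (congr1 (fun x => poweR x _)).
by apply: eq_integral => w _; rewrite /= cmod_fourier_prim ger0_norm// mulr_ge0 ?cmod_ge0.
Qed.

Lemma Ckp_weight k p (f : R -> R[i]) a b : 0 < p -> 0 < b ->
  (\int[mu]_w (weight k p (fun t => cmod (fourier f t)) w)%:E = a%:E)%E ->
  (\int[mu]_w (weight 0 p (fun t => cmod (fourier f t)) w)%:E = b%:E)%E ->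
  Ckp k%:Z p f = ((a / b) `^ p^-1)%:E.
Proof.
move=> p0 b0 ia ib; rewrite /Ckp (cLnorm_weight p0 ia).
have -> : cLnorm p (fourier f) = cLnorm p (fourier_prim 0%:Z f).
  by rewrite /cLnorm; apply: eq_Lnorm => w; have := @cmod_fourier_prim 0 f w; rewrite expr0 invr1 mulr1 => e; congr EFin; exact/esym/e.
rewrite (@cLnorm_weight 0 p f b)//.
have a0 : 0 <= a.
  by rewrite -lee_fin -ia; apply: integral_ge0 => w _; rewrite lee_fin weight_ge0.
rewrite inver gt_eqF ?powR_gt0// -EFinM powRM ?invr_ge0 ?(ltW b0)//.
by rewrite -[b^-1]powR_inv1 ?(ltW b0)// -powRrM mulN1r powRN.
Qed.

End weights.

Section spline_decay.
Context {R : realType}.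
Implicit Types (p x w th : R) (k n : nat).

Lemma cauchy_lower w (c : R) : `|w| <= c -> 1 <= (1 + c ^+ 2) / (1 + w ^+ 2).
Proof.
move=> wc; rewrite ler_pdivlMr ?one_plus_sqr_gt0// mul1r lerD2l.
by rewrite -(real_normK (num_real w)) ler_sqr ?nnegrE// (le_trans _ wc).
Qed.

(** Three ranges of [|w|]. Up to [16/5], [k] powers of the base absorb [|w|^(-k)]. From 6 on, two
    powers of [4/|w|] give the decay [w^(-2)]. In between, [x] is at most [31/20] and the rate is
    bounded by [th]; there [185 = 5 * 37] with [37 = 1 + 6^2]. The assumption on the rate concerns
    only the given [w], so that [th] may be the maximal rate, for integrability, or a smaller number
    away from the peak. *)
Lemma spline_profile_decay k th n w : (k <= n)%N -> 69 / 100 <= th -> w != 0 ->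
  (forall x, 0 < x <= 31 / 20 -> `|w| = 2 * (pi - x) -> peak_rate x <= th) ->
  spline_profile n w * `|w| ^- k <= (40 + 185 * th ^+ k.+2) * th ^+ (n - k) / (1 + w ^+ 2).
Proof.
move=> kn th69 w0 xth; have th0 : 0 < th by lra.
have n0 : 0 < `|w| by rewrite normr_gt0.
have C0 : 0 <= 185 * th ^+ k.+2 by rewrite mulr_ge0// exprn_ge0// ltW.
have D0 := one_plus_sqr_gt0 w.
have t0 : 0 <= th ^+ (n - k) by rewrite exprn_ge0// ltW.
suff [c [c0 cC H]] : exists c, [/\ 0 <= c, c <= 40 + 185 * th ^+ k.+2 &
    spline_profile n w * `|w| ^- k <= th ^+ (n - k) * (c / (1 + w ^+ 2))].
  apply: (le_trans H); rewrite [X in _ <= X / _]mulrC -mulrA ler_wpM2l// ler_wpM2r//.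
  by rewrite invr_ge0 ltW.
have nk : n.+2 = (n - k + k.+2)%N by rewrite !addnS subnK.
have base (c : R) : 0 <= spline_base w <= th ->
    spline_base w ^+ k.+2 * `|w| ^- k <= c / (1 + w ^+ 2) ->
    spline_profile n w * `|w| ^- k <= th ^+ (n - k) * (c / (1 + w ^+ 2)).
  move=> /andP[b0 bth] H; apply: (@le_trans _ _ (spline_base w ^+ n.+2 * `|w| ^- k)).
    by rewrite ler_wpM2r ?spline_profile_le_base// invr_ge0 exprn_ge0.
  rewrite nk exprD -mulrA; apply: ler_pM => //.
  - by rewrite exprn_ge0.
  - by rewrite mulr_ge0 ?exprn_ge0// invr_ge0 exprn_ge0.
  - by rewrite lerXn2r ?nnegrE// ltW.
have b0 := @spline_base_ge0 R w.
have [w16|w16] := leP `|w| (16 / 5).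
  have [b68 b4] := @spline_base_le R w ltac:(by rewrite n0 w16).
  exists 12; split => //; first by lra.
  apply: base; first by rewrite b0; lra.
  apply: (@le_trans _ _ 1); last first.
    apply: (le_trans (cauchy_lower w16)).
    by rewrite ler_wpM2r ?invr_ge0 ?(ltW D0)//; lra.
  rewrite ler_pdivrMr ?exprn_gt0// mul1r.
  rewrite exprS exprS mulrA; apply: (@le_trans _ _ (1 * spline_base w ^+ k)).
    by apply: ler_wpM2r; [rewrite exprn_ge0|rewrite mulr_ile1//; lra].
  by rewrite mul1r lerXn2r ?nnegrE//; lra.
have [w6|w6] := leP 6 `|w|.
  have binv := spline_base_le_inv w.
  have w4 : 4 / `|w| <= 2 / 3 by rewrite ler_pdivrMr//; lra.
  exists 32; split => //; first by lra.
  apply: base; first by rewrite b0; lra.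
  apply: (@le_trans _ _ ((4 / `|w|) ^+ 2)).
    rewrite ler_pdivrMr ?exprn_gt0// -addn2 addnC exprD.
    apply: ler_pM; rewrite ?exprn_ge0// ?lerXn2r ?nnegrE ?b0 ?divr_ge0//; lra.
  rewrite expr_div_n real_normK ?num_real// ler_pdivrMr; last by rewrite exprn_even_gt0.
  rewrite mulrAC ler_pdivlMr// -(real_normK (num_real w)).
  have : 6 ^+ 2 <= `|w| ^+ 2 by rewrite ler_sqr ?nnegrE//.
  by move: (`|w| ^+ 2) => u; lra.
have p3 := @pi_num R; have p4 := @pi_num_lt R.
pose x := pi - `|w| / 2; have x01 : 0 < x <= 31 / 20 by rewrite /x; lra.
have wx : `|w| = 2 * (pi - x) by rewrite /x; move: (@pi R) => P; field.
have [up _] := spline_profile_bounds n x01 wx.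
exists (185 * th ^+ k.+2); split => //; first by lra.
have r0 : 0 <= peak_rate x by rewrite ltW// peak_rate_gt0//; lra.
apply: (@le_trans _ _ (5 * th ^+ n.+2)).
  rewrite -[leRHS]mulr1; apply: ler_pM.
  - exact: spline_profile_ge0.
  - by rewrite invr_ge0 exprn_ge0.
  - apply: (le_trans up); rewrite ler_pM2l// lerXn2r ?nnegrE//; last exact: xth.
    by rewrite ltW.
  - by rewrite invf_le1 ?exprn_gt0// exprn_ege1//; lra.
rewrite nk exprD [leLHS]mulrCA ler_wpM2l//.
have := cauchy_lower (ltW w6).
have -> : 1 + (6 : R) ^+ 2 = 37 by ring.
have t2 : 0 <= th ^+ k.+2 by rewrite exprn_ge0// ltW.
move: (th ^+ k.+2) t2 => t t2 H.
have -> : 185 * t / (1 + w ^+ 2) = 5 * t * (37 / (1 + w ^+ 2)) by ring.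
by rewrite ler_peMr// mulr_ge0.
Qed.

End spline_decay.

Section concentration.
Context {R : realType}.
Local Notation mu := (@lebesgue_measure R).
Implicit Types (p x w th : R) (k n : nat).

(** As [r < q], the remainder of rate [r] is negligible against the mass [b n]. The rates and the
    constants may depend on [eta]. *)
Lemma cvg_ratio_of_concentration (a b : nat -> R) (L : R) k :
  (forall eta : R, 0 < eta -> exists r q C c : R, [/\ 0 <= r, r < q, 0 < c, 0 <= C &
     forall n, (k <= n)%N -> `|a n - L * b n| <= eta * b n + C * r ^+ (n - k) /\
                             c * q ^+ (n - k) <= b n]) ->
  (fun n => a n / b n) @ \oo --> L.
Proof.
move=> H; apply/cvgrPdist_le => e e0.
have [r [q [C [c [r0 rq c0 C0 {}H]]]]] := H (e / 2) (divr_gt0 e0 (ltr0Sn _ 1)).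
have q0 : 0 < q by exact: le_lt_trans rq.
have rq1 : `|r / q| < 1 by rewrite ger0_norm ?divr_ge0 ?(ltW q0)// ltr_pdivrMr// mul1r.
have e2 : 0 < e / 2 / (C / c + 1) by rewrite !divr_gt0// ltr_wpDl// divr_ge0 ?(ltW c0).
have := cvg_expr rq1 => /cvgrPdist_le /(_ _ e2) [N _ NH].
near=> n.
have kn : (k <= n)%N by near: n; exists k.
have Nn : (N <= n - k)%N by rewrite leq_subRL//; near: n; exists (k + N)%N.
have [h1 h2] := H n kn.
have qn : 0 < q ^+ (n - k) by rewrite exprn_gt0.
have b0 : 0 < b n by apply: lt_le_trans h2; rewrite mulr_gt0.
have := NH _ Nn; rewrite /= sub0r normrN normrX ger0_norm ?divr_ge0 ?(ltW q0)//.
rewrite expr_div_n => h3.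
rewrite distrC; have -> : a n / b n - L = (a n - L * b n) / b n.
  by field; rewrite gt_eqF.
rewrite normrM normfV (gtr0_norm b0) ler_pdivrMr//; apply: (le_trans h1).
have {}h3 : r ^+ (n - k) <= e / 2 / (C / c + 1) * q ^+ (n - k) by rewrite -ler_pdivrMr.
have Cc0 : 0 <= C / c by rewrite divr_ge0 ?(ltW c0).
suff : C * r ^+ (n - k) <= e / 2 * b n by lra.
apply: (@le_trans _ _ (e / 2 * (c * q ^+ (n - k)))); last by rewrite ler_pM2l//; lra.
apply: (le_trans (ler_wpM2l C0 h3)).
have hC : C / (C / c + 1) <= c.
  rewrite ler_pdivrMr; last by lra.
  by rewrite mulrDr mulr1 mulrCA divff ?gt_eqF// mulr1; lra.
move: (C / c + 1) hC => X hC.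
have -> : C * (e / 2 / X * q ^+ (n - k)) = e / 2 * (C / X * q ^+ (n - k)) by ring.
by rewrite ler_pM2l ?ler_pM2r//; lra.
Unshelve. all: by end_near. Qed.

Lemma spline_profile0 n : spline_profile n 0 = 0 :> R.
Proof. by rewrite /spline_profile /spline_base mul0r sin0 expr0n mulr0 mul0r expr0n mulr0. Qed.

(** The number [1 / (1 + w^2)] is at most 1, so raising it to the power [p > 1] does not increase
    it. *)
Lemma weight_le_cauchy k p M (Phi : R -> R) w : 1 < p -> 0 <= Phi w -> 0 <= M ->
  Phi w * `|w| ^- k <= M / (1 + w ^+ 2) -> weight k p Phi w <= M `^ p / (1 + w ^+ 2).
Proof.
move=> p1 Phi0 M0 H; rewrite /weight.
have D0 := one_plus_sqr_gt0 w.
apply: (@le_trans _ _ ((M / (1 + w ^+ 2)) `^ p)).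
  apply: ge0_ler_powR; rewrite ?nnegrE//; first by lra.
    by rewrite mulr_ge0// invr_ge0 exprn_ge0.
  by rewrite divr_ge0// ltW.
rewrite powRM ?invr_ge0 ?(ltW D0)// ler_wpM2l ?powR_ge0//.
apply: ge1r_powR; last by lra.
by rewrite invr_gt0 D0 invf_le1// lerDl sqr_ge0.
Qed.

Lemma measurable_cmod (f : R -> R[i]) : continuous (fun w => complex.Re (f w)) ->
  continuous (fun w => complex.Im (f w)) -> measurable_fun setT (fun w => cmod (f w)).
Proof.
move=> cR cI; apply: continuous_measurable_fun => w.
rewrite (_ : (fun w => _) = Num.sqrt \o
    (fun w => complex.Re (f w) * complex.Re (f w) + complex.Im (f w) * complex.Im (f w))).
  apply: continuous_comp; last exact: sqrt_continuous.
  by apply: cvgD; apply: cvgM; [exact: cR|exact: cR|exact: cI|exact: cI].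
by apply/funext => v /=; rewrite cmodE !expr2.
Qed.

Lemma is_cderive_continuous (f df : R -> R[i]) : (forall x, is_cderive f x (df x)) ->
  continuous (fun w => complex.Re (f w)) /\ continuous (fun w => complex.Im (f w)).
Proof.
move=> H; split=> x; apply: differentiable_continuous; apply/derivable1_diffP.
- by have [[]] := H x.
- by have [_ []] := H x.
Qed.

Lemma measurable_spline_profile n : measurable_fun setT (spline_profile n : R -> R).
Proof.
apply: measurable_funM.
  pose f w : R[i] := \sum_(j < n.+2.*2) ((bspline n.+2.*2 (1 + j%:R))%:C * (-1) ^+ j) * cis (- (j%:R / 2) * w).
  rewrite (_ : (fun w => _) = (fun w => cmod (f w))).
    have /is_cderive_continuous [cR cI] : forall x, is_cderive f x
      (\sum_(j < n.+2.*2) ((bspline n.+2.*2 (1 + j%:R))%:C * (-1) ^+ j) *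
         ('i * (- (j%:R / 2))%:C * cis (- (j%:R / 2) * x))).
      move=> x; apply: is_cderive_sum => j; apply: is_cderiveZ; exact: is_cderive_cis.
    exact: measurable_cmod.
  apply/funext => w; congr cmod; apply: eq_bigr => j _.
  by rewrite [(- cis _) ^+ _]exprNn -cisMn mulrA; congr (_ * cis _); field.
apply: measurable_funX; apply: measurable_funM.
  apply: continuous_measurable_fun => w; apply: cvgM; first exact: cvg_cst.
  apply: (@continuous_comp _ _ _ (fun w : R => sin (w / 4)) (fun y => y ^+ 2)); last exact: exprn_continuous.
  apply: (@continuous_comp _ _ _ (fun w : R => w / 4) sin); last exact: continuous_sin.
  by apply: cvgM; [exact: cvg_id|exact: cvg_cst].
have -> : (fun w : R => `|w|^-1) = (fun w : R => `|w| `^ (- 1)).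
  by apply/funext => w; rewrite powR_inv1.
apply: (measurableT_comp (measurable_powR _)).
by apply: continuous_measurable_fun; exact: norm_continuous.
Qed.

End concentration.

Section real_integrals.
Context {R : realType}.
Local Notation mu := (@lebesgue_measure R).

Lemma integrable_scaled_cauchy (c : R) : mu.-integrable setT (fun w => (c / (1 + w ^+ 2))%:E).
Proof. by under eq_fun do rewrite EFinM; apply: integrableZl => //; exact: integrable_cauchy. Qed.

Lemma integrable_le_cauchy (f : R -> R) c : measurable_fun setT f -> (forall w, 0 <= f w) ->
  (forall w, f w <= c / (1 + w ^+ 2)) -> mu.-integrable setT (fun w => (f w)%:E).
Proof.
move=> mf f0 fc; apply: (le_integrable measurableT _ _ (integrable_scaled_cauchy c)).
  exact/measurable_EFinP.
by move=> w _; rewrite lee_fin !ger0_norm// (le_trans (f0 w)).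
Qed.

Lemma Rintegral_dist_le (f g : R -> R) (s eta c : R) :
  mu.-integrable setT (EFin \o f) -> mu.-integrable setT (EFin \o g) ->
  (forall w, `|g w - s * f w| <= eta * f w + c / (1 + w ^+ 2)) ->
  `|\int[mu]_w g w - s * \int[mu]_w f w| <=
    eta * \int[mu]_w f w + c * \int[mu]_w (1 + w ^+ 2)^-1.
Proof.
move=> jf ig gf.
have jpf a : mu.-integrable setT (EFin \o (fun w => a * f w)).
  by rewrite /comp; under eq_fun do rewrite EFinM; exact: integrableZl.
have ic : mu.-integrable setT (EFin \o (fun w => c / (1 + w ^+ 2))) by exact: integrable_scaled_cauchy.
rewrite -!RintegralZl//; last exact: integrable_cauchy.
rewrite -RintegralB// -RintegralD//.
have igf : mu.-integrable setT (EFin \o (fun w => g w - s * f w)).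
  by rewrite /comp; under eq_fun do rewrite EFinB; apply: integrableB => //; exact: jpf.
apply: (le_trans (le_normr_Rintegral measurableT igf)); apply: le_Rintegral => //.
- exact: integrable_norm.
- by rewrite /comp; under eq_fun do rewrite EFinD; apply: integrableD => //; exact: jpf.
Qed.

Lemma Rintegral_ge_itv (f : R -> R) u v c : mu.-integrable setT (EFin \o f) ->
  (forall w, 0 <= f w) -> u <= v -> (forall w, u <= w <= v -> c <= f w) ->
  c * (v - u) <= \int[mu]_w f w.
Proof.
move=> jf f0 uv cf.
have mI : measurable `[u, v] by exact: measurable_itv.
have jI : mu.-integrable `[u, v] (EFin \o f) by exact: integrableS jf.
apply: (@le_trans _ _ (\int[mu]_(w in `[u, v]) f w)).
  have -> : c * (v - u) = \int[mu]_(w in `[u, v]) c.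
    rewrite Rintegral_cst // (_ : fine _ = v - u)//.
    transitivity (fine (lebesgue_measure `[u, v])) => //; rewrite lebesgue_measure_itv /= lte_fin.
    by have [_|vu] := ltP u v => //=; rewrite (le_anti (introT andP (conj uv vu))) subrr.
  apply: le_Rintegral => //.
    by apply: continuous_compact_integrable; [exact: segment_compact|exact/continuous_subspaceT/cst_continuous].
rewrite /Rintegral fine_le//; try exact: integrable_fin_num.
apply: ge0_subset_integral => //; first by case/integrableP: jf.
by move=> w _; rewrite lee_fin.
Qed.

End real_integrals.

(** * Concentration of the spline wavelets at the peak frequency *)

Section spline_limit.
Context {R : realType}.

Local Notation mu := (@lebesgue_measure R).
Implicit Types (p x w th : R) (k n : nat).
Context (x0 : R) (x0_num : 57 / 100 < x0 < 58 / 100) (x0_peak : peak_eqn x0 = 0).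

Let x0pi : 0 < x0 < pi.
Proof. by have := @pi_ge2 R; have := x0_num; lra. Qed.

(** The rate increases up to [x0] and decreases afterwards, so away from [x0] it is bounded by its
    values at [x0 - e'] and [x0 + e']. The number [69/100] is included in [th] to meet the
    requirement of [spline_profile_decay]. The number [th'] lies midway between [th] and the
    maximum, and continuity provides [d]. *)
Lemma peak_separation (e : R) : 0 < e -> exists th th' d : R,
  [/\ 69 / 100 <= th, th < th', 0 < d <= 1 / 10,
      forall x, 0 < x <= 31 / 20 -> e <= `|x - x0| -> peak_rate x <= th &
      forall x, x0 <= x <= x0 + d -> th' <= peak_rate x].
Proof.
move=> e0; pose e' := Num.min e (1 / 10).
have e'0 : 0 < e' by rewrite lt_min e0 /=; lra.
have e'e : e' <= e by rewrite ge_min lexx.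
have e'1 : e' <= 1 / 10 by rewrite ge_min lexx orbT.
pose th := Num.max (69 / 100) (Num.max (peak_rate (x0 - e')) (peak_rate (x0 + e'))).
have p2 := @pi_ge2 R; have x0n := x0_num.
have th_lt : th < peak_rate x0.
  rewrite !gt_max (peak_rate_num x0pi x0_peak) /=.
  by rewrite (peak_rate_incr x0pi x0_peak) ?(peak_rate_decr x0pi x0_peak)//; lra.
pose th' := (th + peak_rate x0) / 2.
have th'_lt : th' < peak_rate x0 by rewrite /th'; lra.
have : peak_rate x @[x --> x0] --> peak_rate x0.
  apply: differentiable_continuous; apply/derivable1_diffP.
  by have [] := is_derive_peak_rate x0pi.
move=> /cvgrPdist_lt /(_ (peak_rate x0 - th')); rewrite subr_gt0 => /(_ th'_lt).
move=> [d0 /= d00 H].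
exists th, th', (Num.min (d0 / 2) (1 / 10)); split.
- by rewrite /th le_max lexx.
- by rewrite /th'; lra.
- by rewrite lt_min ge_min lexx orbT !andbT; apply/andP; split; lra.
- move=> x x01 ex; rewrite /th !le_max.
  have [xx0|xx0] := leP x x0.
    have xe : x <= x0 - e' by move: ex; rewrite ler0_norm; lra.
    move: xe; rewrite le_eqVlt => /predU1P[->|xe]; first by rewrite lexx orbT.
    have := @peak_rate_incr _ _ x0pi x0_peak x (x0 - e') ltac:(lra) xe ltac:(lra).
    by move=> /ltW ->; rewrite orbT.
  have xe : x0 + e' <= x by move: ex; rewrite gtr0_norm; lra.
  move: xe; rewrite le_eqVlt => /predU1P[<-|xe]; first by rewrite lexx !orbT.
  have := @peak_rate_decr _ _ x0pi x0_peak (x0 + e') x ltac:(lra) xe ltac:(lra).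
  by move=> /ltW ->; rewrite !orbT.
move=> x /andP[x0x xd].
have xd2 : x <= x0 + d0 / 2 by apply: (le_trans xd); rewrite lerD2l ge_min lexx.
have := H x; rewrite /ball_ /= => /(_ _).
rewrite ler0_norm; last by lra.
move=> /(_ ltac:(lra)); rewrite ltr_norml; lra.
Qed.

End spline_limit.

Section spline_limit.
Context {R : realType}.
Local Notation mu := (@lebesgue_measure R).
Implicit Types (p x w th : R) (k n : nat).
Context (x0 : R) (x0_num : 57 / 100 < x0 < 58 / 100) (x0_peak : peak_eqn x0 = 0).

Let x0pi : 0 < x0 < pi.
Proof. by have := @pi_ge2 R; have := x0_num; lra. Qed.

Lemma spline_weight_decay p j th n w : 1 < p -> (j <= n)%N -> 69 / 100 <= th ->
  (forall x, 0 < x <= 31 / 20 -> `|w| = 2 * (pi - x) -> peak_rate x <= th) ->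
  weight j p (spline_profile n) w <=
    (40 + 185 * th ^+ j.+2) `^ p * (th ^+ (n - j)) `^ p / (1 + w ^+ 2).
Proof.
move=> p1 jn th69 wth; have th0 : 0 <= th by lra.
have M0 : 0 <= 40 + 185 * th ^+ j.+2.
  exact: (addr_ge0 (ler0n _ _) (mulr_ge0 (ler0n _ _) (exprn_ge0 _ th0))).
have t0 : 0 <= th ^+ (n - j) by rewrite exprn_ge0.
have [->|wn0] := eqVneq w 0.
  have p0 : p != 0 by rewrite gt_eqF//; lra.
  by rewrite /weight spline_profile0 mul0r powR0// divr_ge0 ?mulr_ge0 ?powR_ge0// ltW// one_plus_sqr_gt0.
rewrite -powRM//; apply: weight_le_cauchy => //; first exact: spline_profile_ge0.
  exact: mulr_ge0.
exact: spline_profile_decay.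
Qed.

Lemma integrable_spline_weight p j n : 1 < p -> (j <= n)%N ->
  mu.-integrable setT (fun w => (weight j p (spline_profile n) w)%:E).
Proof.
move=> p1 jn; apply: integrable_le_cauchy; last first.
- move=> w; apply: (@spline_weight_decay p j (peak_rate x0)) => //.
    by rewrite ltW// (peak_rate_num x0pi x0_peak).
  by move=> x x01 _; apply: (peak_rate_le x0pi x0_peak); have := @pi_ge2 R; lra.
- by move=> w; exact: weight_ge0.
- by apply: measurable_weight; exact: measurable_spline_profile.
Qed.

Lemma weight_scale p k (Phi : R -> R) w : 0 <= Phi w ->
  weight k p Phi w = (`|w| ^- k) `^ p * weight 0 p Phi w.
Proof.
move=> Phi0; rewrite /weight expr0 invr1 mulr1 powRM ?invr_ge0 ?exprn_ge0//.
by rewrite mulrC.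
Qed.

Lemma cvg_frequency_factor p k (w0 : R) : 0 < w0 ->
  (`|w| ^- k) `^ p @[w --> w0] --> (w0 ^- k) `^ p.
Proof.
move=> w00.
have pw : {for w0 ^- k, continuous (fun y : R => y `^ p)}.
  apply: differentiable_continuous; apply/derivable1_diffP.
  by apply: derivable_powR; rewrite in_itv /= andbT invr_gt0 exprn_gt0.
rewrite -[in X in _ --> X](gtr0_norm w00).
apply: (@continuous_comp _ _ _ (fun w : R => `|w| ^- k) (fun y => y `^ p)); last first.
  by rewrite gtr0_norm.
apply: cvgV; first by rewrite gt_eqF ?exprn_gt0 ?normr_gt0 ?gt_eqF.
apply: (@continuous_comp _ _ _ (fun w : R => `|w|) (fun y => y ^+ k)); last exact: exprn_continuous.
exact: norm_continuous.
Qed.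

Lemma powRXC (y p : R) n : 0 <= y -> (y ^+ n) `^ p = (y `^ p) ^+ n.
Proof. by move=> y0; rewrite -(powR_mulrn n y0) powRAC (powR_mulrn n (powR_ge0 y p)). Qed.

(** Near the peak frequency the factor [|w|^(-kp)] is within [eta] of its value at [w0]. Elsewhere
    both weights have the smaller rate [th] and go into the remainder. *)
Lemma spline_weight_dist p k eta th e (w0 : R) n w : 1 < p -> (k <= n)%N -> 0 < eta ->
  69 / 100 <= th ->
  (forall v, `|w0 - v| < e -> `|(w0 ^- k) `^ p - (`|v| ^- k) `^ p| <= eta) ->
  (forall x, 0 < x <= 31 / 20 -> e <= `|w0 - 2 * (pi - x)| -> peak_rate x <= th) ->
  `|weight k p (spline_profile n) w - (w0 ^- k) `^ p * weight 0 p (spline_profile n) w| <=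
    eta * weight 0 p (spline_profile n) w +
    ((40 + 185 * th ^+ k.+2) `^ p +
      (w0 ^- k) `^ p * ((40 + 185 * th ^+ 2) `^ p * (th `^ p) ^+ k)) *
    (th `^ p) ^+ (n - k) / (1 + w ^+ 2).
Proof.
move=> p1 kn eta0 th69 near far; have th0 : 0 <= th by lra.
have D0 := one_plus_sqr_gt0 w.
set f := weight 0 p (spline_profile n) w.
have f0 : 0 <= f by exact: weight_ge0.
set t := (th `^ p) ^+ (n - k).
have t0 : 0 <= t by rewrite exprn_ge0// powR_ge0.
have phi0 (v : R) : 0 <= (v ^- k) `^ p by exact: powR_ge0.
have tk0 : 0 <= (th `^ p) ^+ k by rewrite exprn_ge0// powR_ge0.
have [near_w|far_w] := ltP `|w0 - `|w| | e.
  have := near _ near_w; rewrite normr_id distrC => pw.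
  rewrite weight_scale ?spline_profile_ge0// -/f -mulrBl normrM (ger0_norm f0).
  apply: (@le_trans _ _ (eta * f)); first by rewrite ler_wpM2r.
  rewrite lerDl; apply: divr_ge0; last exact: ltW.
  apply: (mulr_ge0 _ t0); apply: (addr_ge0 (powR_ge0 _ _)).
  exact: (mulr_ge0 (phi0 _) (mulr_ge0 (powR_ge0 _ _) tk0)).
have wfar x : 0 < x <= 31 / 20 -> `|w| = 2 * (pi - x) -> peak_rate x <= th.
  by move=> x01 wx; apply: far => //; rewrite -wx.
apply: (@le_trans _ _ (weight k p (spline_profile n) w + (w0 ^- k) `^ p * f)).
  apply: (le_trans (ler_normB _ _)).
  by rewrite !ger0_norm ?weight_ge0 ?mulr_ge0.
have h1 := spline_weight_decay p1 kn th69 wfar.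
have h2 := spline_weight_decay p1 (leq0n n) th69 wfar.
rewrite powRXC// -/t in h1.
rewrite powRXC// subn0 -{2}(subnKC kn) exprD -/t -/f in h2.
apply: (le_trans (lerD h1 (ler_wpM2l (phi0 w0) h2))).
have e0 : 0 <= eta * f by rewrite mulr_ge0// ltW.
rewrite -[leLHS]add0r; apply: lerD => //.
by rewrite le_eqVlt; apply/orP; left; apply/eqP; ring.
Qed.

(** Only the positive frequencies corresponding to [[x0, x0 + d]] are kept, an interval of length
    [2 d]; there [x <= 4/5] and the lower bound of [spline_profile_bounds] applies. *)
Lemma spline_weight_mass p k th d n : 1 < p -> (k <= n)%N -> 0 < th -> 0 < d <= 1 / 10 ->
  (forall x, x0 <= x <= x0 + d -> th <= peak_rate x) ->
  d * 2 * (2^-1 * th ^+ k.+2) `^ p * (th `^ p) ^+ (n - k) <=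
  \int[mu]_w weight 0 p (spline_profile n) w.
Proof.
move=> p1 kn th0 d01 near.
have geom w : 2 * (pi - (x0 + d)) <= w <= 2 * (pi - x0) ->
    [/\ 0 < w, x0 <= pi - w / 2 <= x0 + d, 0 < pi - w / 2 <= 31 / 20 & pi - w / 2 <= 4 / 5].
  by move: x0_num d01 (@pi_ge2 R) => + + + /andP[]; clear; move: (@pi R) => P *; split; lra.
have th0' := ltW th0.
have e0 : (2^-1 * th ^+ n.+2) `^ p = (2^-1 * th ^+ k.+2) `^ p * (th `^ p) ^+ (n - k).
  have c0 : 0 <= 2^-1 * th ^+ k.+2 by rewrite mulr_ge0 ?invr_ge0 ?exprn_ge0.
  rewrite -powRXC// -(powRM p c0 (exprn_ge0 _ th0')); congr (powR _ _).
  by rewrite -mulrA -exprD !addSn subnKC.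
rewrite -mulrA -e0 mulrC.
have -> : d * 2 = 2 * (pi - x0) - 2 * (pi - (x0 + d)) by move: (@pi R) => P; ring.
apply: Rintegral_ge_itv; [exact: integrable_spline_weight|by move=> w; exact: weight_ge0| |].
  by case/andP: d01 => d0 _; rewrite ler_wpM2l// lerD2l lerN2 lerDl ltW.
move=> w /geom [w0 xd x01 x45].
have wx : `|w| = 2 * (pi - (pi - w / 2)) by rewrite gtr0_norm//; move: (@pi R) => P; field.
move: xd x01 x45 wx; set x := pi - w / 2 => xd x01 x45 wx.
rewrite /weight expr0 invr1 mulr1; apply: ge0_ler_powR; first exact: (le_trans ler01 (ltW p1)).
- by rewrite nnegrE mulr_ge0 ?invr_ge0 ?exprn_ge0.
- by rewrite nnegrE spline_profile_ge0.
have [_ /(_ x45)] := spline_profile_bounds n x01 wx.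
apply: le_trans; rewrite ler_wpM2l ?invr_ge0//; apply: lerXn2r; rewrite ?nnegrE//.
  by rewrite (le_trans th0' (near _ xd)).
exact: near.
Qed.

(* The mass of the weights concentrates at the frequencies [+- 2 (pi - x0)],
   where the exponential rate is maximal. *)
Lemma spline_weight_limit p k : 1 < p -> exists a b : nat -> R,
  (forall n, (k <= n)%N ->
    [/\ (\int[mu]_w (weight k p (spline_profile n) w)%:E = (a n)%:E)%E,
        (\int[mu]_w (weight 0 p (spline_profile n) w)%:E = (b n)%:E)%E & 0 < b n]) /\
  (fun n => a n / b n) @ \oo --> ((2 * (pi - x0)) ^- k) `^ p.
Proof.
move=> p1; pose w0 := 2 * (pi - x0).
have w00 : 0 < w0 by rewrite mulr_gt0// subr_gt0; case/andP: x0pi.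
pose K := \int[mu]_w (1 + w ^+ 2)^-1.
have K0 : 0 <= K by apply: Rintegral_ge0 => w _; rewrite invr_ge0 ltW// one_plus_sqr_gt0.
pose a n := \int[mu]_w weight k p (spline_profile n) w.
pose b n := \int[mu]_w weight 0 p (spline_profile n) w.
have ia n : (k <= n)%N -> (\int[mu]_w (weight k p (spline_profile n) w)%:E = (a n)%:E)%E.
  by move=> kn; rewrite /a /Rintegral fineK// integrable_fin_num//; exact: integrable_spline_weight.
have ib n : (\int[mu]_w (weight 0 p (spline_profile n) w)%:E = (b n)%:E)%E.
  by rewrite /b /Rintegral fineK// integrable_fin_num//; exact: integrable_spline_weight.
have est (eta : R) : 0 < eta -> exists r q C c : R, [/\ 0 <= r, r < q, 0 < c, 0 <= C &
    forall n, (k <= n)%N -> `|a n - (w0 ^- k) `^ p * b n| <= eta * b n + C * r ^+ (n - k) /\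
                            c * q ^+ (n - k) <= b n].
  move=> eta0; have /cvgrPdist_le /(_ _ eta0) [e /= e0 phie] := @cvg_frequency_factor p k w0 w00.
  have [th [th' [d [th69 thth' d01 far near]]]] := @peak_separation _ _ x0_num x0_peak (e / 2) ltac:(by rewrite divr_gt0).
  have th0 : 0 <= th by apply: le_trans th69; rewrite divr_ge0.
  have th'0 : 0 < th' by exact: le_lt_trans th0 thth'.
  have d0 : 0 < d by case/andP: d01.
  exists (th `^ p), (th' `^ p),
    (((40 + 185 * th ^+ k.+2) `^ p +
      (w0 ^- k) `^ p * ((40 + 185 * th ^+ 2) `^ p * (th `^ p) ^+ k)) * K),
    (d * 2 * (2^-1 * th' ^+ k.+2) `^ p); split.
  - exact: powR_ge0.
  - by apply: gt0_ltr_powR => //; rewrite ?nnegrE ?(ltW th'0)//; exact: lt_trans p1.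
  - by rewrite mulr_gt0 ?(mulr_gt0 d0)// powR_gt0// mulr_gt0 ?invr_gt0 ?exprn_gt0.
  - apply: (mulr_ge0 _ K0); apply: (addr_ge0 (powR_ge0 _ _)).
    apply: (mulr_ge0 (powR_ge0 _ _)); apply: (mulr_ge0 (powR_ge0 _ _)).
    exact: (exprn_ge0 _ (powR_ge0 _ _)).
  move=> n kn; split; last exact: spline_weight_mass.
  rewrite mulrAC; apply: Rintegral_dist_le; try exact: integrable_spline_weight.
  move=> w; apply: (@spline_weight_dist p k eta th e) => //.
  move=> x x01 ex; apply: far => //; move: ex; rewrite /w0.
  have -> : 2 * (pi - x0) - 2 * (pi - x) = 2 * (x - x0) by move: (@pi R) => P; ring.
  by rewrite normrM (ger0_norm (ler0n R 2)) ler_pdivrMr// mulrC.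
exists a, b; split; last exact: cvg_ratio_of_concentration est.
move=> n kn; split; [exact: ia|exact: ib|].
have [r [q [C [c [r0 rq c0 C0 /(_ n kn) [_]]]]]] := est 1 ltr01.
by apply: lt_le_trans; rewrite mulr_gt0// exprn_gt0// (le_lt_trans r0).
Qed.

End spline_limit.

Section spline_norms.
Context {R : realType}.
Local Notation mu := (@lebesgue_measure R).
Implicit Types (p w c : R) (k n : nat).

(** Proportionality is required off 0 only, as the closed form of the spline transform divides by
    [w]; a point has measure 0. *)
Lemma integral_weight_scaled k p c (Phi Psi : R -> R) a : 0 <= c ->
  (forall w, 0 <= Phi w) -> measurable_fun setT Phi -> (forall w, w != 0 -> Psi w = c * Phi w) ->
  (\int[mu]_w (weight k p Phi w)%:E = a%:E)%E ->
  (\int[mu]_w (weight k p Psi w)%:E = (c `^ p * a)%:E)%E.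
Proof.
move=> c0 Phi0 mPhi PsiE ia.
have mD : measurable ([set: R] `\ (0 : R)) by apply: measurableD => //; exact: measurable_set1.
have mW : measurable_fun [set: R] (EFin \o weight k p Phi).
  by apply/measurable_EFinP; exact: measurable_weight.
have eqW : {in [set: R] `\ (0 : R), (fun w => ((c `^ p) * weight k p Phi w)%:E) =1
    (fun w => (weight k p Psi w)%:E)}.
  move=> w; rewrite inE => -[_ /= /eqP w0].
  by rewrite /weight PsiE// -[in RHS]mulrA [in RHS]powRM// mulr_ge0// ?invr_ge0 ?exprn_ge0.
have mcW : measurable_fun [set: R] (fun w => ((c `^ p) * weight k p Phi w)%:E).
  by apply/measurable_EFinP; apply: measurable_funM => //; exact: measurable_weight.
transitivity (\int[mu]_w ((c `^ p) * weight k p Phi w)%:E)%E.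
  rewrite -(@integral_setD1 _ _ 0)//; last first.
    by apply: eq_measurable_fun eqW _; apply: measurable_funS mcW.
  rewrite -[RHS](@integral_setD1 _ _ 0)//; last by apply: measurable_funS mcW.
  by apply: eq_integral => w wD; rewrite eqW.
under eq_integral do rewrite EFinM.
rewrite ge0_integralZl_EFin ?powR_ge0//; last by move=> w _; rewrite lee_fin weight_ge0.
by rewrite ia EFinM.
Qed.

Lemma cvg_powR (r : nat -> R) (l p : R) : 0 < l -> r @ \oo --> l -> (fun n => r n `^ p) @ \oo --> l `^ p.
Proof.
move=> l0; apply: (@continuous_cvg _ _ _ _ _ r (fun y : R => y `^ p)).
apply: differentiable_continuous; apply/derivable1_diffP.
by apply: derivable_powR; rewrite in_itv /= andbT.
Qed.

Lemma powR_inv (x p : R) : 0 <= x -> p != 0 -> (x `^ p) `^ p^-1 = x.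
Proof. by move=> x0 p0; rewrite -powRrM mulfV// powRr1. Qed.

Lemma Ckp_spline (x0 p : R) k : 57 / 100 < x0 < 58 / 100 -> peak_eqn x0 = 0 -> 1 < p ->
  exists s : nat -> R,
    (forall m, (k.+2 <= m)%N -> Ckp k%:Z p (@spline_waveletC R m) = (s m)%:E) /\
    s @ \oo --> (2 * (pi - x0)) ^- k.
Proof.
move=> x0n x0p p1; have p0 : 0 < p by exact: lt_trans p1.
have w00 : 0 < 2 * (pi - x0) by have := @pi_ge2 R; lra.
have [a [b [ab lim]]] := spline_weight_limit x0n x0p k p1.
exists (fun m => (a (m - 2)%N / b (m - 2)%N) `^ p^-1); split.
  move=> m km; have [ia ib b0] : _ := ab (m - 2)%N ltac:(lia).
  have mE : m = (m - 2).+2 by lia.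
  rewrite [in LHS]mE; set n := (m - 2)%N in ia ib b0 *.
  set c : R := (Num.sqrt (2 * pi))^-1.
  have c0 : 0 < c by rewrite invr_gt0 sqrtr_gt0 mulr_gt0// pi_gt0.
  have sc j d : (\int[mu]_w (weight j p (spline_profile n) w)%:E = d%:E)%E ->
      (\int[mu]_w (weight j p (fun t => cmod (fourier (@spline_waveletC R n.+2) t)) w)%:E = (c `^ p * d)%:E)%E.
    apply: integral_weight_scaled; [exact: ltW|exact: spline_profile_ge0|exact: measurable_spline_profile|].
    by move=> w w0; rewrite cmod_fourier_spline.
  have cp0 : 0 < c `^ p by exact: powR_gt0.
  rewrite (Ckp_weight p0 _ (sc _ _ ia) (sc _ _ ib)) ?mulr_gt0//.
  by rewrite -mulf_div divff ?mul1r// gt_eqF.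
rewrite -[X in _ --> X](@powR_inv _ p) ?gt_eqF// ?invr_ge0 ?exprn_ge0// ?ltW//.
apply: cvg_powR; first by rewrite powR_gt0 ?invr_gt0 ?exprn_gt0.
rewrite -(cvg_shiftn 2); under eq_fun do rewrite addnK.
exact: lim.
Qed.

End spline_norms.

(** * Daubechies masks *)

Section mask_modulus.
Context {R : realType}.
Implicit Types (n : nat) (u t w : R).

(** The integral of [(1 - v^2)^n] over [v] from 0 to [u], expanded. The substitution [v = cos t]
    makes it an antiderivative of [sin(t)^(2n+1)] up to sign, so the mask of order [n + 1] has a
    squared modulus polynomial in [cos t]. *)
Definition wallis_poly n u : R :=
  \sum_(j < n.+1) (-1) ^+ j * 'C(n, j)%:R / j.*2.+1%:R * u ^+ j.*2.+1.

Lemma is_derive_wallis_poly n u : is_derive u 1 (wallis_poly n) ((1 - u ^+ 2) ^+ n).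
Proof.
have -> : wallis_poly n = \sum_(j < n.+1) fun y : R =>
    (-1) ^+ j * 'C(n, j)%:R / j.*2.+1%:R * y ^+ j.*2.+1.
  by apply/funext => y; rewrite fct_sumE.
have -> : (1 - u ^+ 2) ^+ n =
    \sum_(j < n.+1) ((-1) ^+ j * 'C(n, j)%:R / j.*2.+1%:R) *: (j.*2.+1%:R * u ^+ j.*2).
  rewrite exprDn; apply: eq_bigr => j _; rewrite expr1n mul1r (exprNn (u ^+ 2)) -exprM -mulr_natr.
  have J : j.*2.+1%:R != 0 :> R by rewrite pnatr_eq0.
  by rewrite /GRing.scale /= -mul2n; field.
by apply: is_derive_sum => j; apply: is_deriveZ; exact: is_derive_pow.
Qed.

Lemma wallis_polyN n u : wallis_poly n (- u) = - wallis_poly n u.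
Proof.
rewrite -sumrN; apply: eq_bigr => j _.
by rewrite (exprNn u) -[(-1) ^+ j.*2.+1]signr_odd /= odd_double expr1 mulN1r mulrN.
Qed.

Lemma wallis_poly0 n : wallis_poly n 0 = 0.
Proof. by rewrite /wallis_poly big1// => j _; rewrite expr0n mulr0. Qed.

Lemma wallis_poly1_gt0 n : 0 < wallis_poly n 1.
Proof.
rewrite -[ltLHS](wallis_poly0 n).
apply: derive_gt0_lt ltr01 (fun x _ => is_derive_wallis_poly n x) _.
by move=> x /andP[x0 x1]; rewrite exprn_gt0// subr_gt0 -[ltRHS](expr1n _ 2) ltrXn2r// ltW.
Qed.

Lemma is_derive_wallis_cos n t :
  is_derive t 1 (fun t => - wallis_poly n (cos t)) (sin t ^+ n.*2.+1).
Proof.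
have d : is_derive t 1 (wallis_poly n \o cos) ((1 - cos t ^+ 2) ^+ n * - sin t).
  by apply: is_derive_eq (is_derive1_comp (is_derive_wallis_poly n (cos t)) (is_derive_cos t)) _.
apply: is_derive_eq (is_deriveN d) _.
by rewrite -sin2cos2 -exprM mulrN opprK -exprSr mul2n.
Qed.

Lemma integral_from_to_sin_pow n t :
  integral_from_to 0 t (fun w => sin w ^+ n.*2.+1) = wallis_poly n 1 - wallis_poly n (cos t).
Proof.
have cs : continuous (fun w : R => sin w ^+ n.*2.+1).
  move=> x; apply: (@continuous_comp _ _ _ sin (fun y : R => y ^+ n.*2.+1)).
    exact: continuous_sin.
  exact: exprn_continuous.
rewrite /integral_from_to; have [t0|t0] := leP 0 t.
  rewrite (Rintegral_FTC t0 cs (is_derive_wallis_cos n)) cos0; ring.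
rewrite (Rintegral_FTC (ltW t0) cs (is_derive_wallis_cos n)) cos0; ring.
Qed.

Definition mask_poly n u : R := (1 + wallis_poly n u / wallis_poly n 1) / 2.

Lemma sqr_cmod_mask n (H : R -> R[i]) t : is_daubechies_mask n.+1 H ->
  cmod (H t) ^+ 2 = mask_poly n (cos t).
Proof.
move=> [_ -> _]; have W := wallis_poly1_gt0 n.
rewrite /daubechies_c !integral_from_to_sin_pow cospi wallis_polyN /mask_poly.
have W0 : wallis_poly n 1 != 0 by rewrite gt_eqF.
by field; rewrite ?W0 ?andbT//; apply/eqP; lra.
Qed.

Lemma mask_polyN n u : mask_poly n (- u) = 1 - mask_poly n u.
Proof. by rewrite /mask_poly wallis_polyN; field; rewrite gt_eqF// wallis_poly1_gt0. Qed.

Lemma mask_poly1 n : mask_poly n 1 = 1.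
Proof. by rewrite /mask_poly divff ?gt_eqF ?wallis_poly1_gt0//; field. Qed.

Lemma is_derive_mask_poly n u :
  is_derive u 1 (mask_poly n) ((1 - u ^+ 2) ^+ n / (2 * wallis_poly n 1)).
Proof.
have W := wallis_poly1_gt0 n.
have -> : mask_poly n = cst (1 / 2) + (2 * wallis_poly n 1)^-1 *: wallis_poly n.
  by apply/funext => y; rewrite /mask_poly !fctE /GRing.scale /=; field; rewrite gt_eqF.
have d := is_deriveD (is_derive_cst (1 / 2 : R) u 1)
  (is_deriveZ (2 * wallis_poly n 1)^-1 (is_derive_wallis_poly n u)).
by apply: is_derive_eq d _; rewrite add0r; exact: mulrC.
Qed.

Lemma one_sub_sqr_ge0 u : -1 <= u <= 1 -> 0 <= 1 - u ^+ 2.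
Proof. by move=> u1; rewrite subr_ge0 -real_normK ?num_real// exprn_ile1// ler_norml. Qed.

Lemma mask_poly_bounds n u : -1 <= u <= 1 -> 0 <= mask_poly n u <= 1.
Proof.
move=> /andP[u1 u2]; have W := wallis_poly1_gt0 n.
have inc a b : -1 <= a -> a <= b -> b <= 1 -> mask_poly n a <= mask_poly n b.
  move=> a1 ab b1; apply: derive_ge0_le ab (fun x _ => is_derive_mask_poly n x) _.
  move=> x /andP[ax xb]; rewrite divr_ge0 ?exprn_ge0 ?one_sub_sqr_ge0//.
    by rewrite (le_trans a1 (ltW ax)) (le_trans (ltW xb)).
  by rewrite mulr_ge0// ltW.
have m1 := mask_polyN n 1; rewrite mask_poly1 subrr in m1.
by rewrite -{1}m1 inc//= -[leRHS](mask_poly1 n) inc.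
Qed.

Lemma mask_poly0 n : mask_poly n 0 = 1 / 2.
Proof. by rewrite /mask_poly wallis_poly0 mul0r addr0. Qed.

(** For a positive exponent the difference [D] of the two sides vanishes at [-1] and at 0, and the
    sign of its derivative is that of the decreasing function [s]. So [D] increases and then
    decreases, and is nonnegative. For exponent 0 the bound is the value of [mask_poly] at 0. *)
Lemma mask_poly_le n u : -1 <= u <= 0 -> mask_poly n u <= (1 - u ^+ 2) ^+ n / 2.
Proof.
move=> /andP[u1 u0]; have W := wallis_poly1_gt0 n.
case: n W => [|n] W.
  rewrite expr0 -(mask_poly0 0); apply: derive_ge0_le u0 (fun x _ => is_derive_mask_poly 0 x) _.
  by move=> x _; rewrite expr0 div1r invr_ge0 mulr_ge0// ltW.
set q := wallis_poly n.+1 1 in W.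
pose D (x : R) : R := (1 - x ^+ 2) ^+ n.+1 / 2 - mask_poly n.+1 x.
pose s (x : R) : R := - n.+1%:R * x - (1 - x ^+ 2) / (2 * q).
have dD (x : R) : is_derive x 1 D ((1 - x ^+ 2) ^+ n * s x).
  have d1 : is_derive x 1 (fun x : R => 1 - x ^+ 2) (- (2 * x)).
    by apply: is_derive_eq; rewrite /GRing.scale /=; ring.
  have d2 := @is_derive1_comp _ (fun y => y ^+ n.+1) (fun x => 1 - x ^+ 2) x _ _ (is_derive_pow n.+1 (1 - x ^+ 2)) d1.
  have d3 := is_deriveB (is_deriveZ (1/2) d2) (is_derive_mask_poly n.+1 x).
  have -> : D = (1/2) *: ((fun y : R => y ^+ n.+1) \o (fun x : R => 1 - x ^+ 2)) - mask_poly n.+1.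
    by apply/funext => y; rewrite /D !fctE /GRing.scale /=; field.
  apply: is_derive_eq d3 _; rewrite /s /GRing.scale /= -/q [_ ^+ n.+1]exprS.
  by field; rewrite gt_eqF.
have q2 : 0 < 2 * q by rewrite mulr_gt0.
have s_dec (x y : R) : x <= y -> y <= 0 -> s y <= s x.
  move=> xy y0; rewrite -subr_ge0.
  have -> : s x - s y = (y - x) * (n.+1%:R - (y + x) / (2 * q)).
    by rewrite /s; field; rewrite gt_eqF.
  rewrite mulr_ge0 ?subr_ge0// (le_trans _ (ler0n _ _))//.
  by rewrite pmulr_lle0 ?invr_gt0//; lra.
have pos (x : R) : -1 <= x <= 0 -> 0 <= (1 - x ^+ 2) ^+ n.
  by move=> x01; rewrite exprn_ge0 ?one_sub_sqr_ge0//; lra.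
rewrite -subr_ge0 -/(D u).
have m1 := mask_polyN n.+1 1; rewrite mask_poly1 subrr in m1.
have [su|su] := leP 0 (s u).
  have <- : D (-1) = 0 by rewrite /D m1 sqrrN expr1n subrr expr0n mul0r subrr.
  apply: derive_ge0_le u1 (fun x _ => dD x) _ => x /andP[x1 xu].
  rewrite mulr_ge0 ?pos//; first by lra.
  by apply: (le_trans su); rewrite s_dec// ltW.
have <- : D 0 = 0 by rewrite /D mask_poly0 expr0n subr0 expr1n subrr.
apply: derive_le0_ge u0 (fun x _ => dD x) _ => x /andP[ux x0].
rewrite mulr_ge0_le0 ?pos//; first by lra.
by apply: (le_trans _ (ltW su)); rewrite s_dec// ltW.
Qed.

End mask_modulus.

(** * Decay of the products of masks, uniformly in the order *)

Section mask_product.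
Context {R : realType}.
Implicit Types (n N : nat) (u t w x y : R).

Definition mask_sqr n t : R := mask_poly n (cos t).

Definition mask_prod n N w : R :=
  mask_sqr n (w / 2 + pi) * \prod_(1 <= l < N.+1) mask_sqr n (w / 2 ^+ l.+1).

(** A base free of the order, whose [n]-th power bounds the squared mask; no decay is claimed where
    the cosine is nonnegative. *)
Definition damping t : R := if 0 <= cos t then 1 else sin t ^+ 2.

Lemma sin_sqr_le1 t : sin t ^+ 2 <= 1.
Proof. by rewrite sin2cos2 gerBl sqr_ge0. Qed.

Lemma mask_sqr_bounds n t : 0 <= mask_sqr n t <= 1.
Proof. by apply: mask_poly_bounds; rewrite cos_geN1 cos_le1. Qed.

Lemma mask_sqr_ge0 n t : 0 <= mask_sqr n t.
Proof. by case/andP: (mask_sqr_bounds n t). Qed.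

Lemma mask_sqr_le1 n t : mask_sqr n t <= 1.
Proof. by case/andP: (mask_sqr_bounds n t). Qed.

Lemma mask_sqr_le n t : cos t <= 0 -> mask_sqr n t <= (sin t ^+ 2) ^+ n / 2.
Proof. by move=> ct; rewrite sin2cos2; apply: mask_poly_le; rewrite cos_geN1. Qed.

Lemma mask_sqr_ge n t : 0 <= cos t -> 1 - (sin t ^+ 2) ^+ n / 2 <= mask_sqr n t.
Proof.
move=> ct; rewrite lerBlDr -lerBlDl -mask_polyN -(sqrrN (sin t)).
rewrite sqrrN sin2cos2 -sqrrN; apply: mask_poly_le.
by rewrite lerN2 cos_le1 oppr_le0.
Qed.

Lemma damping_bounds t : 0 <= damping t <= 1.
Proof. by rewrite /damping; case: ifP => _; rewrite ?ler01 ?lexx// sqr_ge0 sin_sqr_le1. Qed.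

Lemma mask_sqr_damping n t : mask_sqr n t <= damping t ^+ n.
Proof.
rewrite /damping; case: (leP 0 (cos t)) => ct; first by rewrite expr1n mask_sqr_le1.
apply: (le_trans (mask_sqr_le n (ltW ct))).
by rewrite ler_pdivrMr// mulr_natr mulr2n lerDl exprn_ge0// sqr_ge0.
Qed.

Lemma prod_mask_bounds n (r : seq nat) (f : nat -> R) :
  0 <= \prod_(l <- r) mask_sqr n (f l) <= 1.
Proof.
elim/big_ind : _ => [|x y /andP[x0 x1] /andP[y0 y1]|i _]; first by rewrite ler01 lexx.
  by rewrite mulr_ge0// mulr_ile1.
exact: mask_sqr_bounds.
Qed.

Lemma mask_prod_ge0 n N w : 0 <= mask_prod n N w.
Proof. by rewrite mulr_ge0 ?mask_sqr_ge0//; case/andP: (prod_mask_bounds n (index_iota 1 N.+1) (fun l => w / 2 ^+ l.+1)). Qed.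

Lemma mask_prod_le_first n N w : mask_prod n N w <= mask_sqr n (w / 2 + pi).
Proof.
rewrite ler_piMr ?mask_sqr_ge0//.
by case/andP: (prod_mask_bounds n (index_iota 1 N.+1) (fun l => w / 2 ^+ l.+1)).
Qed.

Lemma mask_prod_recr n N w : mask_prod n N.+1 w = mask_prod n N w * mask_sqr n (w / 2 ^+ N.+2).
Proof. by rewrite /mask_prod big_nat_recr//= mulrA. Qed.

Lemma mask_prod_decr n N N' w : (N <= N')%N -> mask_prod n N' w <= mask_prod n N w.
Proof.
move=> /subnKC <-; elim: (N' - N)%N => [|k IH]; first by rewrite addn0.
by rewrite addnS mask_prod_recr; apply: le_trans IH; rewrite ler_piMr ?mask_prod_ge0 ?mask_sqr_le1.
Qed.

Lemma mask_prod_le_damping n N w :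
  mask_prod n N w <= (\prod_(1 <= l < N.+1) damping (w / 2 ^+ l.+1)) ^+ n.
Proof.
apply: (@le_trans _ _ (\prod_(1 <= l < N.+1) mask_sqr n (w / 2 ^+ l.+1))).
  rewrite ler_piMl ?mask_sqr_le1//.
  by case/andP: (prod_mask_bounds n (index_iota 1 N.+1) (fun l => w / 2 ^+ l.+1)).
rewrite -prodrXl; apply: ler_prod => l _.
by rewrite mask_sqr_ge0 mask_sqr_damping.
Qed.

Lemma mask_prod_le_factor n N w : (0 < N)%N ->
  mask_prod n N w <= damping (w / 2 ^+ N.+1) ^+ n.
Proof.
case: N => // N _; rewrite mask_prod_recr.
apply: le_trans (mask_sqr_damping n _).
rewrite ler_piMl ?mask_sqr_ge0//.
by apply: (le_trans (mask_prod_le_first _ _ _)); rewrite mask_sqr_le1.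
Qed.

Lemma dyadic_prod (F : R -> R) N w : \prod_(1 <= l < N.+1) F (w / 2 ^+ l.+1) =
  \prod_(i < N) F (2 ^+ i * (w / 2 ^+ N.+1)).
Proof.
rewrite big_add1 /= big_mkord (reindex_inj rev_ord_inj) /=; apply: eq_bigr => i _; congr F.
have -> : N.+1 = (i + (N - i.+1).+2)%N by have := ltn_ord i; lia.
rewrite mulrCA; congr (_ * _).
have p2 k : 2 ^+ k != 0 :> R by rewrite expf_neq0// pnatr_eq0.
by rewrite (exprD _ i) (invfM (2 ^+ i)) (mulrA (2 ^+ i)) (mulfV (p2 i)) mul1r.
Qed.

(** The loss factor of one doubling in the telescoping below: [1/2] serves the angles of nonnegative
    cosine, the squared sine the others. *)
Definition half_sin_cap t : R := Num.max (1 / 2) (sin (t / 2) ^+ 2).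

Lemma sin_cos_half t : cos t = 1 - 2 * sin (t / 2) ^+ 2 /\
  sin t ^+ 2 = 4 * sin (t / 2) ^+ 2 * (1 - sin (t / 2) ^+ 2).
Proof.
have tE : t = t / 2 + t / 2 by field.
have c2 := cos2sin2 (t / 2).
split; first by rewrite {1}tE cosD -!expr2 c2; ring.
have -> : sin t = 2 * sin (t / 2) * cos (t / 2) by rewrite {1}tE sinD; ring.
rewrite exprMn c2; ring.
Qed.

Lemma half_sin_cap_bounds t : 0 <= half_sin_cap t <= 1.
Proof. by rewrite /half_sin_cap le_max ge_max sin_sqr_le1 sqr_ge0 orbT andbT /=; lra. Qed.

(* Telescoping step: when the cosine is nonnegative, doubling the angle at
   least doubles [sin (t / 2) ^+ 2]. *)
Lemma damping_step t : sin (t / 2) ^+ 2 * damping t <= half_sin_cap t * sin t ^+ 2.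
Proof.
have [ct st] := sin_cos_half t.
rewrite /damping /half_sin_cap; set y := sin (t / 2) ^+ 2 in ct st *.
have y0 : 0 <= y by exact: sqr_ge0.
have y1 : y <= 1 by exact: sin_sqr_le1.
case: (leP 0 (cos t)) => c0; last by rewrite ler_wpM2r ?sqr_ge0// le_max lexx orbT.
apply: (@le_trans _ _ (1 / 2 * sin t ^+ 2)); last by rewrite ler_wpM2r ?sqr_ge0// le_max lexx.
rewrite st; move: c0; rewrite ct => c0.
have : 0 <= y * (1 - 2 * y) by rewrite mulr_ge0.
lra.
Qed.

Lemma prod_damping_le N x :
  sin (x / 2) ^+ 2 * \prod_(i < N) damping (2 ^+ i * x) <=
  (\prod_(i < N) half_sin_cap (2 ^+ i * x)) * sin (2 ^+ N * x / 2) ^+ 2.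
Proof.
elim: N => [|N IH]; first by rewrite !big_ord0 expr0 mul1r mulr1 mul1r.
rewrite !big_ord_recr /= mulrA.
have [d0 d1] := andP (damping_bounds (2 ^+ N * x)).
apply: (le_trans (ler_wpM2r d0 IH)).
have -> : 2 ^+ N.+1 * x / 2 = 2 ^+ N * x by rewrite exprS; field.
rewrite -[leLHS]mulrA -[leRHS]mulrA ler_wpM2l//.
  by rewrite prodr_ge0// => i _; case/andP: (half_sin_cap_bounds (2 ^+ i * x)).
exact: damping_step.
Qed.

(** With [y = sin(t/2)^2] the product is [y] times the maximum of [1/2] and [4 y (1 - y)]. On
    [[3/4, 1]], [4 y^2 (1 - y)] decreases from [9/16]. The value [3/4] is that of the orbit of
    [2 pi / 3], which doubling preserves up to sign and period. *)
Lemma half_sin_cap_double t : 3 / 4 < half_sin_cap t ->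
  half_sin_cap t * half_sin_cap (2 * t) <= 9 / 16.
Proof.
have e : 2 * t / 2 = t by field.
rewrite /half_sin_cap e (sin_cos_half t).2; set y := sin (t / 2) ^+ 2.
have y1 : y <= 1 by exact: sin_sqr_le1.
rewrite lt_max => /orP[|y34]; first by lra.
have -> : Num.max (1 / 2) y = y by apply/max_idPr; lra.
rewrite maxr_pMr; last by lra.
rewrite ge_max; apply/andP; split; first by lra.
have : 0 <= (y - 3 / 4) * (4 * (y * y) - y - 3 / 4).
  rewrite mulr_ge0; [by []|lra|].
  have : 0 <= (y - 3 / 4) * (4 * y + 2) by rewrite mulr_ge0; lra.
  lra.
lra.
Qed.

(** A factor above [3/4] is grouped with its successor, the others stand alone, so the mean factor
    is at most [3/4]. The last factor may lack a successor; the initial [3/4] pays for it. *)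
Lemma prod_half_sin_cap_le N t :
  3 / 4 * \prod_(i < N) half_sin_cap (2 ^+ i * t) <= (3 / 4) ^+ N.
Proof.
suff : forall t, 3 / 4 * \prod_(i < N) half_sin_cap (2 ^+ i * t) <= (3 / 4) ^+ N /\
    3 / 4 * \prod_(i < N.+1) half_sin_cap (2 ^+ i * t) <= (3 / 4) ^+ N.+1 by case/(_ t).
have shift M s : \prod_(i < M) half_sin_cap (2 ^+ (lift ord0 i) * s) =
    \prod_(i < M) half_sin_cap (2 ^+ i * (2 * s)).
  by apply: eq_bigr => i _; rewrite lift0 exprSr mulrA.
elim: N => [|N IH] s.
  rewrite !big_ord_recl !big_ord0 expr0 expr1 !mulr1 mul1r; split; first by lra.
  by rewrite ler_piMr//; case/andP: (half_sin_cap_bounds s).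
have [h0 h1] := andP (half_sin_cap_bounds s).
split; first by case: (IH s).
rewrite big_ord_recl expr0 mul1r shift.
have [hs|hs] := leP (half_sin_cap s) (3 / 4).
  rewrite mulrCA exprS; have [_ IH1] := IH (2 * s).
  apply: (le_trans (ler_wpM2l h0 IH1)).
  by rewrite ler_wpM2r// exprn_ge0//; lra.
rewrite big_ord_recl expr0 mul1r shift.
have [IH1 _] := IH (2 * (2 * s)).
have hh := half_sin_cap_double hs.
set P := \prod_(i < N) _ in IH1 *.
have -> : 3 / 4 * (half_sin_cap s * (half_sin_cap (2 * s) * P)) =
  half_sin_cap s * half_sin_cap (2 * s) * (3 / 4 * P) by ring.
have P0 : 0 <= 3 / 4 * P.
  rewrite mulr_ge0// /P prodr_ge0// => i _.
  by case/andP: (half_sin_cap_bounds (2 ^+ i * (2 * (2 * s)))).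
apply: (le_trans (ler_wpM2r P0 hh)).
rewrite (exprS _ N.+1) exprS mulrA (_ : 3 / 4 * (3 / 4) = 9 / 16); last by field.
by rewrite ler_wpM2l.
Qed.

Lemma dyadic_scale w : 1 <= `|w| -> exists N, 2 ^+ N <= `|w| < 2 ^+ N.+1.
Proof.
move=> w1; have w0 : 0 <= `|w| by [].
pose N0 := (Num.truncn `|w|).+1.
have ub : exists N, `|w| < 2 ^+ N.
  exists N0; apply: (lt_trans (truncnS_gt _)).
  by rewrite -natrX ltr_nat ltn_expl.
case: (ex_minnP ub) => [[|M] wM minM].
  by move: wM; rewrite expr0 ltNge w1.
exists M; rewrite wM andbT leNgt; apply/negP => /minM; rewrite ltnn//.
Qed.

Lemma sin_sqr_ge (x : R) : 1 / 2 <= `|x| <= 1 -> 1 / 64 <= sin (x / 2) ^+ 2.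
Proof.
have pos (y : R) : 1 / 2 <= y <= 1 -> 1 / 64 <= sin (y / 2) ^+ 2.
  move=> y01; have [+ _] := @sinc_half_ge _ y ltac:(lra).
  rewrite ler_pdivlMr; last by lra.
  move=> h; have h8 : 1 / 8 <= sin (y / 2) by lra.
  have -> : 1 / 64 = (1 / 8) ^+ 2 :> R by field.
  by rewrite lerXn2r// nnegrE//; lra.
have [x0|x0] := leP 0 x; first by rewrite ger0_norm//; exact: pos.
by rewrite ltr0_norm// => /pos; rewrite mulNr sinN sqrrN.
Qed.

(** Read from the smallest angle, the arguments form a doubling orbit starting at some [x] with
    [1/2 <= |x| <= 1], where [sin(x/2)^2 >= 1/64]. Telescoping bounds the product by [86 (3/4)^N],
    as [64 * 4/3 < 86]. The fifth power is chosen because [(3/4)^5 <= 1/4], which turns the bound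
    into a multiple of [4^(-N)], comparable to [w^(-2)]. *)
Lemma prod_damping_decay w : 1 <= `|w| -> exists N,
  (\prod_(1 <= l < N.+1) damping (w / 2 ^+ l.+1)) ^+ 5 <= 4 * 86 ^+ 5 / w ^+ 2.
Proof.
move=> w1; have [N /andP[Nw wN]] := dyadic_scale w1; exists N.
rewrite dyadic_prod; set x := w / 2 ^+ N.+1.
have p0 : 0 < 2 ^+ N.+1 :> R by exact: exprn_gt0.
have x01 : 1 / 2 <= `|x| <= 1.
  rewrite normrM normrV ?unitfE ?gt_eqF// (gtr0_norm p0).
  apply/andP; split; last by rewrite ler_pdivrMr// (mul1r (2 ^+ N.+1)) ltW.
  by rewrite ler_pdivlMr// exprS mulrA div1r mulVf ?pnatr_eq0// (mul1r (2 ^+ N)).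
have h := prod_damping_le N x.
have P0 : 0 <= \prod_(i < N) damping (2 ^+ i * x).
  by rewrite prodr_ge0// => i _; case/andP: (damping_bounds (2 ^+ i * x)).
have P86 : \prod_(i < N) damping (2 ^+ i * x) <= 86 * (3 / 4) ^+ N.
  have := ler_wpM2r P0 (sin_sqr_ge x01) => h1.
  have Q0 : 0 <= \prod_(i < N) half_sin_cap (2 ^+ i * x).
    by rewrite prodr_ge0// => i _; case/andP: (half_sin_cap_bounds (2 ^+ i * x)).
  have h2 := ler_wpM2l Q0 (sin_sqr_le1 (2 ^+ N * x / 2)).
  have h3 := prod_half_sin_cap_le N x.
  have t0 : 0 <= (3 / 4) ^+ N :> R by rewrite exprn_ge0//; lra.
  move: h h1 h2 h3; set P := \prod_(i < N) damping _; set Q := \prod_(i < N) half_sin_cap _.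
  lra.
have c86 : 0 <= 86 * (3 / 4) ^+ N :> R by exact: le_trans P0 P86.
apply: (le_trans (_ : _ <= (86 * (3 / 4) ^+ N) ^+ 5)); first by rewrite lerXn2r// nnegrE.
have w2 : 0 < w ^+ 2 by rewrite -real_normK ?num_real// exprn_gt0// (lt_le_trans ltr01).
rewrite ler_pdivlMr// exprMn [4 * _]mulrC -mulrA ler_wpM2l ?exprn_ge0//.
rewrite exprAC.
have q4 : (3 / 4) ^+ 5 <= 1 / 4 :> R by lra.
apply: (@le_trans _ _ ((1 / 4) ^+ N * (2 ^+ N.+1) ^+ 2)); last first.
  rewrite -exprM mulnC exprM -[X in _ * X](_ : 4 ^+ N.+1 = _); last by congr (_ ^+ _); ring.
  by rewrite exprS mulrCA -exprMn (_ : 1 / 4 * 4 = 1) ?expr1n ?mulr1//; field.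
have q0 : 0 <= (3 / 4) ^+ 5 :> R by lra.
apply: ler_pM; [exact: exprn_ge0|exact: sqr_ge0| |].
  by rewrite lerXn2r// nnegrE; lra.
by rewrite -real_normK ?num_real// lerXn2r ?nnegrE// ltW.
Qed.

(** The first halving that brings [|w|] down to at most [pi] leaves it above [pi / 2], where the
    cosine is negative. Since [|w| > 2 pi], this takes at least two halvings, so the angle is an
    argument of the infinite product. *)
Lemma damping_lt1_exists w : 2 * pi < `|w| ->
  exists N, (0 < N)%N /\ 0 <= damping (w / 2 ^+ N.+1) < 1.
Proof.
move=> w2; have p2 := @pi_ge2 R.
have ub : exists N, `|w| / 2 ^+ N <= pi.
  have [N /andP[_ wN]] := @dyadic_scale w ltac:(lra).
  exists N.+1; rewrite ler_pdivrMr ?exprn_gt0//.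
  by apply: (le_trans (ltW wN)); rewrite ler_peMl ?exprn_ge0//; lra.
case: (ex_minnP ub) => -[|[|N]].
- by rewrite expr0 divr1; lra.
- by rewrite expr1; lra.
move=> wN minN; exists N.+1; split => //.
have wN1 : pi < `|w| / 2 ^+ N.+1 by rewrite ltNge; apply/negP => /minN; rewrite ltnn.
have xE : `|w / 2 ^+ N.+2| = `|w| / 2 ^+ N.+2.
  by rewrite normrM normrV ?unitfE ?expf_neq0 ?pnatr_eq0// (gtr0_norm (exprn_gt0 _ _)).
set x := w / 2 ^+ N.+2 in xE *.
have x2 : `|x| = `|w| / 2 ^+ N.+1 / 2 by rewrite xE [in LHS]exprS; field; rewrite expf_neq0 ?pnatr_eq0.
have cx : cos x < 0.
  suff : cos `|x| < 0 by case: (ger0P x) => _; rewrite ?cosN.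
  rewrite -cos_pihalf ltr_cos ?in_itv /=; [lra|lra|by rewrite normr_ge0 xE].
rewrite /damping (leNgt 0 (cos x)) cx /= sqr_ge0 sin2cos2 gtrBl exprn_even_gt0//=.
by rewrite lt_eqF.
Qed.

End mask_product.

(** * Lower bounds inside the band *)

Section daubechies_pointwise.
Context {R : realType}.
Implicit Types (n N : nat) (u t w x y : R).

Lemma sin_sqr_half_le x : 0 <= cos x -> sin (x / 2) ^+ 2 <= sin x ^+ 2 / 2.
Proof.
have [-> ->] := sin_cos_half x => c0; set y := sin (x / 2) ^+ 2 in c0 *.
have : 0 <= y * (1 - 2 * y) by rewrite mulr_ge0// sqr_ge0.
lra.
Qed.

Lemma cos_dyadic_ge0 w l : `|w| < 2 * pi -> 0 <= cos (w / 2 ^+ l.+2).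
Proof.
move=> w2; apply: cos_ge0_pihalf; rewrite -ler_norml normrM normrV ?unitfE ?expf_neq0 ?pnatr_eq0//.
rewrite (gtr0_norm (exprn_gt0 _ _))// ler_pdivrMr ?exprn_gt0//.
have h : 1 <= 2 ^+ l :> R by rewrite exprn_ege1// ler1n.
rewrite !exprS; have p2 := @pi_ge2 R.
have : 0 <= (2 ^+ l - 1) * pi :> R by apply: mulr_ge0; lra.
by move: w2; move: (@pi R) (2 ^+ l) `|w|; clear=> P s v; lra.
Qed.

Lemma sin_sqr_dyadic w l : `|w| < 2 * pi ->
  sin (w / 2 ^+ l.+2) ^+ 2 <= sin (w / 4) ^+ 2 / 2 ^+ l.
Proof.
move=> w2; elim: l => [|l IH].
  by rewrite expr0 divr1 -natrX.
have -> : w / 2 ^+ l.+3 = w / 2 ^+ l.+2 / 2 by rewrite [in LHS]exprSr invfM mulrA.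
apply: (le_trans (sin_sqr_half_le (cos_dyadic_ge0 l w2))).
by rewrite (exprSr 2 l) (invfM (2 ^+ l)) [leRHS]mulrA ler_wpM2r// invr_ge0.
Qed.

(** Each further halving of the angle at least halves the deficit of the mask, so the deficits form
    a convergent geometric series. The factor [1 - 2^(-N)] is the partial sum that makes the
    induction close with a bound uniform in [N]. *)
Lemma prod_mask_ge n N w : (0 < n)%N -> `|w| < 2 * pi ->
  1 - (sin (w / 4) ^+ 2) ^+ n * (1 - 2 ^- N) <=
  \prod_(1 <= l < N.+1) mask_sqr n (w / 2 ^+ l.+1).
Proof.
move=> n0 w2; set s := sin (w / 4) ^+ 2.
have s0 : 0 <= s by exact: sqr_ge0.
have s1 : s <= 1 by exact: sin_sqr_le1.
have sn0 : 0 <= s ^+ n by rewrite exprn_ge0.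
have sn1 : s ^+ n <= 1 by rewrite exprn_ile1.
elim: N => [|N IH]; first by rewrite big_geq// expr0 invr1 subrr mulr0 subr0.
rewrite big_nat_recr//=.
have f : 1 - s ^+ n / 2 ^+ N.+1 <= mask_sqr n (w / 2 ^+ N.+2).
  apply: (le_trans _ (mask_sqr_ge n (cos_dyadic_ge0 N w2))).
  rewrite lerD2l lerN2 (exprSr 2 N) (invfM (2 ^+ N)) [leRHS]mulrA ler_wpM2r ?invr_ge0//.
  apply: (@le_trans _ _ ((s / 2 ^+ N) ^+ n)).
    rewrite lerXn2r ?nnegrE//; [exact: sqr_ge0| |exact: sin_sqr_dyadic].
    by rewrite divr_ge0// exprn_ge0.
  rewrite exprMn ler_wpM2l// -[leRHS]expr1 ler_wiXn2l ?invr_ge0 ?exprn_ge0//.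
  by rewrite invf_le1 ?exprn_gt0// exprn_ege1// ler1n.
have h2 : 0 < (2 ^- N.+1 : R) <= 1 / 2.
  rewrite invr_gt0 exprn_gt0//= div1r lef_pV2 ?posrE ?exprn_gt0// exprS ler_peMr//.
  by rewrite exprn_ege1// ler1n.
have hN : 2 ^- N = 2 * 2 ^- N.+1 :> R by rewrite (exprS 2 N) (invfM 2 (2 ^+ N)) mulrA mulfV ?mul1r ?pnatr_eq0.
move: f h2; rewrite hN in IH *; set h := 2 ^- N.+1 => f h2.
have a0 : 0 <= 1 - s ^+ n * (1 - 2 * h).
  by rewrite subr_ge0 mulr_ile1//; lra.
have b0 : 0 <= 1 - s ^+ n * h.
  by rewrite subr_ge0 mulr_ile1//; lra.
apply: (le_trans _ (ler_pM a0 b0 IH f)).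
have : 0 <= (s ^+ n * (1 - 2 * h)) * (s ^+ n * h) by rewrite !mulr_ge0//; lra.
move: (s ^+ n) => S; lra.
Qed.

Lemma mask_prod_ge n N w : (0 < n)%N -> pi < `|w| < 2 * pi ->
  (1 - (sin (w / 2) ^+ 2) ^+ n) * (1 - (sin (w / 4) ^+ 2) ^+ n) <= mask_prod n N w.
Proof.
move=> n0 /andP[w1 w2].
have pw (x : R) k : 0 <= (sin x ^+ 2) ^+ k <= 1.
  by rewrite exprn_ge0 ?sqr_ge0// exprn_ile1 ?sqr_ge0 ?sin_sqr_le1.
have [a0 a1] := andP (pw (w / 2) n); have [b0 b1] := andP (pw (w / 4) n).
apply: ler_pM; rewrite ?subr_ge0//.
  have c0 : 0 <= cos (w / 2 + pi).
    rewrite cosDpi oppr_ge0.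
    suff : cos `|w / 2| <= 0 by case: (ger0P (w / 2)) => _; rewrite ?cosN.
    rewrite normrM (@ger0_norm _ 2^-1)// -cos_pihalf.
    by rewrite ltW// ltr_cos ?in_itv /=; have := @pi_ge2 R; lra.
  apply: (le_trans _ (mask_sqr_ge n c0)); rewrite sinDpi sqrrN; lra.
apply: (le_trans _ (prod_mask_ge N n0 w2)).
rewrite lerD2l lerN2 ler_piMr// gerBl invr_ge0 exprn_ge0//.
Qed.

End daubechies_pointwise.

(** * From the masks to the spectrum of the Daubechies wavelets *)

Section daubechies_spectrum.
Context {R : realType}.
Local Notation mu := (@lebesgue_measure R).
Implicit Types (n N k : nat) (w : R) (psi : R -> R[i]).

Definition spectrum psi w : R := Num.sqrt (2 * pi) * cmod (fourier psi w).

Lemma spectrum_ge0 psi w : 0 <= spectrum psi w.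
Proof. by rewrite mulr_ge0 ?sqrtr_ge0 ?cmod_ge0. Qed.

Lemma cvg_cmod (u : nat -> R[i]) (l : R[i]) :
  ((u : nat -> (R[i])^o) @ \oo --> (l : (R[i])^o)) -> (fun n => cmod (u n)) @ \oo --> cmod l.
Proof.
move=> ul; apply/cvgrPdist_lt => e e0.
have /cvgrPdist_lt /(_ e%:C) := ul.
rewrite ltcR => /(_ e0); apply: filterS => n.
have -> : `|l - u n| = (cmod (l - u n))%:C by rewrite normc_def cmodE; case: (l - u n).
by rewrite ltcR; apply: le_lt_trans; exact: ler_cmod_dist.
Qed.

Lemma sqr_spectrum_cvg n psi w : is_daubechies_wavelet n.+1 psi ->
  (fun N => mask_prod n N w) @ \oo --> spectrum psi w ^+ 2.
Proof.
move=> [H mH [_ /(_ w) /cvg_cmod cH]].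
have s0 : 0 < Num.sqrt (2 * pi) :> R by rewrite sqrtr_gt0 mulr_gt0// pi_gt0.
have -> : (fun N => mask_prod n N w) = (fun N => (Num.sqrt (2 * pi) *
    cmod (((Num.sqrt (2 * pi))^-1)%:C * H (w / 2 + pi) * \prod_(1 <= l < N.+1) H (w / 2 ^+ l.+1))) ^+ 2).
  apply/funext => N; rewrite !cmodM cmod_real ger0_norm ?invr_ge0 ?sqrtr_ge0//.
  rewrite mulrA mulrA mulfV ?gt_eqF// mul1r exprMn (sqr_cmod_mask _ mH); congr (_ * _).
  rewrite (big_morph (@cmod R) (@cmodM R) (@cmod1 R)) -prodrXl.
  by apply: eq_bigr => l _; rewrite (sqr_cmod_mask _ mH).
rewrite /spectrum; under eq_fun do rewrite expr2; rewrite expr2.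
by apply: cvgM; apply: cvgZl_tmp.
Qed.

Lemma sqr_spectrum_le n psi w N : is_daubechies_wavelet n.+1 psi ->
  spectrum psi w ^+ 2 <= mask_prod n N w.
Proof.
move=> /sqr_spectrum_cvg - /(_ w) /cvgr_to_le; apply.
by exists N => // N' /= NN'; exact: mask_prod_decr.
Qed.

Lemma sqr_spectrum_ge n psi w c : is_daubechies_wavelet n.+1 psi ->
  (forall N, c <= mask_prod n N w) -> c <= spectrum psi w ^+ 2.
Proof. by move=> /sqr_spectrum_cvg - /(_ w) /cvgr_to_ge + cT; apply; exact: nearW. Qed.

Lemma measurable_mask_sqr n (f : R -> R) : measurable_fun setT f ->
  measurable_fun setT (fun w => mask_sqr n (f w)).
Proof.
move=> mf; apply: (measurableT_comp _ mf); apply: continuous_measurable_fun => x.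
apply: (@continuous_comp _ _ _ cos (mask_poly n)); first exact: continuous_cos.
apply: differentiable_continuous; apply/derivable1_diffP.
by have [] := is_derive_mask_poly n (cos x).
Qed.

Lemma measurable_spectrum n psi : is_daubechies_wavelet n.+1 psi ->
  measurable_fun setT (spectrum psi).
Proof.
move=> hpsi.
have -> : spectrum psi = Num.sqrt \o (fun w => spectrum psi w ^+ 2).
  by apply/funext => w /=; rewrite sqrtr_sqr ger0_norm ?spectrum_ge0.
apply: (measurableT_comp (continuous_measurable_fun (@sqrt_continuous R))).
apply: (@measurable_fun_cvg _ _ _ _ (fun N => mask_prod n N)); last first.
  by move=> w _; exact: sqr_spectrum_cvg.
elim=> [|N IH].
  rewrite (_ : mask_prod n 0 = fun w => mask_sqr n (w / 2 + pi)).
    by apply: measurable_mask_sqr; apply: measurable_funD => //; exact: measurable_funM.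
  by apply/funext => w; rewrite /mask_prod big_geq// mulr1.
rewrite (_ : mask_prod n N.+1 = fun w => mask_prod n N w * mask_sqr n (w / 2 ^+ N.+2)).
  by apply: measurable_funM => //; apply: measurable_mask_sqr; exact: measurable_funM.
by apply/funext => w; exact: mask_prod_recr.
Qed.

Lemma spectrum_le_of_sqr psi w (b : R) : 0 <= b ->
  spectrum psi w ^+ 2 <= b ^+ 2 -> spectrum psi w <= b.
Proof. by move=> b0; rewrite ler_sqr ?nnegrE ?spectrum_ge0. Qed.

Lemma spectrum0 n psi : is_daubechies_wavelet n.+1 psi -> spectrum psi 0 = 0.
Proof.
move=> hpsi; apply/eqP; rewrite -sqrf_eq0 eq_le sqr_ge0 andbT.
apply: (le_trans (sqr_spectrum_le 0 0 hpsi)); apply: (le_trans (mask_prod_le_first _ _ _)).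
by rewrite /mask_sqr mul0r add0r cospi mask_polyN mask_poly1 subrr.
Qed.

Lemma sin_sqr_le (x : R) : `|x| <= 1 -> sin x ^+ 2 <= x ^+ 2.
Proof.
have pos (y : R) : 0 <= y <= 1 -> sin y ^+ 2 <= y ^+ 2.
  move=> /andP[y0 y1]; rewrite lerXn2r ?nnegrE//.
    by rewrite sin_ge0_pi// y0 (le_trans y1)// (le_trans _ (@pi_ge2 R))//; lra.
  by apply: (le_trans (sin_le_taylor 0 y0)); rewrite /= mulr1.
have [x0|x0] := leP 0 x; first by rewrite ger0_norm// => x1; apply: pos; rewrite x0.
rewrite ltr0_norm// => x1; rewrite -(sqrrN (sin x)) -sinN -(sqrrN x); apply: pos.
by rewrite x1 oppr_ge0 ltW.
Qed.

(** The factor [H (w/2 + pi)] alone has a zero at 0 of high enough order; this bound is later spent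
    on [|w|^(-k)]. *)
Lemma spectrum_le_small n psi w : is_daubechies_wavelet n.+1 psi -> `|w| <= 1 ->
  spectrum psi w <= `|w| ^+ n.
Proof.
move=> hpsi w1; apply: spectrum_le_of_sqr; first exact: exprn_ge0.
apply: (le_trans (sqr_spectrum_le w 0 hpsi)); apply: (le_trans (mask_prod_le_first _ _ _)).
have w2 : `|w / 2| <= 1 / 2 by rewrite normrM (@ger0_norm _ 2^-1)// ler_wpM2r.
have c0 : cos (w / 2 + pi) <= 0.
  rewrite cosDpi oppr_le0; apply: cos_ge0_pihalf; rewrite -ler_norml (le_trans w2)//.
  by have := @pi_ge2 R; lra.
apply: (le_trans (mask_sqr_le n c0)); rewrite sinDpi sqrrN [leRHS]exprAC.
have s0 : 0 <= (sin (w / 2) ^+ 2) ^+ n by rewrite exprn_ge0// sqr_ge0.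
apply: (@le_trans _ _ ((sin (w / 2) ^+ 2) ^+ n)).
  by rewrite ler_pdivrMr// ler_peMr// ler1n.
rewrite lerXn2r ?nnegrE ?sqr_ge0//.
apply: (le_trans (sin_sqr_le _)); first by rewrite (le_trans w2)//; lra.
rewrite -(real_normK (num_real (w / 2))) lerXn2r ?nnegrE// normrM (@ger0_norm _ 2^-1)//.
by have := normr_ge0 w; lra.
Qed.

(** The spectrum is a square root of the product of squared masks, so [n >= 10] provides the five
    powers of the damping product that [prod_damping_decay] needs. *)
Lemma spectrum_le_large n psi w : is_daubechies_wavelet n.+1 psi -> (10 <= n)%N -> 1 <= `|w| ->
  spectrum psi w <= 4 * 86 ^+ 5 / w ^+ 2.
Proof.
move=> hpsi n10 /prod_damping_decay [N]; set D := \prod_(_ <= _ < _) _ => DN.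
have [D0 D1] : 0 <= D /\ D <= 1.
  rewrite /D; elim/big_ind : _ => [|x y [x0 x1] [y0 y1]|l _]; first by split.
    by rewrite mulr_ge0// mulr_ile1.
  by case/andP: (damping_bounds (w / 2 ^+ l.+1)).
apply: le_trans DN; apply: spectrum_le_of_sqr; first exact: exprn_ge0.
apply: (le_trans (sqr_spectrum_le w N hpsi)); apply: (le_trans (mask_prod_le_damping _ _ _)).
by rewrite -/D -exprM ler_wiXn2l.
Qed.

Lemma spectrum_decay n k psi w : is_daubechies_wavelet n.+1 psi ->
  (10 <= n)%N -> (k <= n)%N ->
  spectrum psi w * `|w| ^- k <= (8 * 86 ^+ 5 + 2) / (1 + w ^+ 2).
Proof.
move=> hpsi n10 kn; have D0 := one_plus_sqr_gt0 w.
have c86 : 0 <= 86 ^+ 5 :> R by rewrite exprn_ge0.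
have inv_ge0 : 0 <= `|w| ^- k by rewrite invr_ge0 exprn_ge0.
have [->|w0] := eqVneq w 0.
  by rewrite (spectrum0 hpsi) mul0r divr_ge0 ?addr_ge0 ?mulr_ge0// expr0n addr0.
have n0 : 0 < `|w| by rewrite normr_gt0.
have [w1|w1] := leP 1 `|w|.
  apply: (@le_trans _ _ (4 * 86 ^+ 5 / w ^+ 2)).
    rewrite -[leRHS]mulr1; apply: ler_pM => //; first exact: spectrum_ge0.
      exact: (spectrum_le_large hpsi n10 w1).
    by rewrite invf_le1 ?exprn_gt0// exprn_ege1.
  have w2 : 1 <= w ^+ 2 by rewrite -(real_normK (num_real w)) exprn_ege1.
  rewrite ler_pdivrMr; last by rewrite (lt_le_trans ltr01).
  rewrite mulrAC ler_pdivlMr//.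
  move: (86 ^+ 5) (w ^+ 2) c86 w2; clear => c u c0 u1.
  have : 0 <= c * (u - 1) by rewrite mulr_ge0 ?subr_ge0.
  lra.
apply: (@le_trans _ _ 1); last first.
  rewrite ler_pdivlMr// mul1r.
  have : w ^+ 2 <= 1 by rewrite -(real_normK (num_real w)) exprn_ile1// ltW.
  by move: (86 ^+ 5) (w ^+ 2) c86; clear=> c u c0 u1; lra.
rewrite ler_pdivrMr ?exprn_gt0// mul1r.
by apply: (le_trans (spectrum_le_small hpsi (ltW w1))); rewrite ler_wiXn2l// ltW.
Qed.

End daubechies_spectrum.

(** * Passage to the limit for the Daubechies wavelets *)

Section daubechies_limit.
Context {R : realType}.
Local Notation mu := (@lebesgue_measure R).
Implicit Types (n N k : nat) (w : R).
Context (psi : nat -> R -> R[i]) (hpsi : forall n, is_daubechies_wavelet n.+1 (psi n)).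

Definition band w : R := if pi < `|w| < 2 * pi then 1 else 0.

Lemma band_ge0 w : 0 <= band w.
Proof. by rewrite /band; case: ifP. Qed.

Lemma measurable_band : measurable_fun setT band.
Proof.
apply: measurable_fun_ifT => //; apply: measurable_and; apply: measurable_fun_ltr => //;
  exact: measurableT_comp.
Qed.

Lemma sin_sqr_lt1 (t : R) : cos t != 0 -> sin t ^+ 2 < 1.
Proof. by move=> ct; rewrite sin2cos2 gtrBl exprn_even_gt0. Qed.

Lemma cvg_expr_lt1 (a : R) : 0 <= a < 1 -> (fun n => a ^+ n) @ \oo --> (0 : R).
Proof. by move=> /andP[a0 a1]; apply: cvg_expr; rewrite ger0_norm. Qed.

(** Below [pi] the factor at [w/2 + pi] tends to 0 geometrically; above [2 pi] one factor of the
    infinite product does. In the band [mask_prod_ge] provides a lower bound uniform in the number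
    of factors and tending to 1. *)
Lemma cvg_sqr_spectrum w : `|w| != pi -> `|w| != 2 * pi ->
  (fun n => spectrum (psi n) w ^+ 2) @ \oo --> band w.
Proof.
move=> w1 w2; have p2 := @pi_ge2 R.
have up (a : R) : 0 <= a < 1 -> (forall n, spectrum (psi n) w ^+ 2 <= a ^+ n) ->
    (fun n => spectrum (psi n) w ^+ 2) @ \oo --> (0 : R).
  move=> a01 H; apply: (squeeze_cvgr _ (cvg_cst 0) (cvg_expr_lt1 a01)).
  by apply: nearW => n; rewrite sqr_ge0 H.
have nh : `|w / 2| = `|w| / 2 by rewrite normrM (@ger0_norm _ 2^-1).
have nq : `|w / 4| = `|w| / 4 by rewrite normrM (@ger0_norm _ 4^-1).
rewrite /band; have [wp|wp|/eqP] := ltgtP `|w| pi; last by rewrite (negbTE w1).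
  have c0 : 0 < cos (w / 2) by apply: cos_gt0_pihalf; rewrite -ltr_norml nh; lra.
  apply: (up (sin (w / 2) ^+ 2)); first by rewrite sqr_ge0 sin_sqr_lt1// gt_eqF.
  move=> n; apply: (le_trans (sqr_spectrum_le w 0 (hpsi n))).
  apply: (le_trans (mask_prod_le_first _ _ _)).
  have cp : cos (w / 2 + pi) <= 0 by rewrite cosDpi oppr_le0 ltW.
  apply: (le_trans (mask_sqr_le n cp)); rewrite sinDpi sqrrN.
  by rewrite ler_pdivrMr// ler_peMr ?ler1n// exprn_ge0 ?sqr_ge0.
have [wp'|wp'|/eqP] := ltgtP `|w| (2 * pi); last by rewrite (negbTE w2).
  have ch : cos (w / 2) < 0.
    suff : cos `|w / 2| < 0 by case: (ger0P (w / 2)) => _; rewrite ?cosN.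
    by rewrite nh -cos_pihalf ltr_cos ?in_itv /=; lra.
  have cq : 0 < cos (w / 4) by apply: cos_gt0_pihalf; rewrite -ltr_norml nq; lra.
  have lim : (fun n => (1 - (sin (w / 2) ^+ 2) ^+ n) * (1 - (sin (w / 4) ^+ 2) ^+ n)) @ \oo --> (1 : R).
    have one_sub (a : R) : 0 <= a < 1 -> (fun n => 1 - a ^+ n) @ \oo --> (1 : R).
      move=> /cvg_expr_lt1 /cvgrPdist_le a0; apply/cvgrPdist_le => e /a0.
      by apply: filterS => n; rewrite sub0r normrN subKr.
    have h1 : 0 <= sin (w / 2) ^+ 2 < 1 by rewrite sqr_ge0 sin_sqr_lt1// lt_eqF.
    have h2 : 0 <= sin (w / 4) ^+ 2 < 1 by rewrite sqr_ge0 sin_sqr_lt1// gt_eqF.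
    have := cvgM (one_sub _ h1) (one_sub _ h2); rewrite (mulr1 (1 : R)) => h; exact: h.
  rewrite /=; apply: (@squeeze_cvgr _ _ _ _ _ (fun=> 1)) lim _; last exact: cvg_cst.
  exists 1%N => // n /= n1; apply/andP; split.
    apply: (sqr_spectrum_ge (hpsi n)) => N.
    by apply: mask_prod_ge => //; rewrite wp wp'.
  apply: (le_trans (sqr_spectrum_le w 0 (hpsi n))).
  by apply: (le_trans (mask_prod_le_first _ _ _)); exact: mask_sqr_le1.
have [N [N0 d01]] := damping_lt1_exists wp'.
apply: (up _ d01) => n; apply: (le_trans (sqr_spectrum_le w N (hpsi n))).
exact: mask_prod_le_factor.
Qed.

(** Limit 0 is handled by squeezing, since [y^p <= y] for [0 <= y <= 1]; positive limits use the
    differentiability of the power. *)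
Lemma cvg_powR_ge0 (y : nat -> R) (l p : R) : 1 < p -> (forall n, 0 <= y n) -> 0 <= l ->
  y @ \oo --> l -> (fun n => y n `^ p) @ \oo --> l `^ p.
Proof.
move=> p1 y0; rewrite le_eqVlt => /predU1P[<-|l0]; last exact: cvg_powR.
move=> yl; rewrite powR0; last by rewrite gt_eqF// (lt_trans ltr01).
have /cvgrPdist_le /(_ 1 ltr01) y1 := yl.
apply: (squeeze_cvgr _ (cvg_cst 0) yl).
apply: filterS y1 => n; rewrite sub0r normrN ger0_norm// => y1.
rewrite powR_ge0 /=; have [->|yn0] := eqVneq (y n) 0.
  by rewrite powR0// gt_eqF// (lt_trans ltr01).
by apply: ge1r_powR; [rewrite lt_neqAle eq_sym yn0 y0|exact: ltW].
Qed.

Lemma cvg_weight_spectrum k p w : 1 < p -> `|w| != pi -> `|w| != 2 * pi ->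
  (fun n => weight k p (spectrum (psi n)) w) @ \oo --> weight k p band w.
Proof.
move=> p1 w1 w2; have i0 : 0 <= `|w| ^- k by rewrite invr_ge0 exprn_ge0.
apply: cvg_powR_ge0 => //.
- by move=> n; rewrite mulr_ge0 ?spectrum_ge0.
- by rewrite mulr_ge0 ?band_ge0.
apply: cvgM; last exact: cvg_cst.
have -> : band w = Num.sqrt (band w) by rewrite /band; case: ifP; rewrite ?sqrtr1 ?sqrtr0.
have -> : (fun n => spectrum (psi n) w) = (fun n => Num.sqrt (spectrum (psi n) w ^+ 2)).
  by apply/funext => n; rewrite sqrtr_sqr ger0_norm ?spectrum_ge0.
apply: continuous_cvg; first exact: sqrt_continuous.
exact: cvg_sqr_spectrum.
Qed.

Lemma integrable_weight_band k p : 1 < p ->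
  mu.-integrable setT (fun w => (weight k p band w)%:E).
Proof.
move=> p1; apply: (@integrable_le_cauchy _ _ ((1 + (2 * pi) ^+ 2) `^ p)).
- exact: measurable_weight measurable_band.
- by move=> w; exact: weight_ge0.
have P0 : 0 <= 1 + (2 * pi) ^+ 2 :> R by rewrite addr_ge0// sqr_ge0.
move=> w; apply: weight_le_cauchy => //; first exact: band_ge0.
rewrite /band; case: ifP => [/andP[w1 w2]|_]; last first.
  by rewrite mul0r divr_ge0// ltW// one_plus_sqr_gt0.
apply: (le_trans _ (cauchy_lower (ltW w2))); rewrite mul1r.
have w0 : 1 <= `|w| by rewrite (le_trans _ (ltW w1))// (le_trans _ (@pi_ge2 R))//; lra.
by rewrite invf_le1 ?exprn_ege1// (lt_le_trans ltr01)// exprn_ege1.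
Qed.

Lemma cvg_integral_spectrum_weight k p : 1 < p -> exists A : nat -> R,
  (forall n, (10 <= n)%N -> (k <= n)%N ->
    (\int[mu]_w (weight k p (spectrum (psi n)) w)%:E = (A n)%:E)%E) /\
  A @ \oo --> \int[mu]_w weight k p band w.
Proof.
move=> p1; pose M : R := 8 * 86 ^+ 5 + 2.
have M0 : 0 <= M by rewrite /M addr_ge0// mulr_ge0// exprn_ge0.
pose n0 := maxn 10 k.
have dom n w : (n0 <= n)%N -> weight k p (spectrum (psi n)) w <= M `^ p / (1 + w ^+ 2).
  rewrite geq_max => /andP[n10 kn]; apply: weight_le_cauchy => //; first exact: spectrum_ge0.
  exact: (spectrum_decay w (hpsi n)).
have mW n : measurable_fun [set: R] (weight k p (spectrum (psi n))).
  by apply: measurable_weight; exact: (measurable_spectrum (hpsi n)).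
exists (fun n => \int[mu]_w weight k p (spectrum (psi n)) w); split.
  move=> n n10 kn; rewrite /Rintegral fineK//; apply: integrable_fin_num => //.
  apply: (@integrable_le_cauchy _ _ (M `^ p)) => //; first by move=> w; exact: weight_ge0.
  by move=> w; apply: dom; rewrite geq_max n10.
rewrite -(cvg_shiftn n0).
have [] := @dominated_convergence _ _ R mu setT measurableT
  (fun n w => (weight k p (spectrum (psi (n + n0)%N)) w)%:E)
  (fun w => (weight k p band w)%:E) (fun w => (M `^ p / (1 + w ^+ 2))%:E).
- by move=> n; apply/measurable_EFinP; exact: mW.
- by apply/measurable_EFinP; exact: measurable_weight measurable_band.
- exists [set - pi; pi; - (2 * pi); 2 * pi]; split.
  + by do 3! (apply: measurableU; last exact: measurable_set1); exact: measurable_set1.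
  + by apply: countable_lebesgue_measure0; apply: finite_set_countable; rewrite !finite_setU.
  move=> w /= nw; apply: contrapT => nW; apply: nw => _.
  apply: cvg_EFin; first exact: nearW.
  rewrite (cvg_shiftn n0 (fun n => weight k p (spectrum (psi n)) w)).
  apply: cvg_weight_spectrum => //; apply/eqP => wE; apply: nW.
    move: wE; have [_ ->|_ <-] := ger0P w; first by left; left; right.
    by left; left; left; rewrite opprK.
  move: wE; have [_ ->|_ <-] := ger0P w; first by right.
  by left; right; rewrite opprK.
- exact: integrable_scaled_cauchy.
- apply: aeW => w n _; rewrite gee0_abs ?lee_fin ?weight_ge0//.
  by rewrite dom// leq_addl.
move=> _ _ lim; apply: fine_cvg; rewrite /Rintegral fineK; first exact: lim.
by apply: integrable_fin_num => //; exact: integrable_weight_band.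
Qed.

Definition band_mass k p : R := \int[mu]_w weight k p band w.

Lemma band_mass_ge k p e : 1 < p -> 0 < e <= 1 ->
  ((pi + e) ^- k) `^ p * (e / 2) <= band_mass k p.
Proof.
move=> p1 /andP[e0 e1]; have p2 := @pi_ge2 R.
(* The closed interval starts at [pi + e/2] because the band is open at [pi]. *)
have -> : e / 2 = (pi + e) - (pi + e / 2) by move: (@pi R) => P; field.
apply: Rintegral_ge_itv; [exact: integrable_weight_band|by move=> w; exact: weight_ge0|lra|].
move=> w /andP[w1 w2]; have w0 : 0 < w by lra.
have wb : pi < w < 2 * pi by lra.
rewrite /weight /band gtr0_norm// wb mul1r; apply: ge0_ler_powR.
- by rewrite (le_trans ler01)// ltW.
- by rewrite nnegrE invr_ge0 exprn_ge0//; lra.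
- by rewrite nnegrE invr_ge0 exprn_ge0// ltW.
have pe0 : 0 < pi + e by lra.
by rewrite lef_pV2 ?posrE ?exprn_gt0// lerXn2r ?nnegrE// ltW.
Qed.

Lemma band_mass_le k p : 1 < p -> band_mass k p <= (pi ^- k) `^ p * band_mass 0 p.
Proof.
move=> p1; have i0 := integrable_weight_band 0 p1.
rewrite /band_mass -RintegralZl//; apply: le_Rintegral => //.
- exact: integrable_weight_band.
- by rewrite /comp; under eq_fun do rewrite EFinM; exact: integrableZl.
move=> w _; rewrite weight_scale ?band_ge0//.
rewrite /weight expr0 invr1 mulr1 /band; case: ifP => [/andP[w1 w2]|_]; last first.
  by rewrite powR0 ?mulr0// gt_eqF// (lt_trans ltr01).
have P0 := @pi_gt0 R; have w0 := lt_trans P0 w1.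
rewrite ler_wpM2r ?powR_ge0//; apply: ge0_ler_powR.
- by rewrite (le_trans ler01)// ltW.
- by rewrite nnegrE invr_ge0 exprn_ge0.
- by rewrite nnegrE invr_ge0 exprn_ge0// ltW.
by rewrite lef_pV2 ?posrE ?exprn_gt0// lerXn2r ?nnegrE// ltW.
Qed.

Lemma band_mass_gt0 k p : 1 < p -> 0 < band_mass k p.
Proof.
move=> p1; have := @band_mass_ge k p 1 p1; rewrite ltr01 lexx => /(_ isT).
apply: lt_le_trans; rewrite mulr_gt0// powR_gt0// invr_gt0 exprn_gt0//.
by rewrite addr_gt0 ?pi_gt0.
Qed.

Lemma Ckp_daubechies k p : 1 < p -> exists d : nat -> R,
  (\forall n \near \oo, Ckp k%:Z p (psi n) = (d n)%:E) /\
  d @ \oo --> (band_mass k p / band_mass 0 p) `^ p^-1.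
Proof.
move=> p1; have p0 : 0 < p by exact: lt_trans p1.
have [a [ia la]] := cvg_integral_spectrum_weight k p1.
have [b [ib lb]] := cvg_integral_spectrum_weight 0 p1.
have b0 := band_mass_gt0 0 p1; have a0 := band_mass_gt0 k p1.
rewrite -/(band_mass k p) in la; rewrite -/(band_mass 0 p) in lb.
move: (band_mass k p) (band_mass 0 p) a0 b0 la lb => A B a0 b0 la lb.
exists (fun n => (a n / b n) `^ p^-1); split; last first.
  apply: cvg_powR; first by rewrite divr_gt0.
  apply: (cvgM la); by apply: (cvgV _ lb); rewrite gt_eqF.
have bn0 : \forall n \near \oo, 0 < b n by exact: (@cvgr_gt _ _ _ _ b _ lb 0 b0).
near=> n.
have n10 : (10 <= n)%N by near: n; exact: nbhs_infty_ge.
have kn : (k <= n)%N by near: n; exact: nbhs_infty_ge.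
have bn : 0 < b n by near: n; exact: bn0.
set c : R := (Num.sqrt (2 * pi))^-1.
have c0 : 0 < c by rewrite invr_gt0 sqrtr_gt0 mulr_gt0// pi_gt0.
have sc j d : (\int[mu]_w (weight j p (spectrum (psi n)) w)%:E = d%:E)%E ->
    (\int[mu]_w (weight j p (fun t => cmod (fourier (psi n) t)) w)%:E = (c `^ p * d)%:E)%E.
  apply: integral_weight_scaled; [exact: ltW|exact: spectrum_ge0|exact: (measurable_spectrum (hpsi n))|].
  move=> w _; rewrite /spectrum mulrA mulVf ?mul1r// gt_eqF//.
  by rewrite sqrtr_gt0 mulr_gt0// pi_gt0.
have cp0 : 0 < c `^ p by exact: powR_gt0.
rewrite (Ckp_weight p0 _ (sc _ _ (ia n n10 kn)) (sc _ _ (ib n n10 isT))) ?mulr_gt0//.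
by rewrite -mulf_div divff ?mul1r// gt_eqF.
Unshelve. all: by end_near. Qed.

End daubechies_limit.

(** * The limit *)

Section limit_in_k.
Context {R : realType}.
Implicit Types (k : nat) (p x : R).

Lemma powR_root x k : 0 <= x -> (0 < k)%N -> (x ^+ k) `^ k%:R^-1 = x.
Proof.
move=> x0 k0; rewrite -(powR_mulrn k x0) -powRrM mulfV ?powRr1//.
by rewrite pnatr_eq0 -lt0n.
Qed.

Lemma cvg_root (c : R) : 0 < c -> (fun k => c `^ k%:R^-1) @ \oo --> (1 : R).
Proof.
move=> c0; have -> : (fun k : nat => c `^ k%:R^-1) = (fun k => expR (k%:R^-1 * ln c)).
  by apply/funext => k; rewrite /powR gt_eqF.
rewrite -[X in _ --> X]expR0; apply: continuous_cvg; first exact: continuous_expR.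
have h : (fun k : nat => (k%:R^-1 : R)) @ \oo --> (0 : R).
  by rewrite -(cvg_shiftn 1); under eq_fun do rewrite addn1; exact: cvg_harmonic.
have := cvgM h (@cvg_cst _ (ln c) _ \oo _); rewrite mul0r => H; exact: H.
Qed.

Lemma powR_ratio_le (a b x p : R) : 0 < p -> 0 <= a -> 0 < b -> 0 <= x ->
  a <= x `^ p * b -> (a / b) `^ p^-1 <= x.
Proof.
move=> p0 a0 b0 x0 H; rewrite -[leRHS](powR_inv x0 (lt0r_neq0 p0)).
apply: ge0_ler_powR; rewrite ?nnegrE.
- by rewrite invr_ge0 ltW.
- by rewrite divr_ge0// ltW.
- exact: powR_ge0.
- by rewrite ler_pdivrMr.
Qed.

Lemma powR_ratio_ge (a b c x p : R) : 0 < p -> 0 < b -> 0 <= c -> 0 <= x ->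
  x `^ p * c <= a -> x * (c / b) `^ p^-1 <= (a / b) `^ p^-1.
Proof.
move=> p0 b0 c0 x0 H; have xp0 := powR_ge0 x p.
have cb0 : 0 <= c / b by rewrite divr_ge0// ltW.
rewrite -{1}(powR_inv x0 (lt0r_neq0 p0)) -(powRM _ xp0 cb0).
apply: ge0_ler_powR; rewrite ?nnegrE.
- by rewrite invr_ge0 ltW.
- exact: mulr_ge0.
- by rewrite divr_ge0 ?(ltW b0)// (le_trans _ H)// mulr_ge0.
- by rewrite mulrA ler_wpM2r// invr_ge0 ltW.
Qed.

(** The [k]-th root sends the constant [K] to 1, whatever its size, so for each [e] the roots are
    eventually squeezed between [P / v] and a number close to [(P + e) / v]. *)
Lemma cvg_root_of_bounds (P v : R) (r : nat -> R) : 0 < P -> 0 < v ->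
  (forall k, r k <= P ^- k) ->
  (forall e, 0 < e <= 1 -> exists2 K, 0 < K & forall k, (P + e) ^- k * K <= r k) ->
  (fun k => (v ^- k / r k) `^ k%:R^-1) @ \oo --> P / v.
Proof.
move=> P0 v0 r_le r_ge; apply/cvgrPdist_le => e0 e00.
pose e := Num.min 1 (e0 / 2 * v).
have e02 : 0 < e0 / 2 by rewrite divr_gt0.
have e_gt0 : 0 < e by rewrite lt_min ltr01 mulr_gt0.
have e_le1 : e <= 1 by rewrite ge_min lexx.
have e_le : e <= e0 / 2 * v by rewrite ge_min lexx orbT.
have Pe : 0 < P + e by rewrite addr_gt0.
have [|K K0 rK] := r_ge e; first by rewrite e_gt0.
have lim : (fun k => (P + e) / v * (K^-1) `^ k%:R^-1) @ \oo --> (P + e) / v.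
  have Ki0 : 0 < K^-1 by rewrite invr_gt0.
  by rewrite -[X in _ --> X]mulr1; apply: cvgM; [exact: cvg_cst|exact: cvg_root].
move/cvgrPdist_le : lim => /(_ _ e02) near_lim.
near=> k.
have k0 : (0 < k)%N by near: k; exact: nbhs_infty_gt.
have : `|(P + e) / v - (P + e) / v * (K^-1) `^ k%:R^-1| <= e0 / 2 by near: k; exact: near_lim.
rewrite ler_norml => /andP[+ _]; set S := _ * _ `^ _ => hS.
have rk0 : 0 < r k by apply: lt_le_trans (rK k); rewrite mulr_gt0// invr_gt0 exprn_gt0.
have vk0 : 0 <= v ^- k by rewrite invr_ge0 exprn_ge0// ltW.
have ki0 : 0 <= (k%:R^-1 : R) by rewrite invr_ge0.
have q0 : 0 <= v ^- k / r k by rewrite divr_ge0// ltW.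
have lo : P / v <= (v ^- k / r k) `^ k%:R^-1.
  have Pv : 0 <= P / v by rewrite divr_ge0// ltW.
  rewrite -[leLHS](powR_root Pv k0); apply: ge0_ler_powR; rewrite ?nnegrE//.
    exact: exprn_ge0.
  rewrite ler_pdivlMr// expr_div_n mulrAC mulrC ler_piMr//.
  by rewrite mulrC -ler_pdivlMr ?exprn_gt0// div1r.
have hi : (v ^- k / r k) `^ k%:R^-1 <= S.
  have Pv : 0 <= (P + e) / v by rewrite divr_ge0// ltW.
  have Ki : 0 <= K^-1 by rewrite invr_ge0 ltW.
  have Pk : 0 <= ((P + e) / v) ^+ k by rewrite exprn_ge0.
  rewrite /S -{1}(powR_root Pv k0) -(powRM _ Pk Ki); apply: ge0_ler_powR; rewrite ?nnegrE//.
    exact: mulr_ge0.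
  have Kk0 : 0 < (P + e) ^- k * K by rewrite mulr_gt0// invr_gt0 exprn_gt0.
  have -> : ((P + e) / v) ^+ k / K = v ^- k * ((P + e) ^- k * K)^-1.
    by rewrite expr_div_n (invfM _ K) invrK; ring.
  by rewrite ler_wpM2l// lef_pV2 ?posrE.
have eP : (P + e) / v <= P / v + e0 / 2.
  by rewrite mulrDl lerD2l ler_pdivrMr.
by rewrite ler_norml; apply/andP; split; lra.
Unshelve. all: by end_near. Qed.

(** The inner limit, in [m], for fixed [k]. *)
Definition limit_ratio p (w0 : R) k : R :=
  (w0 ^- k / (band_mass k p / band_mass 0 p) `^ p^-1) `^ k%:R^-1.

Lemma cvg_limit_ratio p (w0 : R) : 1 < p -> 0 < w0 -> limit_ratio p w0 @ \oo --> pi / w0.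
Proof.
move=> p1 w00; have p0 : 0 < p by exact: lt_trans p1.
have b0 := band_mass_gt0 0 p1; have P0 := @pi_gt0 R.
apply: cvg_root_of_bounds => //.
  move=> k; apply: (powR_ratio_le p0 _ b0 _ (band_mass_le k p1)).
    exact: (ltW (band_mass_gt0 k p1)).
  by rewrite invr_ge0 exprn_ge0// ltW.
move=> e e01; have /andP[e_gt0 _] := e01.
have e2 : 0 < e / 2 by rewrite divr_gt0.
exists ((e / 2 / band_mass 0 p) `^ p^-1); first by rewrite powR_gt0 ?divr_gt0.
move=> k; apply: (powR_ratio_ge p0 b0 (ltW e2) _ (band_mass_ge k p1 e01)).
by rewrite invr_ge0 exprn_ge0// ltW// addr_gt0.
Qed.

Lemma cvg_Ckp_ratio (x0 p : R) (psi : nat -> R -> R[i]) k :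
  57 / 100 < x0 < 58 / 100 -> peak_eqn x0 = 0 -> 1 < p ->
  (forall m, (0 < m)%N -> is_daubechies_wavelet m (psi m)) -> (0 < k)%N ->
  (fun m => poweR (Ckp k%:Z p (@spline_waveletC R m) / Ckp k%:Z p (psi m))%E (k%:R^-1)) @ \oo -->
  (limit_ratio p (2 * (pi - x0)) k)%:E.
Proof.
move=> x0n x0p p1 hpsi k0.
have w00 : 0 < 2 * (pi - x0) by have := @pi_ge2 R; lra.
have [s [sE ls]] := Ckp_spline k x0n x0p p1.
have [d [dE ld]] := Ckp_daubechies (fun n => hpsi n.+1 isT) k p1.
have b0 := band_mass_gt0 0 p1; have a0 := band_mass_gt0 k p1.
have L0 : 0 < (band_mass k p / band_mass 0 p) `^ p^-1 by exact: (powR_gt0 _ (divr_gt0 a0 b0)).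
rewrite /limit_ratio; move: (_ `^ p^-1) L0 ld => L L0 ld.
(* The wavelet of order 0 is arbitrary, so the sequence [d] is indexed from order 1. *)
rewrite -(cvg_shiftn 1).
have ls1 : (fun n => s (n + 1)%N) @ \oo --> (2 * (pi - x0)) ^- k by rewrite (cvg_shiftn 1 s).
have lsd : (fun n => (s (n + 1)%N / d n) `^ k%:R^-1) @ \oo --> ((2 * (pi - x0)) ^- k / L) `^ k%:R^-1.
  apply: cvg_powR; first by rewrite divr_gt0// invr_gt0 exprn_gt0.
  by apply: (cvgM ls1); apply: (cvgV _ ld); rewrite gt_eqF.
have dn0 : \forall n \near \oo, 0 < d n by exact: (@cvgr_gt _ _ _ _ d _ ld 0 L0).
have lsdE : (fun n => ((s (n + 1)%N / d n) `^ k%:R^-1)%:E) @ \oo -->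
    (((2 * (pi - x0)) ^- k / L) `^ k%:R^-1)%:E.
  by apply: cvg_EFin; [exact: nearW|exact: lsd].
apply: cvg_trans lsdE; apply: near_eq_cvg; near=> n.
have dn : 0 < d n by near: n; exact: dn0.
have kn : (k.+1 < n + 1)%N by near: n; exists k.+1 => // n /=; rewrite addn1.
have dnE : Ckp k%:Z p (psi (n + 1)%N) = (d n)%:E.
  by rewrite addn1; near: n; exact: dE.
by rewrite /= (sE _ kn) dnE inver (gt_eqF dn) -EFinM poweR_EFin.
Unshelve. all: by end_near. Qed.

End limit_in_k.

Lemma xi2_eqnE (R : realType) (x : R) : xi2_eqn x <-> peak_eqn (2 * x) = 0.
Proof.
rewrite /xi2_eqn /peak_eqn.
have -> : (2 * pi * x - 4 * x ^+ 2) = pi * (2 * x) - (2 * x) ^+ 2 by move: (@pi R) => P; ring.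
by have -> : 3 * x - pi = 3 / 2 * (2 * x) - pi by move: (@pi R) => P; field.
Qed.

Unset Implicit Arguments.
Set Strict Implicit.
Set Printing Implicit Defensive.

Theorem corollary4 (R : realType) (p : R) (hp : 1 < p)
    (psiD : nat -> R -> R[i])
    (hD : forall m : nat, (0 < m)%N -> is_daubechies_wavelet m (psiD m)) :
  exists xi2 : R,
    [/\ unique (fun x : R => 0 < x < pi / 2 /\ xi2_eqn x) xi2,
        28 / 10 ^+ 2 + 53 / 10 ^+ 4 <= xi2 < 28 / 10 ^+ 2 + 54 / 10 ^+ 4,
        61 / 10 ^+ 2 + 98 / 10 ^+ 5 <= pi / (2 * pi - 4 * xi2)
          < 61 / 10 ^+ 2 + 99 / 10 ^+ 5
      & exists ell : nat -> R,
          (forall k : nat, (0 < k)%N ->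
            (fun m : nat =>
               poweR (Ckp k%:Z p (@spline_waveletC R m) / Ckp k%:Z p (psiD m))%E
                     (k%:R^-1)) @ \oo --> (ell k)%:E) /\
          ell @ \oo --> pi / (2 * pi - 4 * xi2)].
Proof.
have [x0 /andP[x0l x0u] x0p] := @peak_exists R.
have x0n : 57 / 100 < x0 < 58 / 100 by lra.
have p2 := @pi_ge2 R; have [pl pu] := @pi_bounds R.
have w0E : 2 * pi - 4 * (x0 / 2) = 2 * (pi - x0) by move: (@pi R) => P; field.
have w00 : 0 < 2 * (pi - x0) by lra.
have h2 : 2 * (x0 / 2) = x0 by field.
exists (x0 / 2); rewrite w0E; split.
- split; first by rewrite xi2_eqnE h2; split => //; lra.
  move=> y [y01 /xi2_eqnE y_eqn].
  have -> : y = 2 * y / 2 by field.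
  by rewrite (@peak_uniq R x0 (2 * y))//; lra.
- lra.
- by rewrite ler_pdivlMr// ltr_pdivrMr//; lra.
exists (limit_ratio p (2 * (pi - x0))); split; last exact: cvg_limit_ratio.
by move=> k k0; exact: cvg_Ckp_ratio.
Qed.
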